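(* Let $(\mathbf u,\xi,p,T)$ be the solution of the four-field variational thermo-poroelasticity problem (VP), and let $(\mathbf u_h^{n+1},\xi_h^{n+1},p_h^{n+1},T_h^{n+1})$, $n\ge1$, be the solution of the sequential semi-decoupled scheme Algorithm 2 (reaction-diffusion first, then elasticity), that is: $(\mathbf u_h^1,\xi_h^1,p_h^1,T_h^1)$ is computed from the provided initial value $(\mathbf u_h^0,\xi_h^0,p_h^0,T_h^0)$ by the coupled initial step, and for $n\ge 1$ the functions $(p_h^{n+1},T_h^{n+1})\in W_h\times W_h$ and then $(\mathbf u_h^{n+1},\xi_h^{n+1})\in\mathbf V_h\times Q_h$ satisfy, for all $(\mathbf v_h,\phi_h,q_h,S_h)\in\mathbf V_h\times Q_h\times W_h\times W_h$, $$c_\alpha\Big(\tfrac{p_h^{n+1}-p_h^n}{\Delta t},q_h\Big)+(\mathbf K\nabla p_h^{n+1},\nabla q_h)+c_{\alpha\beta}\Big(\tfrac{T_h^{n+1}-T_h^n}{\Delta t},q_h\Big)=\tfrac\alpha\lambda\Big(\tfrac{\xi_h^{n}-\xi_h^{n-1}}{\Delta t},q_h\Big)+(g^{n+1},q_h),$$ $$c_\beta\Big(\tfrac{T_h^{n+1}-T_h^n}{\Delta t},S_h\Big)+(\boldsymbol\Theta\nabla T_h^{n+1},\nabla S_h)+c_{\alpha\beta}\Big(\tfrac{p_h^{n+1}-p_h^n}{\Delta t},S_h\Big)=\tfrac\beta\lambda\Big(\tfrac{\xi_h^{n}-\xi_h^{n-1}}{\Delta t},S_h\Big)+(H_s^{n+1},S_h),$$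 $$2\mu(\boldsymbol\varepsilon(\mathbf u_h^{n+1}),\boldsymbol\varepsilon(\mathbf v_h))-(\nabla\cdot\mathbf v_h,\xi_h^{n+1})=(\mathbf f^{n+1},\mathbf v_h),$$ $$(\nabla\cdot\mathbf u_h^{n+1},\phi_h)+\tfrac1\lambda(\xi_h^{n+1},\phi_h)=\tfrac\alpha\lambda(p_h^{n+1},\phi_h)+\tfrac\beta\lambda(T_h^{n+1},\phi_h).$$ Set $e_{\mathbf u}^{h,n}=\Pi^{\mathbf V_h}\mathbf u^n-\mathbf u_h^n$, $e_\xi^{h,n}=\Pi^{Q_h}\xi^n-\xi_h^n$, $e_p^{h,n}=\Pi^{W_{p,h}}p^n-p_h^n$, $e_T^{h,n}=\Pi^{W_{T,h}}T^n-T_h^n$. Then, for $N\ge1$ with $t_{N+1}$ in the time partition, $$\mu\|\boldsymbol\varepsilon(e_{\mathbf u}^{h,N+1})\|_{L^2(\Omega)}^2+\|e_\xi^{h,N+1}\|_{L^2(\Omega)}^2+\tfrac{c_0-b_0}{2}\|e_p^{h,N+1}\|_{L^2(\Omega)}^2+\tfrac{a_0-b_0}{2}\|e_T^{h,N+1}\|_{L^2(\Omega)}^2$$ $$+\Delta t\sum_{n=1}^N\Big((\mathbf K\nabla e_p^{h,n+1},\nabla e_p^{h,n+1})+(\boldsymbol\Theta\nabla e_T^{h,n+1},\nabla e_T^{h,n+1})\Big)\le\tilde C_1\Delta t^2+\tilde C_2h^{2k}+\tilde C_3h^{2l+2},$$ where $$\tilde C_1=\tilde C\Big(\int_0^\tau\|\mathbf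 u_{tt}\|_{H^1(\Omega)}^2+\int_0^\tau\|\xi_{tt}\|_{L^2(\Omega)}^2+\int_0^\tau\|p_{tt}\|_{L^2(\Omega)}^2+\int_0^\tau\|T_{tt}\|_{L^2(\Omega)}^2\Big),$$ $$\tilde C_2=\tilde C\Big(\int_0^\tau\|\xi_t\|_{H^k(\Omega)}^2+\int_0^\tau\|\mathbf u_t\|_{H^{k+1}(\Omega)}^2\Big),\qquad \tilde C_3=\tilde C\Big(\int_0^\tau\|p_t\|_{H^{l+1}(\Omega)}^2+\int_0^\tau\|T_t\|_{H^{l+1}(\Omega)}^2\Big),$$ and $\tilde C=\tilde C(\alpha,\beta,\lambda,a_0,b_0,c_0)$.
   Context: Setting. $\Omega\subset\mathbb R^d$, $d=2$ or $3$, is a bounded domain, $J=(0,\tau)$ with final time $\tau$, $\partial\Omega=\Gamma_d\cup\Gamma_n$ with $\Gamma_d\ne\partial\Omega$. $(\cdot,\cdot)$ is the $L^2(\Omega)$ inner product, $\boldsymbol\varepsilon(\mathbf u)=\frac12(\nabla\mathbf u+\nabla\mathbf u^T)$, subscripts $t,tt$ are time derivatives. $\mathbf V=[H^1_{0,\Gamma_d}(\Omega)]^d$ (vector $H^1$ functions vanishing on $\Gamma_d$), $Q=L^2(\Omega)$, $W=H_0^1(\Omega)$. Parameters. (A1) $\mathbf K,\boldsymbol\Theta$ are $d\times d$ matrices, constant in time, symmetric and positive definite, with constants $k_m,k_M,\theta_m,\theta_M>0$ such that $k_m|\mathbf v|^2\le\mathbf v^T\mathbf K(x)\mathbf v$,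 $|\mathbf K(x)\mathbf v|\le k_M|\mathbf v|$, $\theta_m|\mathbf v|^2\le\mathbf v^T\boldsymbol\Theta(x)\mathbf v$, $|\boldsymbol\Theta(x)\mathbf v|\le\theta_M|\mathbf v|$ for all $\mathbf v\in\mathbb R^d$. (A2) $\lambda,\mu,\alpha,\beta$ are strictly positive constants. (A3) $a_0,b_0,c_0$ are constants with $a_0>b_0$, $c_0>b_0$, $b_0\ge0$. Set $c_\alpha=c_0+\frac{\alpha^2}{\lambda}$, $c_{\alpha\beta}=\frac{\alpha\beta}{\lambda}-b_0$, $c_\beta=a_0+\frac{\beta^2}{\lambda}$. Problem (VP). The initial data satisfy $\mathbf u^0\in[H^1(\Omega)]^d$, $p^0,T^0\in L^2(\Omega)$, and the sources satisfy $\mathbf f\in[L^2(\Omega)]^d$, $g,H_s\in L^2(\Omega)$. For almost every $t\in(0,\tau]$, find $(\mathbf u,\xi,p,T)\in\mathbf V\times Q\times W\times W$ with, for all $(\mathbf v,\phi,q,S)\in\mathbf V\times Q\times W\times W$, $2\mu(\boldsymbol\varepsilon(\mathbf u),\boldsymbol\varepsilon(\mathbf v))-(\nabla\cdot\mathbf v,\xi)=(\mathbf f,\mathbf v)$; $-(\nabla\cdot\mathbf u,\phi)-\frac1\lambda(\xi,\phi)+\frac\alpha\lambda(p,\phi)+\frac\beta\lambda(T,\phi)=0$; $-\frac\alpha\lambda(\xi_t,q)+c_\alpha(p_t,q)+c_{\alpha\beta}(T_t,q)+(\mathbf K\nabla p,\nabla q)=(g,q)$; $-\frac\beta\lambda(\xi_t,S)+c_{\alpha\beta}(p_t,S)+c_\beta(T_t,S)+(\boldsymbol\Theta\nabla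 T,\nabla S)=(H_s,S)$; with $\mathbf u(0)=\mathbf u^0$, $p(0)=p^0$, $T(0)=T^0$, $\xi(0)=\xi^0=-\lambda\nabla\cdot\mathbf u^0+\alpha p^0+\beta T^0$. (Boundary conditions are homogeneous: $\mathbf u=0$ on $\Gamma_d$, zero total traction on $\Gamma_n$, $p=T=0$ on $\partial\Omega$.) Regularity assumed of the solution: $\mathbf u\in L^\infty(J;\mathbf H^{k+1}_{0,\Gamma_d}(\Omega))$, $\mathbf u_t\in L^2(J;\mathbf H^{k+1}_{0,\Gamma_d}(\Omega))$, $\mathbf u_{tt}\in L^2(J;\mathbf H^1_{0,\Gamma_d}(\Omega))$; $\xi\in L^\infty(J;H^k(\Omega))$, $\xi_t\in L^2(J;H^k(\Omega))$, $\xi_{tt}\in L^2(J;L^2(\Omega))$; and, for both $w=p$ and $w=T$, $w\in L^\infty(J;H_0^{l+1}(\Omega))$, $w_t\in L^2(J;H_0^{l+1}(\Omega))$, $w_{tt}\in L^2(J;L^2(\Omega))$. Here $H_0^{l+1}(\Omega)$ (resp. $\mathbf H^m_{0,\Gamma_d}(\Omega)$) means $H^{l+1}$ functions vanishing on $\partial\Omega$ (resp. vector $H^m$ functions vanishing on $\Gamma_d$). Discretization. $\mathcal T_h$ is a shape-regular, quasi-uniform family of triangulations of $\Omega$ with maximal element diameter $h$. Taylor-Hood elements are used for $(\mathbf u,\xi)$ and Lagrange elements of degree $l$ for $p,T$: $\mathbf V_h$ = continuous functions in $\mathbf V$ that are piecewise vector polynomials of degree $k$; $Q_h$ = continuous piecewise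 polynomials of degree $k-1$; $W_h$ = continuous functions in $H_0^1(\Omega)$ that are piecewise polynomials of degree $l$. The inf-sup condition holds: $\inf_{\xi\in Q_h}\sup_{\mathbf v\in\mathbf V_h}\frac{(\nabla\cdot\mathbf v,\xi)}{|\mathbf v|_{H^1(\Omega)}\|\xi\|_{L^2(\Omega)}}\ge\gamma>0$ with $\gamma$ independent of $h$. The time partition of $[0,\tau]$ is equidistant with step $\Delta t$ and nodes $t_n=n\Delta t$; $w^n=w(t_n)$. Projections. $\Pi^{\mathbf V_h}:\mathbf V\to\mathbf V_h$, $\Pi^{Q_h}:Q\to Q_h$ satisfy $2\mu(\boldsymbol\varepsilon(\Pi^{\mathbf V_h}\mathbf u),\boldsymbol\varepsilon(\mathbf v_h))-(\nabla\cdot\mathbf v_h,\Pi^{Q_h}\xi)=2\mu(\boldsymbol\varepsilon(\mathbf u),\boldsymbol\varepsilon(\mathbf v_h))-(\nabla\cdot\mathbf v_h,\xi)$ for all $\mathbf v_h\in\mathbf V_h$ and $(\nabla\cdot\Pi^{\mathbf V_h}\mathbf u,\phi_h)=(\nabla\cdot\mathbf u,\phi_h)$ for all $\phi_h\in Q_h$. $\Pi^{W_{p,h}},\Pi^{W_{T,h}}:W\to W_h$ satisfy $(\mathbf K\nabla\Pi^{W_{p,h}}p,\nabla q_h)=(\mathbf K\nabla p,\nabla q_h)$ and $(\boldsymbol\Theta\nabla\Pi^{W_{T,h}}T,\nabla S_h)=(\boldsymbol\Theta\nabla T,\nabla S_h)$ for all $q_h,S_h\in W_h$. They have the properties ($\lesssim$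 meaning inequality up to a multiplicative constant) $\|\nabla(\Pi^{\mathbf V_h}\mathbf u-\mathbf u)\|_{L^2}+\|\Pi^{Q_h}\xi-\xi\|_{L^2}\lesssim h^k\|\mathbf u\|_{H^{k+1}}+h^k\|\xi\|_{H^k}$, $\|\Pi^{W_{p,h}}p-p\|_{L^2}+h\|\nabla(\Pi^{W_{p,h}}p-p)\|_{L^2}\lesssim h^{l+1}\|p\|_{H^{l+1}}$, and the same for $\Pi^{W_{T,h}}T-T$. Initial step. An initial value $(\mathbf u_h^0,\xi_h^0,p_h^0,T_h^0)\in\mathbf V_h\times Q_h\times W_h\times W_h$ is provided. Then $(\mathbf u_h^1,\xi_h^1,p_h^1,T_h^1)\in\mathbf V_h\times Q_h\times W_h\times W_h$ solves, for all test functions in these spaces, the coupled backward Euler system $2\mu(\boldsymbol\varepsilon(\mathbf u_h^1),\boldsymbol\varepsilon(\mathbf v_h))-(\nabla\cdot\mathbf v_h,\xi_h^1)=(\mathbf f^1,\mathbf v_h)$; $-(\nabla\cdot\mathbf u_h^1,\phi_h)-\frac1\lambda(\xi_h^1,\phi_h)+\frac\alpha\lambda(p_h^1,\phi_h)+\frac\beta\lambda(T_h^1,\phi_h)=0$; $-\frac\alpha\lambda(\xi_h^1-\xi_h^0,q_h)+c_\alpha(p_h^1-p_h^0,q_h)+c_{\alpha\beta}(T_h^1-T_h^0,q_h)+\Delta t(\mathbf K\nabla p_h^1,\nabla q_h)=\Delta t(g^1,q_h)$; $-\frac\beta\lambda(\xi_h^1-\xi_h^0,S_h)+c_\beta(T_h^1-T_h^0,S_h)+c_{\alpha\beta}(p_h^1-p_h^0,S_h)+\Delta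 t(\boldsymbol\Theta\nabla T_h^1,\nabla S_h)=\Delta t(H_s^1,S_h)$.
   Formalization: The initial value is taken to be the projection of the exact initial values and to satisfy the discrete second equation at level 0 (for arbitrary ones the bound fails); C̃ may also depend on τ and the constant hidden in ≲; sources are continuous in time in L². *)

(* Defs.v *)
From HB Require Import structures.
From mathcomp Require Import all_boot all_order all_algebra.
From mathcomp Require Import all_classical all_reals all_analysis.
Set Implicit Arguments.
Unset Strict Implicit.
Unset Printing Implicit Defensive.
Import Order.TTheory GRing.Theory Num.Theory.
Import numFieldNormedType.Exports.
Local Open Scope classical_set_scope.
Local Open Scope ring_scope.

(* R^n is the type 'rV[R]_n of row vectors, with the sigma-algebra generated by
   the coordinates (the Borel sigma-algebra). *)
Section MeasurableRV.
Context {R : realType} {n : nat}.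

Definition rV_coord (i : 'I_n) (x : 'rV[R]_n) : measurableTypeR R := x 0 i.

Definition measurable_rV : set (set 'rV[R]_n) := g_sigma_preimage rV_coord.

Let measurable_rV0 : measurable_rV set0.
Proof. exact: sigma_algebra0. Qed.

Let measurable_rVC A : measurable_rV A -> measurable_rV (~` A).
Proof. exact: sigma_algebraC. Qed.

Let measurable_rV_bigcup (F : (set 'rV[R]_n)^nat) :
  (forall i, measurable_rV (F i)) -> measurable_rV (\bigcup_i (F i)).
Proof. exact: sigma_algebra_bigcup. Qed.

HB.instance Definition _ := @isMeasurable.Build default_measure_display
  'rV[R]_n measurable_rV measurable_rV0 measurable_rVC measurable_rV_bigcup.

Lemma measurable_rV_coord (i : 'I_n) : measurable_fun [set: 'rV[R]_n] (rV_coord i).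
Proof.
move=> _ Y mY; rewrite setTI; apply: sub_sigma_algebra => /=.
rewrite -bigcup_seq/=; exists i => /=; first by rewrite mem_index_enum.
by exists Y => //; rewrite setTI.
Qed.

Lemma measurable_fun_rVP d (T : measurableType d) (f : T -> 'rV[R]_n) :
  (forall i, measurable_fun [set: T] (rV_coord i \o f)) ->
  measurable_fun [set: T] f.
Proof.
move=> mf _ A mA; rewrite setTI.
suff : g_sigma_preimage rV_coord `<=`
   [set B : set 'rV[R]_n | measurable (f @^-1` B)].
  by move=> sub; exact: (sub _ mA).
apply: smallest_sub.
  split => [|B mB|F mF] /=.
  - by rewrite preimage_set0.
  - by rewrite setTD preimage_setC; exact: measurableC.
  - by rewrite preimage_bigcup; exact: bigcupT_measurable.
elim/big_rec: _ => [//|i X _ XB]; rewrite subUset; split=> // _ [B mB <-] /=.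
rewrite setTI -comp_preimage.
by have := mf i measurableT B mB; rewrite setTI.
Qed.

End MeasurableRV.

Section LebesgueStep.
Context {R : realType} {n : nat}.
Variable m : {sigma_finite_measure set 'rV[R]_n -> \bar R}.

Definition rV_cons (p : measurableTypeR R * 'rV[R]_n) : 'rV[R]_n.+1 :=
  row_mx (p.1)%:M p.2.

Let rV_cons_l (a : R) (y : 'rV[R]_n) (j : 'I_1) :
  row_mx a%:M y 0 (lshift n j) = a.
Proof. by rewrite row_mxEl !mxE ord1 eqxx mulr1n. Qed.

Let rV_cons_r (a : R) (y : 'rV[R]_n) (j : 'I_n) :
  row_mx a%:M y 0 (rshift 1 j) = y 0 j.
Proof. by rewrite row_mxEr. Qed.

Lemma measurable_rV_cons : measurable_fun setT rV_cons.
Proof.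
apply: measurable_fun_rVP => i.
case: (splitP (i : 'I_(1 + n))) => [j ij|j ij].
  rewrite [X in measurable_fun _ X](_ : _ = fst)//.
  apply/funext => p /=; rewrite /rV_coord /rV_cons.
  rewrite (_ : i = lshift n j); last exact/val_inj.
exact: rV_cons_l.
rewrite [X in measurable_fun _ X](_ : _ = rV_coord j \o snd).
  by apply: measurableT_comp => //; exact: measurable_rV_coord.
apply/funext => p /=; rewrite /rV_coord /rV_cons.
rewrite (_ : i = rshift 1 j); last exact/val_inj.
exact: rV_cons_r.
Qed.

Definition rV_uncons (x : 'rV[R]_n.+1) : measurableTypeR R * 'rV[R]_n :=
  (@rV_coord R n.+1 (lshift n (ord0 : 'I_1)) x, \row_j x 0 (rshift 1 j)).

Lemma measurable_rV_uncons : measurable_fun setT rV_uncons.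
Proof.
apply/measurable_fun_pairP; split; first exact: measurable_rV_coord.
apply: measurable_fun_rVP => i.
rewrite [X in measurable_fun _ X](_ : _ = rV_coord (rshift 1 i)).
  exact: measurable_rV_coord.
by apply/funext => x; rewrite /rV_coord /= mxE.
Qed.

Lemma rV_consK : cancel rV_cons rV_uncons.
Proof.
move=> [a y]; rewrite /rV_uncons /rV_cons /rV_coord /=; congr pair.
  exact: rV_cons_l.
by apply/rowP => j; rewrite mxE; exact: rV_cons_r.
Qed.

Definition lebesgue_rVS : set 'rV[R]_n.+1 -> \bar R :=
  pushforward (lebesgue_measure \x m)%E rV_cons.


Let lebesgue_rVS0 : lebesgue_rVS set0 = 0%E.
Proof. by rewrite /lebesgue_rVS /pushforward preimage_set0 measure0. Qed.

Let lebesgue_rVS_ge0 A : (0 <= lebesgue_rVS A)%E.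
Proof. by rewrite /lebesgue_rVS /pushforward; exact: measure_ge0. Qed.

Let lebesgue_rVS_sigma_additive : semi_sigma_additive lebesgue_rVS.
Proof.
move=> F mF tF mUF; rewrite /lebesgue_rVS /pushforward preimage_bigcup.
apply: measure_semi_sigma_additive.
- by move=> k; rewrite -[X in measurable X]setTI; exact: measurable_rV_cons.
- apply/trivIsetP => /= i j _ _ ij; rewrite -preimage_setI.
  by move/trivIsetP : tF => /(_ _ _ _ _ ij) ->//; rewrite preimage_set0.
- rewrite -preimage_bigcup -[X in measurable X]setTI.
  exact: measurable_rV_cons.
Qed.

HB.instance Definition _ := isMeasure.Build _ _ _ lebesgue_rVS
  lebesgue_rVS0 lebesgue_rVS_ge0 lebesgue_rVS_sigma_additive.

Let lebesgue_rVS_sigma_finite : sigma_finite setT lebesgue_rVS.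
Proof.
have /sigma_finiteP[F [FT ndF Foo]] := sigma_finiteT (@lebesgue_measure R).
have /sigma_finiteP[G [GT ndG Goo]] := sigma_finiteT m.
exists (fun k => rV_uncons @^-1` (F k `*` G k)).
  apply/esym; rewrite -subTset => x _.
  have [i _ Fi] : (\bigcup_i F i) (rV_uncons x).1 by rewrite -FT.
  have [j _ Gj] : (\bigcup_i G i) (rV_uncons x).2 by rewrite -GT.
  exists (maxn i j) => //; split.
  - by move: Fi; exact/subsetPset/ndF/leq_maxl.
  - by move: Gj; exact/subsetPset/ndG/leq_maxr.
move=> k; have [mF Fk] := Foo k; have [mG Gk] := Goo k; split.
  rewrite -[X in measurable X]setTI; apply: measurable_rV_uncons => //.
  exact: measurableX.
rewrite /lebesgue_rVS /pushforward -comp_preimage.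
rewrite (_ : _ \o _ = id); last by apply/funext => p; exact: rV_consK.
by rewrite preimage_id product_measure1E// lte_mul_pinfty// ge0_fin_numE.
Qed.

HB.instance Definition _ := Measure_isSigmaFinite.Build _ _ _ lebesgue_rVS
  lebesgue_rVS_sigma_finite.

End LebesgueStep.

(* Lebesgue measure on R^n, as an iterated product *)
Fixpoint lebesgue_rV (R : realType) (n : nat) :
    {sigma_finite_measure set 'rV[R]_n -> \bar R} :=
  if n is n'.+1 then lebesgue_rVS (lebesgue_rV R n') else \d_(0 : 'rV[R]_0).

Section Sobolev.
Context {R : realType} {d : nat}.
Local Notation scal := ('rV[R]_d -> R).
Local Notation vec := ('I_d -> 'rV[R]_d -> R).
Local Notation mu := (lebesgue_rV R d).
Implicit Types (Omega Gamma : set 'rV[R]_d) (f g phi : scal) (u v : vec).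

Definition partial (i : 'I_d) phi : scal := fun x => 'D_(delta_mx 0 i) phi x.

Definition mpartial (a : 'I_d -> nat) phi : scal :=
  foldr (fun i psi => iter (a i) (partial i) psi) phi (enum 'I_d).

Definition smooth phi :=
  forall (s : seq 'I_d) (x : 'rV[R]_d), differentiable (foldr partial phi s) x.

Definition supported_in (A : set 'rV[R]_d) phi :=
  exists2 C : set 'rV[R]_d, compact C /\ C `<=` A &
    forall x, ~ C x -> phi x = 0.

Definition L2 Omega : set scal :=
  [set f : scal | measurable_fun Omega f /\
           (\int[mu]_(x in Omega) ((f x) ^+ 2)%:E < +oo)%E].

Definition inner Omega f g : R := \int[mu]_(x in Omega) (f x * g x).

Definition L2norm Omega f : R := Num.sqrt (inner Omega f f).

Definition weak_mpartial Omega (a : 'I_d -> nat) f g :=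
  forall phi, smooth phi -> supported_in Omega phi ->
    inner Omega f (mpartial a phi) =
    (-1) ^+ (\sum_i a i)%N * inner Omega g phi.

Definition sobolev Omega (m : nat) : set scal :=
  [set f : scal | L2 Omega f /\
    forall a : 'I_d -> nat, (\sum_i a i <= m)%N ->
      exists2 g, L2 Omega g & weak_mpartial Omega a f g].

(* The weak derivative of f (unique up to a null set), 0 if there is none *)
Definition weakD Omega (a : 'I_d -> nat) f : scal :=
  xget (cst 0) [set g | L2 Omega g /\ weak_mpartial Omega a f g].

Definition Hnorm Omega (m : nat) f : R :=
  Num.sqrt (\sum_(a : {ffun 'I_d -> 'I_m.+1} | (\sum_i a i <= m)%N)
              (L2norm Omega (weakD Omega (fun i => a i) f)) ^+ 2).

Definition vsobolev Omega (m : nat) : set vec :=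
  [set u : vec | forall i, sobolev Omega m (u i)].

Definition vHnorm Omega (m : nat) u : R :=
  Num.sqrt (\sum_i (Hnorm Omega m (u i)) ^+ 2).

Definition vL2 Omega : set vec := [set u : vec | forall i, L2 Omega (u i)].

Definition vinner Omega u v : R := \sum_i inner Omega (u i) (v i).

Definition vL2norm Omega u : R := Num.sqrt (vinner Omega u u).

Definition boundary Omega : set 'rV[R]_d := closure Omega `\` Omega^°.

(* H^1 functions vanishing on Gamma: the H^1 closure of the smooth functions
   vanishing near Gamma. For Gamma = boundary Omega this is H^1_0. *)
Definition H1_0 Omega Gamma : set scal :=
  [set f : scal | sobolev Omega 1 f /\
    forall e : R, 0 < e -> exists phi : scal,
      [/\ smooth phi, supported_in setT phi,
          (exists2 U, open U /\ Gamma `<=` U & forall x, U x -> phi x = 0) &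
          Hnorm Omega 1 (f - phi) < e]].

Definition vH1_0 Omega Gamma : set vec :=
  [set u : vec | forall i, H1_0 Omega Gamma (u i)].

Definition grad Omega (i : 'I_d) f : scal :=
  weakD Omega (fun j => (j == i) : nat) f.

Definition div Omega u : scal := fun x => \sum_i grad Omega i (u i) x.

Definition strain Omega u (i j : 'I_d) : scal :=
  fun x => 2^-1 * (grad Omega j (u i) x + grad Omega i (u j) x).

(* (eps(u), eps(v)) *)
Definition strain_form Omega u v : R :=
  \sum_i \sum_j inner Omega (strain Omega u i j) (strain Omega v i j).

Definition strain_norm Omega u : R := Num.sqrt (strain_form Omega u u).

(* (A grad f, grad g) *)
Definition diff_form Omega (A : 'rV[R]_d -> 'M[R]_d) f g : R :=
  \sum_i inner Omega (fun x => \sum_j A x i j * grad Omega j f x)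
                     (grad Omega i g).

Definition grad_norm Omega f : R :=
  Num.sqrt (\sum_i (L2norm Omega (grad Omega i f)) ^+ 2).

Definition vgrad_norm Omega u : R :=
  Num.sqrt (\sum_i (grad_norm Omega (u i)) ^+ 2).

(* Euclidean (Frobenius) norm; the library norm on matrices is the max norm. *)
Definition enorm m n (v : 'M[R]_(m, n)) : R :=
  Num.sqrt (\sum_i \sum_j (v i j) ^+ 2).

Definition spd_tensor Omega (A : 'rV[R]_d -> 'M[R]_d) (am aM : R) :=
  (forall i j, measurable_fun Omega (fun x => A x i j)) /\
  forall x, Omega x ->
    (A x)^T = A x /\
    forall v : 'cV[R]_d, am * (enorm v) ^+ 2 <= (v^T *m A x *m v) 0 0 /\
                         enorm (A x *m v) <= aM * enorm v.

Definition domain Omega :=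
  [/\ open Omega, connected Omega, Omega !=set0 & bounded_set Omega].

End Sobolev.

(* Functions of time with values in a space X (a set of elements of E) normed
   by nrm. An element of a Bochner space is given by a representative. *)
Section Bochner.
Context {R : realType} {E : lmodType R}.
Local Notation leb := (@lebesgue_measure R).
Implicit Types (X : set E) (nrm : E -> R) (w : R -> E).

Definition strongly_measurable (J : set R) X nrm w :=
  exists (m : nat -> nat) (A : nat -> nat -> set (measurableTypeR R))
         (x : nat -> nat -> E),
    [/\ forall n i, measurable (A n i), forall n i, X (x n i) &
        {ae leb, forall t, J t -> X (w t) /\
          (fun n => nrm (w t - \sum_(i < m n) (\1_(A n i) t : R) *: x n i))
            @ \oo --> (0 : R)}].

Definition bochner_L2 (J : set R) X nrm w :=
  strongly_measurable J X nrm w /\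
  (\int[leb]_(t in J) ((nrm (w t)) ^+ 2)%:E < +oo)%E.

Definition bochner_Loo (J : set R) X nrm w :=
  strongly_measurable J X nrm w /\
  exists M : R, {ae leb, forall t, J t -> nrm (w t) <= M}.

Definition bounded_functional X nrm (l : E -> R) :=
  (forall (a : R) x y, X x -> X y -> l (a *: x + y) = a * l x + l y) /\
  exists C : R, forall x, X x -> `|l x| <= C * nrm x.

(* w(t) - w(s) is the Bochner integral in X of w' over [s, t]: w is the
   absolutely continuous representative, so that its nodal values make sense,
   and w' is its time derivative. *)
Definition time_derivative (tau : R) X nrm w (w' : R -> E) :=
  (forall t, 0 <= t <= tau -> X (w t)) /\
  forall l, bounded_functional X nrm l ->
    forall s t, 0 <= s -> s <= t -> t <= tau ->
      l (w t) - l (w s) = \int[leb]_(r in `[s, t]) l (w' r).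

Definition time_continuous (tau : R) X nrm w :=
  forall t, 0 <= t <= tau ->
    X (w t) /\
    (fun s => nrm (w s - w t)) @ within `[0, tau] (nbhs t) --> (0 : R).

(* a function of time with its first and second time derivatives *)
Record trajectory := Trajectory {
  traj :> R -> E;
  traj_t : R -> E;
  traj_tt : R -> E }.

Definition regular (tau : R) X nX Y nY (w : trajectory) :=
  [/\ bochner_Loo `]0, tau[ X nX w,
      bochner_L2 `]0, tau[ X nX (traj_t w),
      bochner_L2 `]0, tau[ Y nY (traj_tt w),
      time_derivative tau X nX w (traj_t w) &
      time_derivative tau Y nY (traj_t w) (traj_tt w)].

End Bochner.
Arguments trajectory {R} E.

(* A mesh is a list of d-simplices, each given by the matrix of its vertices. *)
Section Meshes.
Context {R : realType} {d : nat}.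
Local Notation simplex := 'M[R]_(d.+1, d).
Implicit Types (S : simplex) (Th : seq simplex).
Implicit Types (Omega Gammad : set 'rV[R]_d).

Definition hull S : set 'rV[R]_d :=
  [set x | exists c : 'rV[R]_d.+1,
     [/\ forall i, 0 <= c 0 i, \sum_i c 0 i = 1 & x = c *m S]].

(* convex hull of the vertices of S that are also vertices of S' *)
Definition common_face S (S' : simplex) : set 'rV[R]_d :=
  [set x | exists c : 'rV[R]_d.+1,
     [/\ forall i, 0 <= c 0 i, \sum_i c 0 i = 1, x = c *m S &
         forall i, c 0 i != 0 -> exists j, row j S' = row i S]].

Definition nondegenerate S :=
  row_free (\matrix_(i < d) (row (lift ord0 i) S - row ord0 S)).

Definition triangulation Omega Th :=
  [/\ forall S, S \in Th -> nondegenerate S,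
      forall S S', S \in Th -> S' \in Th ->
        hull S `&` hull S' = common_face S S' &
      closure Omega = \bigcup_(S in [set` Th]) hull S].

Definition diam (A : set 'rV[R]_d) : R :=
  sup [set enorm (x - y) | x in A & y in A].

(* diameter of the largest inscribed ball *)
Definition indiam (A : set 'rV[R]_d) : R :=
  sup [set r *+ 2 | r in [set r : R | 0 <= r /\
         exists c, forall y, enorm (y - c) <= r -> A y]].

Definition mesh_size Th : R := \big[Num.max/0]_(S <- Th) diam (hull S).

Definition shape_regular (I : Type) (Th : I -> seq simplex) :=
  exists sigma : R, forall i S, S \in Th i ->
    diam (hull S) <= sigma * indiam (hull S).

Definition quasi_uniform (I : Type) (Th : I -> seq simplex) :=
  exists sigma : R, forall i S, S \in Th i ->
    mesh_size (Th i) <= sigma * diam (hull S).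

Definition polynomial_on (k : nat) (A : set 'rV[R]_d) (f : 'rV[R]_d -> R) :=
  exists c : {ffun 'I_d -> 'I_k.+1} -> R, forall x, A x ->
    f x = \sum_(a : {ffun 'I_d -> 'I_k.+1} | (\sum_i a i <= k)%N)
            c a * \prod_i (x 0 i) ^+ a i.

(* continuous piecewise polynomials of degree k *)
Definition lagrange Omega Th (k : nat) : set ('rV[R]_d -> R) :=
  [set f : 'rV[R]_d -> R | {within closure Omega, continuous f} /\
           forall S, S \in Th -> polynomial_on k (hull S) f].

Definition fe_V Omega Gammad Th k : set ('I_d -> 'rV[R]_d -> R) :=
  [set v | vH1_0 Omega Gammad v /\ forall i, lagrange Omega Th k (v i)].

Definition fe_Q Omega Th k : set ('rV[R]_d -> R) :=
  L2 Omega `&` lagrange Omega Th k.-1.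

Definition fe_W Omega Th l : set ('rV[R]_d -> R) :=
  H1_0 Omega (boundary Omega) `&` lagrange Omega Th l.

Definition inf_sup Omega Gammad Th k (gamma : R) :=
  (gamma%:E <=
   ereal_inf [set ereal_sup
     [set (inner Omega (div Omega v) xi /
             (vgrad_norm Omega v * L2norm Omega xi))%:E
       | v in [set v | fe_V Omega Gammad Th k v /\ (vgrad_norm Omega v != 0)%R]]
     | xi in [set xi | fe_Q Omega Th k xi /\ (L2norm Omega xi != 0)%R]])%E.

End Meshes.

Section ThermoPoroelasticity.
Context {R : realType} {d : nat}.
Local Notation scal := ('rV[R]_d -> R).
Local Notation vec := ('I_d -> 'rV[R]_d -> R).

Record medium := Medium {
  mu : R; lambda : R; alpha : R; beta : R;
  a0 : R; b0 : R; c0 : R;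
  perm : 'rV[R]_d -> 'M[R]_d;   (* the tensor K *)
  cond : 'rV[R]_d -> 'M[R]_d }. (* the tensor Theta *)

Definition admissible (P : medium) :=
  [/\ [/\ 0 < mu P, 0 < lambda P, 0 < alpha P & 0 < beta P],
      b0 P < a0 P, b0 P < c0 P & 0 <= b0 P].

Definition c_alpha P := c0 P + alpha P ^+ 2 / lambda P.
Definition c_alphabeta P := alpha P * beta P / lambda P - b0 P.
Definition c_beta P := a0 P + beta P ^+ 2 / lambda P.

Variables (Omega Gammad : set 'rV[R]_d) (P : medium).

Local Notation "( f , g )" := (inner Omega f g) : ring_scope.
Local Notation V := (vH1_0 Omega Gammad).
Local Notation Q := (L2 Omega).
Local Notation W := (H1_0 Omega (boundary Omega)).

Definition elasticity_eq (u : vec) (xi : scal) (f v : vec) :=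
  2 * mu P * strain_form Omega u v - (div Omega v, xi) = vinner Omega f v.

Definition pressure_eq (u : vec) (xi p T phi : scal) :=
  - (div Omega u, phi) - (lambda P)^-1 * (xi, phi)
  + alpha P / lambda P * (p, phi) + beta P / lambda P * (T, phi) = 0.

Definition vp_solution (tau : R) (u0 : vec) (p0 T0 : scal)
    (f : R -> vec) (g Hs : R -> scal)
    (u : trajectory vec) (xi p T : trajectory scal) :=
  {ae @lebesgue_measure R, forall t, 0 < t <= tau ->
    [/\ V (u t), Q (xi t), W (p t) & W (T t)] /\
    forall v phi q S, V v -> Q phi -> W q -> W S ->
    [/\ elasticity_eq (u t) (xi t) (f t) v,
        pressure_eq (u t) (xi t) (p t) (T t) phi,
        - (alpha P / lambda P) * (traj_t xi t, q) + c_alpha P * (traj_t p t, q)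
        + c_alphabeta P * (traj_t T t, q) + diff_form Omega (perm P) (p t) q
        = (g t, q) &
        - (beta P / lambda P) * (traj_t xi t, S)
        + c_alphabeta P * (traj_t p t, S) + c_beta P * (traj_t T t, S)
        + diff_form Omega (cond P) (T t) S
        = (Hs t, S)]} /\
  {ae lebesgue_rV R d, forall x, Omega x ->
    [/\ forall i, u 0 i x = u0 i x, p 0 x = p0 x, T 0 x = T0 x &
        xi 0 x = - lambda P * div Omega u0 x + alpha P * p0 x
                 + beta P * T0 x]}.

Definition regular_solution (tau : R) (k l : nat)
    (u : trajectory vec) (xi p T : trajectory scal) :=
  [/\ regular tau (V `&` vsobolev Omega k.+1) (vHnorm Omega k.+1)
              V (vHnorm Omega 1) u,
      regular tau (sobolev Omega k) (Hnorm Omega k) Q (L2norm Omega) xi,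
      regular tau (W `&` sobolev Omega l.+1) (Hnorm Omega l.+1)
              Q (L2norm Omega) p &
      regular tau (W `&` sobolev Omega l.+1) (Hnorm Omega l.+1)
              Q (L2norm Omega) T].

Section Discrete.
Variables (Th : seq 'M[R]_(d.+1, d)) (k l : nat).
Local Notation Vh := (fe_V Omega Gammad Th k).
Local Notation Qh := (fe_Q Omega Th k).
Local Notation Wh := (fe_W Omega Th l).

(* (Pi u, Pi xi) are the projections of (u, xi) onto V_h x Q_h *)
Definition stokes_projection (u : vec) (xi : scal) (Piu : vec) (Pixi : scal) :=
  [/\ Vh Piu, Qh Pixi,
      forall v, Vh v ->
        2 * mu P * strain_form Omega Piu v - (div Omega v, Pixi) =
        2 * mu P * strain_form Omega u v - (div Omega v, xi) &
      forall phi, Qh phi -> (div Omega Piu, phi) = (div Omega u, phi)].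

(* Pi w is the projection of w onto W_h for the tensor A *)
Definition elliptic_projection (A : 'rV[R]_d -> 'M[R]_d) (w Piw : scal) :=
  Wh Piw /\
  forall q, Wh q -> diff_form Omega A Piw q = diff_form Omega A w q.

Definition stokes_projection_bound (C : R) :=
  forall u xi Piu Pixi,
    V u -> vsobolev Omega k.+1 u -> sobolev Omega k xi ->
    stokes_projection u xi Piu Pixi ->
    vgrad_norm Omega (Piu - u) + L2norm Omega (Pixi - xi) <=
    C * (mesh_size Th ^+ k * vHnorm Omega k.+1 u
         + mesh_size Th ^+ k * Hnorm Omega k xi).

Definition elliptic_projection_bound (A : 'rV[R]_d -> 'M[R]_d) (C : R) :=
  forall w Piw,
    W w -> sobolev Omega l.+1 w -> elliptic_projection A w Piw ->
    L2norm Omega (Piw - w) + mesh_size Th * grad_norm Omega (Piw - w) <=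
    C * (mesh_size Th ^+ l.+1 * Hnorm Omega l.+1 w).

(* The discrete counterpart of the initial conditions u(0) = u^0, p(0) = p^0,
   T(0) = T^0, xi(0) = - lambda div u^0 + alpha p^0 + beta T^0: the initial
   value is the projection of (u, xi, p, T)(0) and satisfies the discrete
   relation between xi, u, p and T. *)
Definition discrete_initial_value
    (u0 : vec) (xi0 p0 T0 : scal) (uh0 : vec) (xih0 ph0 Th0 : scal) :=
  [/\ stokes_projection u0 xi0 uh0 xih0,
      elliptic_projection (perm P) p0 ph0,
      elliptic_projection (cond P) T0 Th0 &
      forall phi, Qh phi -> pressure_eq uh0 xih0 ph0 Th0 phi].

Definition coupled_step (dt : R) (f1 : vec) (g1 Hs1 : scal)
    (xi0 p0 T0 : scal) (u1 : vec) (xi1 p1 T1 : scal) :=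
  [/\ Vh u1, Qh xi1, Wh p1 & Wh T1] /\
  forall v phi q S, Vh v -> Qh phi -> Wh q -> Wh S ->
  [/\ elasticity_eq u1 xi1 f1 v,
      pressure_eq u1 xi1 p1 T1 phi,
      - (alpha P / lambda P) * (xi1 - xi0, q) + c_alpha P * (p1 - p0, q)
      + c_alphabeta P * (T1 - T0, q) + dt * diff_form Omega (perm P) p1 q
      = dt * (g1, q) &
      - (beta P / lambda P) * (xi1 - xi0, S) + c_beta P * (T1 - T0, S)
      + c_alphabeta P * (p1 - p0, S) + dt * diff_form Omega (cond P) T1 S
      = dt * (Hs1, S)].

(* reaction-diffusion first, then elasticity; xi_ is xi_h at the level before
   the previous one *)
Definition decoupled_step (dt : R) (f1 : vec) (g1 Hs1 : scal)
    (xi_ xi0 p0 T0 : scal) (u1 : vec) (xi1 p1 T1 : scal) :=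
  [/\ Vh u1, Qh xi1, Wh p1 & Wh T1] /\
  forall v phi q S, Vh v -> Qh phi -> Wh q -> Wh S ->
  [/\ c_alpha P * (dt^-1 *: (p1 - p0), q) + diff_form Omega (perm P) p1 q
      + c_alphabeta P * (dt^-1 *: (T1 - T0), q)
      = alpha P / lambda P * (dt^-1 *: (xi0 - xi_), q) + (g1, q),
      c_beta P * (dt^-1 *: (T1 - T0), S) + diff_form Omega (cond P) T1 S
      + c_alphabeta P * (dt^-1 *: (p1 - p0), S)
      = beta P / lambda P * (dt^-1 *: (xi0 - xi_), S) + (Hs1, S),
      elasticity_eq u1 xi1 f1 v &
      (div Omega u1, phi) + (lambda P)^-1 * (xi1, phi)
      = alpha P / lambda P * (p1, phi) + beta P / lambda P * (T1, phi)].

End Discrete.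
End ThermoPoroelasticity.
Arguments medium R d : clear implicits.

(* Main.v *)
Require Import Defs.
From HB Require Import structures.
From mathcomp Require Import all_boot all_order all_algebra.
From mathcomp Require Import all_classical all_reals all_analysis.
From mathcomp Require Import measurable_realfun ring lra.
Set Implicit Arguments.
Unset Strict Implicit.
Unset Printing Implicit Defensive.
Import Order.TTheory GRing.Theory Num.Theory.
Import numFieldNormedType.Exports.
Local Open Scope classical_set_scope.
Local Open Scope ring_scope.

(** Write D for the increment over one time step of size dt. The scheme and the
    exact equations at the nodes are subtracted, and the exact solution is
    replaced by its projections. The projections leave the diffusion terms
    unchanged, so the errors of pressure, temperature, displacement and total
    pressure satisfy the equations of the scheme with defects on the right-hand
    side ([error_pressure], [error_temperature], [error_elasticity],
    [error_constraint]).

    Stability ([scheme_stability]). The equations for pressure and temperature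
    are tested with the increments D e_p and D e_T of the errors, not with the
    errors themselves. The mass terms then dominate a positive multiple m0 of
    x_n = |D e_p|^2 + |D e_T|^2, plus w_n^2 / lambda where w_n is the norm of the
    increment of alpha e_p + beta e_T; the diffusion terms telescope. The total
    pressure enters with a time lag. Testing the elasticity equation and the
    constraint, which hold for increments, with the increments of the
    displacement and of the total pressure bounds the norm of the latter by
    w_(n-1) plus lambda times the increment of the defect of the constraint
    ([elastic_bound]). The lagged term w_(n-1) w_n / lambda is therefore at most
    half of (w_(n-1)^2 + w_n^2) / lambda, and w_n^2 / (2 lambda) is carried over
    to the next step: the decoupling costs no condition on dt
    ([energy_recursion]). All errors have norm 0 at the initial level, so the errors
    at a later level are sums of at most N+1 increments; Cauchy-Schwarz yields a
    factor N+1, and (N+1) dt is at most the final time.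

    Consistency. The defects are of two kinds. Projections of increments are
    increments of projections, hence their errors are h^k and h^(l+1) times
    increments of the solution, whose squared norms over a step are at most dt
    times the time integral of the squared norm of the first derivative over the
    step ([norm_increment]). The differences between increments and dt times the
    rate at the new level are controlled by the second derivative
    ([norm_second_increment]). Summation over the steps reproduces the integrals
    over the whole time interval, at most twice because of the lag
    ([increment_sum]). The bounds on vector-valued increments are obtained by
    duality, the increment being tested against itself, which only requires
    integrals of real functions of time ([increment_le]).

    Two points connect this with the analytic definitions. Weak derivatives are
    chosen functions determined only almost everywhere; by the fundamental lemma
    of the calculus of variations ([ae_eq0_of_test]) they are unique, hence
    linear, when seen through the inner product, which makes the Sobolev norms
    and the bilinear forms semi-inner products in the algebraic sense. The
    variational equations are given for almost every time; they extend to the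
    nodes because both sides are continuous in time, and a continuous function
    vanishing almost everywhere vanishes ([continuous_upto_ae0]). *)

(** * Semi-inner products *)

Lemma norm_sum_le {R : realType} (I : Type) (r : seq I) (F G : I -> R) :
  (forall i, `|F i| <= G i) -> `|\sum_(i <- r) F i| <= \sum_(i <- r) G i.
Proof. by move=> FG; apply: (le_trans (ler_norm_sum _ _ _)); apply: ler_sum. Qed.

Section SemiInner.
Context {R : realType} {E : lmodType R}.
Implicit Types (X : set E) (b : E -> E -> R).

Definition subspace X := X 0 /\ forall (a : R) x y, X x -> X y -> X (a *: x + y).

(** Symmetric nonnegative bilinear on the subspace X, and arbitrary off it: the
    forms at hand act on functions, not on their classes, and make sense only
    for functions of the right regularity. *)
Definition semi_inner X b :=
  [/\ subspace X,
      forall (a : R) x y z, X x -> X y -> X z ->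
        b (a *: x + y) z = a * b x z + b y z,
      forall x y, X x -> X y -> b x y = b y x &
      forall x, X x -> 0 <= b x x].

Definition semi_norm b x : R := Num.sqrt (b x x).

Section Subspace.
Variable (X : set E).
Hypothesis sX : subspace X.

Lemma subspaceD x y : X x -> X y -> X (x + y).
Proof. by move=> Xx Xy; rewrite -[x]scale1r; apply: sX.2. Qed.

Lemma subspaceZ a x : X x -> X (a *: x).
Proof. by move=> Xx; rewrite -[_ *: _]addr0; apply: sX.2 => //; case: sX. Qed.

Lemma subspaceN x : X x -> X (- x).
Proof. by move=> Xx; rewrite -scaleN1r; apply: subspaceZ. Qed.

Lemma subspaceB x y : X x -> X y -> X (x - y).
Proof. by move=> Xx Xy; apply: subspaceD => //; apply: subspaceN. Qed.

Lemma subspace_sum (I : Type) (r : seq I) (F : I -> E) :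
  (forall i, X (F i)) -> X (\sum_(i <- r) F i).
Proof.
move=> XF; elim/big_ind : _ => [|x y Xx Xy|i _] //; first by case: sX.
exact: subspaceD.
Qed.

End Subspace.

Section Linear.
Variables (X : set E) (l : E -> R).
Hypothesis sX : subspace X.
Hypothesis lin : forall (a : R) x y, X x -> X y -> l (a *: x + y) = a * l x + l y.

Lemma form0 : l 0 = 0.
Proof.
have X0 := sX.1; have := lin 1 X0 X0; rewrite scale1r mul1r addr0.
by move/eqP; rewrite -subr_eq0 opprD addNKr oppr_eq0 => /eqP.
Qed.

Lemma formZ a x : X x -> l (a *: x) = a * l x.
Proof. by move=> Xx; rewrite -[_ *: _]addr0 lin ?form0 ?addr0 //; case: sX. Qed.

Lemma formD x y : X x -> X y -> l (x + y) = l x + l y.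
Proof. by move=> Xx Xy; rewrite -[x in LHS]scale1r lin// mul1r. Qed.

Lemma formB x y : X x -> X y -> l (x - y) = l x - l y.
Proof. by move=> Xx Xy; rewrite addrC -scaleN1r lin// mulN1r addrC. Qed.

Lemma form_sum (I : Type) (r : seq I) (F : I -> E) :
  (forall i, X (F i)) -> l (\sum_(i <- r) F i) = \sum_(i <- r) l (F i).
Proof.
move=> XF; elim: r => [|i r ih]; first by rewrite !big_nil form0.
by rewrite !big_cons formD ?ih//; exact: subspace_sum.
Qed.

End Linear.

Section Norm.
Variables (X : set E) (b : E -> E -> R).
Hypothesis sb : semi_inner X b.
Local Notation N := (semi_norm b).

Let sX : subspace X. Proof. by case: sb. Qed.
Let bC x y : X x -> X y -> b x y = b y x. Proof. by case: sb => _ _ + _; apply. Qed.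

Lemma sip_lin z : X z -> forall (a : R) x y, X x -> X y ->
  b (a *: x + y) z = a * b x z + b y z.
Proof. by case: sb => _ + _ _ Xz a x y Xx Xy; apply. Qed.

Lemma sip_linr z : X z -> forall (a : R) x y, X x -> X y ->
  b z (a *: x + y) = a * b z x + b z y.
Proof.
move=> Xz a x y Xx Xy; rewrite bC ?sip_lin// ?(bC Xz)//.
exact: sX.2.
Qed.

Lemma sip_ge0 x : X x -> 0 <= b x x.
Proof. by case: sb => _ _ _; apply. Qed.

Lemma semi_norm_sqr x : X x -> N x ^+ 2 = b x x.
Proof. by move=> Xx; rewrite sqr_sqrtr// sip_ge0. Qed.

Lemma semi_norm_ge0 x : 0 <= N x.
Proof. exact: sqrtr_ge0. Qed.

(** The discriminant of the nonnegative polynomial t |-> b (t x + y, t x + y);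
    when b x x = 0 that polynomial is affine, so its slope vanishes. *)
Lemma cauchy_schwarz_sqr x y : X x -> X y -> b x y ^+ 2 <= b x x * b y y.
Proof.
move=> Xx Xy.
have poly t : 0 <= t ^+ 2 * b x x + 2 * t * b x y + b y y.
  have Xz : X (t *: x + y) by exact: sX.2.
  have := sip_ge0 Xz; rewrite sip_lin// !sip_linr// (bC Xy Xx).
  by congr (0 <= _); ring.
have [xx0|xx0] := eqVneq (b x x) 0.
  have [xy0|xy0] := eqVneq (b x y) 0; first by rewrite xx0 xy0 mul0r expr2 mul0r.
  have := poly (- (b y y + 1) / (2 * b x y)); rewrite xx0.
  rewrite (_ : _ + _ = - 1); first by rewrite lerNr oppr0 ler10.
  by field.
have xxp : 0 < b x x by rewrite lt_def xx0 sip_ge0.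
have := poly (- b x y / b x x).
have -> : (- b x y / b x x) ^+ 2 * b x x + 2 * (- b x y / b x x) * b x y + b y y =
          (b x x * b y y - b x y ^+ 2) / b x x by field.
by rewrite pmulr_lge0 ?invr_gt0// subr_ge0.
Qed.

Lemma cauchy_schwarz x y : X x -> X y -> `|b x y| <= N x * N y.
Proof.
move=> Xx Xy; rewrite -(@ler_pXn2r _ 2)// ?nnegrE ?mulr_ge0 ?sqrtr_ge0//.
by rewrite exprMn !semi_norm_sqr// real_normK ?num_real// cauchy_schwarz_sqr.
Qed.

Lemma semi_normZ a x : X x -> N (a *: x) = `|a| * N x.
Proof.
move=> Xx; have XZ := subspaceZ sX a Xx.
rewrite /semi_norm (formZ sX (sip_lin XZ))// (formZ sX (sip_linr Xx))//.
by rewrite mulrA -expr2 sqrtrM ?sqr_ge0// sqrtr_sqr.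
Qed.

Lemma semi_normN x : X x -> N (- x) = N x.
Proof. by move=> Xx; rewrite -scaleN1r semi_normZ// normrN1 mul1r. Qed.

Lemma semi_normD x y : X x -> X y -> N (x + y) <= N x + N y.
Proof.
move=> Xx Xy; have XD := subspaceD sX Xx Xy.
rewrite -(@ler_pXn2r _ 2)// ?nnegrE ?addr_ge0 ?semi_norm_ge0//.
rewrite sqrrD !semi_norm_sqr// (formD (sip_lin XD))// !(formD (sip_linr _))//.
rewrite (bC Xy Xx); have := le_trans (ler_norm _) (cauchy_schwarz Xx Xy).
rewrite mulr2n; lra.
Qed.

Lemma semi_normB x y : X x -> X y -> N (x - y) <= N x + N y.
Proof.
move=> Xx Xy; rewrite -(semi_normN Xy) semi_normD//.
exact: subspaceN.
Qed.

Lemma semi_norm0 : N 0 = 0.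
Proof. by rewrite -(scale0r 0) semi_normZ ?normr0 ?mul0r//; case: sX. Qed.

End Norm.
End SemiInner.

(** A map need only be linear when seen through b: this is what makes the
    Sobolev products, built from almost-everywhere defined derivatives,
    semi-inner products on the nose. *)
Definition seen_linear {R : realType} {E F : lmodType R} (X : set E)
    (Y : set F) (b : F -> F -> R) (L : E -> F) :=
  (forall x, X x -> Y (L x)) /\
  forall (a : R) x y z, X x -> X y -> Y z ->
    b (L (a *: x + y)) z = a * b (L x) z + b (L y) z.

Lemma semi_inner_pullback {R : realType} {E F : lmodType R} (X : set E)
    (Y : set F) (b : F -> F -> R) (L : E -> F) :
  subspace X -> semi_inner Y b -> seen_linear X Y b L ->
  semi_inner X (fun x y => b (L x) (L y)).
Proof.
move=> sX [sY lb bC b0] [XY lL]; split => //.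
- by move=> a x y z Xx Xy Xz; rewrite lL//; apply: XY.
- by move=> x y Xx Xy; rewrite bC//; apply: XY.
- by move=> x Xx; apply: b0; apply: XY.
Qed.

Lemma semi_inner_sum {R : realType} {E : lmodType R} (X : set E) (I : Type)
    (r : seq I) (Q : pred I) (b : I -> E -> E -> R) :
  subspace X -> (forall i, Q i -> semi_inner X (b i)) ->
  semi_inner X (fun x y => \sum_(i <- r | Q i) b i x y).
Proof.
move=> sX sb; split => //.
- move=> a x y z Xx Xy Xz; rewrite mulr_sumr -big_split/=.
  by apply: eq_bigr => i /sb[_ lb _ _]; rewrite lb.
- by move=> x y Xx Xy; apply: eq_bigr => i /sb[_ _ bC _]; rewrite bC.
- by move=> x Xx; apply: sumr_ge0 => i /sb[_ _ _ b0]; exact: b0.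
Qed.

(** * Square-integrable functions *)

Section SquareIntegrable.
Context {dT : measure_display} {T : measurableType dT} {R : realType}.
Variable m : {measure set T -> \bar R}.
Variable D : set T.
Hypothesis mD : measurable D.

Definition sq_integrable : set (T -> R) :=
  [set f : T -> R | measurable_fun D f /\ (\int[m]_(x in D) ((f x) ^+ 2)%:E < +oo)%E].

Definition l2_form (f g : T -> R) : R := \int[m]_(x in D) (f x * g x).

Lemma sq_integrable_int f : sq_integrable f ->
  m.-integrable D (EFin \o (fun x => f x ^+ 2)).
Proof.
move=> [mf foo]; apply/integrableP; split.
  by apply/measurable_EFinP; exact: measurable_funX.
rewrite (eq_integral (fun x => ((f x) ^+ 2)%:E)) => // x _ /=.
by rewrite ger0_norm ?sqr_ge0.
Qed.

Lemma sq_integrableM f g : sq_integrable f -> sq_integrable g ->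
  m.-integrable D (EFin \o (fun x => f x * g x)).
Proof.
move=> Lf Lg; have If := sq_integrable_int Lf; have Ig := sq_integrable_int Lg.
apply: le_integrable (integrableD mD If Ig) => //=.
  by apply/measurable_EFinP; apply: measurable_funM; [case: Lf|case: Lg].
move=> x _; rewrite /= lee_fin normrM [leRHS]ger0_norm ?addr_ge0 ?sqr_ge0//.
rewrite -[f x ^+ 2]real_normK ?num_real// -[g x ^+ 2]real_normK ?num_real//.
by have := sqr_ge0 (`|f x| - `|g x|); have := sqr_ge0 (`|f x| + `|g x|); nra.
Qed.

Lemma subspace_sq_integrable : subspace sq_integrable.
Proof.
split; first split.
- exact: measurable_cst.
- by rewrite (eq_integral (cst 0%E)) ?integral0 ?ltry// => x _ /=; rewrite expr2 mul0r.
move=> a f g Lf Lg; split.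
  by apply: measurable_funD; [apply: measurable_funM => //; case: Lf|case: Lg].
have If := sq_integrable_int Lf; have Ig := sq_integrable_int Lg.
have := integrable_lty mD (integrableD mD (integrableZl mD (2 * a ^+ 2) If)
                                          (integrableZl mD 2 Ig)).
apply: le_lt_trans; apply: ge0_le_integral => //=.
- by move=> x _; rewrite lee_fin sqr_ge0.
- apply/measurable_EFinP; apply: measurable_funX.
  by apply: measurable_funD; [apply: measurable_funM => //; case: Lf|case: Lg].
- apply/measurable_EFinP; apply: measurable_funD; apply: measurable_funM => //.
  + by apply: measurable_funX; case: Lf.
  + by apply: measurable_funX; case: Lg.
- move=> x _; rewrite lee_fin -[leLHS]/((a * f x + g x) ^+ 2).
  rewrite -subr_ge0 (_ : _ - _ = (a * f x - g x) ^+ 2) ?sqr_ge0//.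
  by ring.
Qed.

Lemma semi_inner_l2 : semi_inner sq_integrable l2_form.
Proof.
split; first exact: subspace_sq_integrable.
- move=> a f g h Lf Lg Lh; rewrite /l2_form.
  rewrite -RintegralZl//; last exact: sq_integrableM.
  rewrite -RintegralD//; last exact: sq_integrableM.
    by apply: eq_Rintegral => x _; rewrite /= mulrDl mulrA.
  exact: (integrableZl mD a (sq_integrableM Lf Lh)).
- by move=> f g _ _; apply: eq_Rintegral => x _; rewrite mulrC.
- by move=> f _; apply: Rintegral_ge0 => x _; rewrite -expr2 sqr_ge0.
Qed.

Lemma sq_integrable_mul (a f : T -> R) (M : R) : measurable_fun D a ->
  (forall x, D x -> `|a x| <= M) -> sq_integrable f -> sq_integrable (a \* f).
Proof.
move=> ma aM Lf; split; first by apply: measurable_funM => //; case: Lf.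
have := integrable_lty mD (integrableZl mD (M ^+ 2) (sq_integrable_int Lf)).
apply: le_lt_trans; apply: ge0_le_integral => //=.
- by move=> x _; rewrite lee_fin sqr_ge0.
- apply/measurable_EFinP; apply: measurable_funX.
  by apply: measurable_funM => //; case: Lf.
- apply/measurable_EFinP; apply: measurable_funM => //.
  by apply: measurable_funX; case: Lf.
- move=> x Dx; rewrite lee_fin exprMn ler_wpM2r ?sqr_ge0//.
  rewrite -[a x ^+ 2]real_normK ?num_real// ler_pXn2r ?nnegrE//.
  + exact: aM.
  + by apply: le_trans (aM _ Dx).
Qed.

(** Boundedness suffices on a set of finite measure. *)
Lemma bounded_sq_integrable (f : T -> R) (M : R) : (m D < +oo)%E ->
  measurable_fun D f -> (forall x, D x -> `|f x| <= M) -> sq_integrable f.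
Proof.
move=> Doo mf fM; split => //.
apply: (@le_lt_trans _ _ (\int[m]_(x in D) (cst (M ^+ 2)%:E x))%E).
  apply: ge0_le_integral => //=.
  - by move=> x _; rewrite lee_fin sqr_ge0.
  - by apply/measurable_EFinP; apply: measurable_funX.
  - move=> x Dx; rewrite lee_fin -[f x ^+ 2]real_normK ?num_real//.
    rewrite ler_pXn2r ?nnegrE//; first exact: fM.
    by apply: le_trans (fM _ Dx).
by rewrite integral_cst// lte_mul_pinfty// ?lee_fin ?sqr_ge0.
Qed.

End SquareIntegrable.

(** * Measurable sets and functions on R^n *)

Section BorelRV.
Context {R : realType} {n : nat}.
Implicit Types (a b : 'I_n -> R).

Definition obox a b : set 'rV[R]_n := [set x | forall i, a i < x 0 i < b i].

Definition oboxes : set (set 'rV[R]_n) :=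
  [set A | exists a b, A = obox a b].

Lemma measurable_forall_ord (F : 'I_n -> set 'rV[R]_n) :
  (forall i, measurable (F i)) -> measurable [set x | forall i, F i x].
Proof.
move=> mF; rewrite (_ : mkset _ = \bigcap_(i in [set: 'I_n]) F i).
  by apply: fin_bigcap_measurable => //; exact: finite_finset.
by apply/seteqP; split => [x h i _|x h i]; apply: h.
Qed.

Lemma measurable_coord_preimage (i : 'I_n) (B : set R) : measurable B ->
  measurable [set x : 'rV[R]_n | B (x 0 i)].
Proof.
move=> mB; rewrite -[mkset _]setTI.
exact: (@measurable_rV_coord R n i measurableT B mB).
Qed.

Lemma measurable_obox a b : measurable (obox a b).
Proof.
apply: measurable_forall_ord => i.
have := @measurable_coord_preimage i `]a i, b i[ (measurable_itv _).
by congr measurable; apply/funext => x; rewrite /= in_itv.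
Qed.

Lemma setI_closed_oboxes : setI_closed oboxes.
Proof.
move=> _ _ [a [b ->]] [a' [b' ->]].
exists (fun i => Num.max (a i) (a' i)), (fun i => Num.min (b i) (b' i)).
apply/seteqP; split => x /=.
  move=> [h h'] i; have /andP[h1 h2] := h i; have /andP[h3 h4] := h' i.
  by rewrite gt_max lt_min h1 h2 h3 h4.
by move=> h; split => i; move: (h i); rewrite gt_max lt_min =>
  /andP[/andP[h1 h2] /andP[h3 h4]]; rewrite ?h1 ?h2 ?h3 ?h4.
Qed.

(** The coordinate sigma-algebra is generated by open boxes, because a coordinate
    slab is an increasing union of boxes. Boxes are stable under intersection,
    which opens the way to pi-lambda arguments. *)
Lemma measurable_oboxes : @measurable _ 'rV[R]_n = <<s oboxes >>.
Proof.
apply/seteqP; split; last first.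
  apply: smallest_sub.
    by split => [|A mA|F mF]; [exact: measurable0|rewrite setTD; exact: measurableC|
      exact: bigcupT_measurable].
  by move=> _ [a [b ->]]; exact: measurable_obox.
apply: smallest_sub; first exact: smallest_sigma_algebra.
elim/big_rec: _ => [//|i X _ XB]; rewrite subUset; split=> // _ [B mB <-] /=.
rewrite setTI.
suff : @measurable _ (measurableTypeR R) `<=`
    [set B : set R | <<s oboxes >> [set x | B (x 0 i)] ] by exact.
rewrite [X in X `<=` _](RGenOpens.measurableE R).
apply: smallest_sub.
  split => [|A sA|F sF] /=.
  - exact: (@sigma_algebra0 _ setT oboxes).
  - by have := @sigma_algebraCD _ setT oboxes _ sA; congr (<<s _ >> _).
  - exact: sigma_algebra_bigcup.
move=> _ [p [q ->]].
change (<<s oboxes >> [set x : 'rV[R]_n | x 0 i \in `]p, q[]).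
rewrite (_ : mkset _ = \bigcup_k obox
   (fun j => if j == i then p else - k%:R) (fun j => if j == i then q else k%:R)).
  by apply: sigma_algebra_bigcup => k; apply: sub_sigma_algebra; eexists; eexists.
apply/seteqP; split => x /=; rewrite in_itv /=.
  move=> pq; exists (Num.truncn (\sum_j `|x 0 j|)).+1 => //= j.
  case: eqP => [->//|_]; rewrite -ltr_norml.
  apply: (le_lt_trans _ (truncnS_gt _)); rewrite (bigD1 j)//= lerDl.
  exact: sumr_ge0.
by move=> [k _ /(_ i)]; rewrite eqxx.
Qed.

Lemma nbhs_rV_obox (x : 'rV[R]_n) (A : set 'rV[R]_n) : nbhs x A ->
  exists2 e : R, 0 < e & obox (fun i => x 0 i - e) (fun i => x 0 i + e) `<=` A.
Proof.
move=> /nbhs_ballP[e /= e0 eA]; exists e => // y xy; apply: eA; split => // i j.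
rewrite /ball/= ord1 ltr_distlC; exact: xy.
Qed.

Lemma open_obox_subset (U : set 'rV[R]_n) x : open U -> U x ->
  exists2 e : R, 0 < e & obox (fun i => x 0 i - e) (fun i => x 0 i + e) `<=` U.
Proof. by move=> oU Ux; apply: nbhs_rV_obox; move: oU; rewrite openE; apply. Qed.

(** Boxes with rational corners form a countable basis of the topology. *)
Definition ratbox (q : {ffun 'I_n -> rat * rat}) : set 'rV[R]_n :=
  obox (fun i => ratr (q i).1) (fun i => ratr (q i).2).

Lemma obox_ratbox (x : 'rV[R]_n) (e : R) : 0 < e -> exists q,
  [/\ ratbox q x, ratbox q `<=` obox (fun i => x 0 i - e) (fun i => x 0 i + e) &
      forall i, x 0 i - e <= ratr (q i).1 /\ ratr (q i).2 <= x 0 i + e].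
Proof.
move=> e0.
have h i : exists r : rat * rat, x 0 i - e < ratr r.1 < x 0 i /\
                               x 0 i < ratr r.2 < x 0 i + e.
  have [|r1 r1P] := @rat_in_itvoo R (x 0 i - e) (x 0 i); first by rewrite ltrBlDr ltrDl.
  have [|r2 r2P] := @rat_in_itvoo R (x 0 i) (x 0 i + e); first by rewrite ltrDl.
  by exists (r1, r2); rewrite !in_itv/= in r1P r2P *.
pose q := [ffun i => projT1 (cid (h i))].
have qP i : (x 0 i - e < ratr (q i).1 < x 0 i) /\ (x 0 i < ratr (q i).2 < x 0 i + e).
  by rewrite ffunE; exact: (projT2 (cid (h i))).
exists q; split.
- by move=> i; have [/andP[_ ->] /andP[->]] := qP i.
- move=> y yq i; have [/andP[h1 _] /andP[_ h2]] := qP i.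
  have /andP[h3 h4] := yq i.
  by rewrite (lt_trans h1 h3) (lt_trans h4 h2).
- by move=> i; have [/andP[/ltW-> _] /andP[_ /ltW->]] := qP i.
Qed.

Lemma measurable_bigcup_count (I : countType) (P : set I) (F : I -> set 'rV[R]_n) :
  (forall i, P i -> measurable (F i)) -> measurable (\bigcup_(i in P) F i).
Proof.
move=> mF.
rewrite (_ : \bigcup_(i in P) F i =
  \bigcup_k (if unpickle k is Some i then if `[< P i >] then F i else set0 else set0)).
  apply: bigcupT_measurable => k; case: unpickle => // i.
  by case: asboolP => // /mF.
apply/seteqP; split => x.
  by move=> [i Pi Fx]; exists (pickle i) => //; rewrite pickleK asboolT.
by move=> [k _]; case: unpickle => // i; case: asboolP => // Pi Fx; exists i.
Qed.

Lemma open_ratbox_cover (U : set 'rV[R]_n) : open U ->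
  U = \bigcup_(q in [set q | ratbox q `<=` U]) ratbox q.
Proof.
move=> oU; apply/seteqP; split => [x Ux|x [q qU qx]]; last exact: qU.
have [e e0 eU] := open_obox_subset oU Ux.
have [q [qx qe _]] := obox_ratbox x e0.
by exists q => //= y /qe /eU.
Qed.

(** An open set is a countable union of rational boxes. *)
Lemma open_measurable_rV (U : set 'rV[R]_n) : open U -> measurable U.
Proof.
move=> oU; rewrite (open_ratbox_cover oU).
by apply: measurable_bigcup_count => q _; exact: measurable_obox.
Qed.

Lemma continuous_measurable_rV (f : 'rV[R]_n -> R) :
  continuous f -> measurable_fun [set: 'rV[R]_n] f.
Proof.
move=> cf; apply: (measurability _ (RGenOpens.measurableE R)).
move=> _ [_ [p [q ->]] <-]; rewrite setTI; apply: open_measurable_rV.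
by apply: open_comp => [x _|]; [exact: cf|exact: interval_open].
Qed.

End BorelRV.

Section LebesgueFinite.
Context {R : realType}.

Definition cube (n : nat) (B : R) : set 'rV[R]_n := [set x | forall i, `|x 0 i| <= B].
Arguments cube : clear implicits.

Lemma measurable_cube n B : measurable (cube n B).
Proof.
apply: measurable_forall_ord => i.
have := @measurable_coord_preimage R n i `[- B, B] (measurable_itv _).
by congr measurable; apply/funext => x; rewrite /= in_itv/= ler_norml.
Qed.

Lemma rV_cons_coord0 n p : @rV_cons R n p 0 ord0 = p.1.
Proof.
have h (a : R) (y : 'rV[R]_n) (j : 'I_1) : row_mx a%:M y 0 (lshift n j) = a.
  by rewrite row_mxEl !mxE ord1 eqxx mulr1n.
rewrite /rV_cons (_ : ord0 = lshift n (ord0 : 'I_1)); last exact: val_inj.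
exact: h.
Qed.

Lemma rV_cons_coordS n p (i : 'I_n) : @rV_cons R n p 0 (lift ord0 i) = p.2 0 i.
Proof.
have h (a : R) (y : 'rV[R]_n) (j : 'I_n) : row_mx a%:M y 0 (rshift 1 j) = y 0 j.
  by rewrite row_mxEr.
rewrite /rV_cons (_ : lift ord0 i = rshift 1 i); last exact: val_inj.
exact: h.
Qed.

Lemma preimage_rV_cons_cube n B :
  @rV_cons R n @^-1` cube n.+1 B = `[- B, B]%classic `*` cube n B.
Proof.
apply/seteqP; split => -[s y] /=.
  move=> h; split; last by move=> i; have := h (lift ord0 i); rewrite rV_cons_coordS.
  by have := h ord0; rewrite rV_cons_coord0 in_itv/= ler_norml.
move=> [sB h] i; rewrite in_itv/= -ler_norml in sB.
by case: (unliftP ord0 i) => [j|] ->; rewrite ?rV_cons_coordS ?rV_cons_coord0.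
Qed.

Lemma lebesgue_rV_cube n B : (lebesgue_rV R n (cube n B) < +oo)%E.
Proof.
elim: n => [|n ih] /=; first by rewrite diracE ltry.
rewrite /lebesgue_rVS /pushforward preimage_rV_cons_cube product_measure1E//=.
- by rewrite lte_mul_pinfty ?measure_ge0 ?ge0_fin_numE//= lebesgue_measure_itv/=;
    case: ifP => _; rewrite ?ltry// -EFinB ltry.
- exact: measurable_cube.
Qed.

Lemma bounded_cube n (A : set 'rV[R]_n) : bounded_set A -> exists B, A `<=` cube n B.
Proof.
move=> [M [_ hM]]; exists (M + 1) => x Ax i.
have /= := hM (M + 1) _ x Ax; rewrite ltrDl ltr01 => /(_ isT); apply: le_trans.
rewrite [leRHS]mx_normrE.
exact: (le_bigmax _ (fun ij => `|x ij.1 ij.2|) (0, i)).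
Qed.

Lemma lebesgue_rV_bounded n (A : set 'rV[R]_n) : bounded_set A -> measurable A ->
  (lebesgue_rV R n A < +oo)%E.
Proof.
move=> /bounded_cube[B AB] mA; apply: le_lt_trans (lebesgue_rV_cube n B).
by apply: le_measure => //; rewrite inE//; exact: measurable_cube.
Qed.

End LebesgueFinite.
Arguments cube {R} n B.

(** * Smooth functions *)

Section SmoothClosure.
Context {R : realType} {d : nat}.
Local Notation scal := ('rV[R]_d -> R).
Implicit Types (f g phi : scal).

(** Differentiability of all iterated partial derivatives of order at most m:
    unlike [smooth], it can be established by induction on m. *)
Definition smooth_upto (m : nat) phi := forall (s : seq 'I_d) (x : 'rV[R]_d),
  (size s <= m)%N -> differentiable (foldr partial phi s) x.

Lemma smooth_uptoP phi : smooth phi <-> forall m, smooth_upto m phi.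
Proof.
split=> [sphi m s x _|sphi s x]; first exact: sphi.
exact: (sphi (size s)).
Qed.

Lemma smooth_upto0 phi :
  (forall x : 'rV[R]_d, differentiable phi x) -> smooth_upto 0 phi.
Proof. by move=> dphi [|//] x _; exact: dphi. Qed.

Lemma smooth_uptoS m phi : (forall x : 'rV[R]_d, differentiable phi x) ->
  (forall i, smooth_upto m (partial i phi)) -> smooth_upto m.+1 phi.
Proof.
move=> dphi sphi s x; elim/last_ind: s => [|s i _]; first by move=> _; exact: dphi.
rewrite size_rcons ltnS => sm; rewrite foldr_rcons; exact: sphi.
Qed.

Lemma smooth_upto_diff m phi x : smooth_upto m phi -> differentiable phi x.
Proof. by move=> /(_ [::]); exact. Qed.

Lemma smooth_upto_partial m phi i : smooth_upto m.+1 phi -> smooth_upto m (partial i phi).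
Proof.
move=> sphi s x sm; rewrite -(foldr_rcons partial).
by apply: sphi; rewrite size_rcons.
Qed.

Lemma smooth_upto_le m m' phi : (m <= m')%N -> smooth_upto m' phi -> smooth_upto m phi.
Proof. by move=> mm' sphi s x sm; apply: sphi; exact: leq_trans mm'. Qed.

Lemma partialP phi i x : differentiable phi x ->
  is_derive x (delta_mx 0 i) phi (partial i phi x).
Proof. by move=> dphi; apply: derivableP; exact: diff_derivable. Qed.

Lemma partial_lin i (a : R) f g : (forall x, differentiable f x) ->
  (forall x, differentiable g x) ->
  partial i (a *: f + g) = a *: partial i f + partial i g.
Proof.
move=> df dg; apply/funext => x; rewrite /partial deriveD ?deriveZ//.
- exact: diff_derivable.
- by apply: derivableZ; exact: diff_derivable.
- exact: diff_derivable.
Qed.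

Lemma partialM i f g : (forall x, differentiable f x) ->
  (forall x, differentiable g x) ->
  partial i (f * g) = f * partial i g + partial i f * g.
Proof.
move=> df dg; apply/funext => x; rewrite /partial deriveM//; last 2 first.
- exact: diff_derivable.
- exact: diff_derivable.
by congr (_ + _); rewrite mulrC.
Qed.

Lemma smooth_upto_lin m (a : R) f g :
  smooth_upto m f -> smooth_upto m g -> smooth_upto m (a *: f + g).
Proof.
elim: m f g => [|m ih] f g sf sg.
  apply: smooth_upto0 => x; apply: differentiableD.
    by apply: differentiableZ; exact: smooth_upto_diff sf.
  exact: smooth_upto_diff sg.
have df x := smooth_upto_diff x sf; have dg x := smooth_upto_diff x sg.
apply: smooth_uptoS => [x|i].
  by apply: differentiableD => //; exact: differentiableZ.
by rewrite partial_lin//; apply: ih; exact: smooth_upto_partial.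
Qed.

Lemma smooth_uptoD m f g :
  smooth_upto m f -> smooth_upto m g -> smooth_upto m (f + g).
Proof. by move=> sf sg; rewrite -[f]scale1r; exact: smooth_upto_lin. Qed.

Lemma smooth_uptoM m f g :
  smooth_upto m f -> smooth_upto m g -> smooth_upto m (f * g).
Proof.
elim: m f g => [|m ih] f g sf sg.
  apply: smooth_upto0 => x; apply: differentiableM.
    exact: smooth_upto_diff sf.
  exact: smooth_upto_diff sg.
have df x := smooth_upto_diff x sf; have dg x := smooth_upto_diff x sg.
apply: smooth_uptoS => [x|i]; first exact: differentiableM.
have lef : smooth_upto m f by exact: smooth_upto_le sf.
have leg : smooth_upto m g by exact: smooth_upto_le sg.
rewrite partialM//; apply: smooth_uptoD; apply: ih => //; exact: smooth_upto_partial.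
Qed.

Lemma smooth_upto_cst m (c : R) : smooth_upto m (cst c : scal).
Proof.
elim: m c => [|m ih] c; first by apply: smooth_upto0 => x; exact: differentiable_cst.
apply: smooth_uptoS => [x|i]; first exact: differentiable_cst.
rewrite (_ : partial i _ = cst 0)//; apply/funext => x.
by rewrite /partial derive_cst.
Qed.

Lemma smooth_lin (a : R) f g : smooth f -> smooth g -> smooth (a *: f + g).
Proof.
by move=> /smooth_uptoP sf /smooth_uptoP sg; apply/smooth_uptoP => m;
  exact: smooth_upto_lin.
Qed.

Lemma smoothM f g : smooth f -> smooth g -> smooth (f * g).
Proof.
by move=> /smooth_uptoP sf /smooth_uptoP sg; apply/smooth_uptoP => m;
  exact: smooth_uptoM.
Qed.

Lemma smooth_cst (c : R) : smooth (cst c : scal).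
Proof. by apply/smooth_uptoP => m; exact: smooth_upto_cst. Qed.

Lemma smooth_prod (I : Type) (r : seq I) (F : I -> scal) :
  (forall i, smooth (F i)) -> smooth (\prod_(i <- r) F i).
Proof.
move=> sF; elim/big_ind: _ => //; first exact: smooth_cst.
exact: smoothM.
Qed.

Lemma smooth_partial i f : smooth f -> smooth (partial i f).
Proof. by move=> sf s x; rewrite -(foldr_rcons partial); exact: sf. Qed.

Lemma smooth_diff f x : smooth f -> differentiable f x.
Proof. by move=> /(_ [::]); exact. Qed.

Lemma smooth_continuous f : smooth f -> continuous f.
Proof. by move=> sf x; apply: differentiable_continuous; exact: smooth_diff. Qed.

Lemma smooth_mpartial (a : 'I_d -> nat) f : smooth f -> smooth (mpartial a f).
Proof.
move=> sf; rewrite /mpartial; elim: (enum _) => //= i s ih.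
by elim: (a i) => //= m; exact: smooth_partial.
Qed.

(** Chain rule for a function of one affine coordinate. *)
Lemma is_derive_affine_coord (F : R -> R) (c e : R) (i : 'I_d) (x v : 'rV[R]_d) dF :
  is_derive (c * x 0 i + e) 1 F dF ->
  differentiable (fun y : 'rV[R]_d => F (c * y 0 i + e)) x /\
  'D_v (fun y : 'rV[R]_d => F (c * y 0 i + e)) x = c * v 0 i * dF.
Proof.
move=> [derF DF]; pose A := (fun y : 'rV[R]_d => c *: (y 0 i : R) + e).
have dcoord y : differentiable (fun z : 'rV[R]_d => z 0 i : R) y.
  exact: differentiable_coord.
have dA y : differentiable A y.
  by apply: differentiableD => //; apply: differentiableZ.
have dF' : differentiable F (A x) by apply/derivable1_diffP.
have -> : (fun y : 'rV[R]_d => F (c * y 0 i + e)) = F \o A by [].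
split; first exact: differentiable_comp.
rewrite deriveE; last exact: differentiable_comp.
rewrite diff_comp//= deriv1E// derive1E DF; congr (_ * _).
rewrite -deriveE//= /A.
have dco : is_derive x v (fun z : 'rV[R]_d => z 0 i : R) (v 0 i).
  apply: DeriveDef; first exact: diff_derivable.
  rewrite /derive; apply: cvg_lim => //.
  apply: (@cvg_trans _ ((cst (v 0 i) : R -> R) @ 0^')); last exact: cvg_cst.
  apply: near_eq_cvg; near=> h.
  have h0 : h != 0 by near: h; exact: nbhs_dnbhs_neq.
  by rewrite /= !mxE addrK /GRing.scale/= mulKf.
have := @is_deriveD _ _ _ (c *: (fun z : 'rV[R]_d => z 0 i : R)) (cst e) x v _ _
  (is_deriveZ c dco) (is_derive_cst _ _ _).
by move=> [_]; rewrite addr0.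
Unshelve. all: by end_near. Qed.

End SmoothClosure.

Section FlatExp.
Context {R : realType}.

(** x^-k exp(-1/x) for x > 0, extended by 0. The family is closed under
    differentiation up to linear combinations, so its members are smooth. *)
Definition flat_exp (k : nat) (x : R) : R :=
  if 0 < x then x ^- k * expR (- x^-1) else 0.

Lemma flat_exp_ge0 k x : 0 <= flat_exp k x.
Proof.
rewrite /flat_exp; case: ifP => // x0.
by rewrite mulr_ge0 ?expR_ge0// -exprVn exprn_ge0// invr_ge0 ltW.
Qed.

Lemma flat_exp0_le1 x : flat_exp 0 x <= 1.
Proof.
rewrite /flat_exp; case: ifP => // x0.
by rewrite expr0 invr1 mul1r expR_le1 oppr_le0 invr_ge0 ltW.
Qed.

(** The exponential series dominates any power of 1/x, so flat_exp is quadratically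
    small at 0; this gives the derivative 0 there. *)
Lemma flat_exp_bound k x : flat_exp k x <= (k.+2)`!%:R * x ^+ 2.
Proof.
rewrite /flat_exp; case: ifP => x0; last by rewrite mulr_ge0 ?sqr_ge0// ler0n.
have y0 : 0 <= x^-1 by rewrite invr_ge0 ltW.
have := expR_ge1Dxn k.+1 y0; rewrite expRN => h.
rewrite ler_pdivrMr ?expR_gt0// -ler_pdivrMl; last first.
  by rewrite mulr_gt0 ?exprn_gt0 ?ltr0n ?fact_gt0.
apply: le_trans h; rewrite -[leLHS]add0r lerD// [leRHS]mulrC invfM -mulrA.
by rewrite -!exprVn -exprD add2n.
Qed.

Lemma flat_exp_cvg0 k :
  (fun h => h^-1 *: ((flat_exp k \o shift 0) (h *: 1) - flat_exp k 0)) @ 0^' --> (0 : R).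
Proof.
pose C : R := (k.+2)`!%:R; have C0 : 0 < C by rewrite ltr0n fact_gt0.
apply/cvgrPdist_le => e e0; near=> h.
have h0 : h != 0 by near: h; exact: nbhs_dnbhs_neq.
rewrite /= [flat_exp k 0]/flat_exp ltxx subr0 sub0r normrN addr0.
rewrite [h *: 1]mulr1 /GRing.scale/= normrM normfV ler_pdivrMl ?normr_gt0//.
rewrite ger0_norm ?flat_exp_ge0// (le_trans (flat_exp_bound _ _))//.
rewrite -[h ^+ 2]real_normK ?num_real// expr2 mulrCA ler_wpM2l//.
rewrite mulrC -ler_pdivlMr// ltW//.
near: h; apply: dnbhs0_lt; exact: divr_gt0.
Unshelve. all: by end_near. Qed.

Lemma is_derive_flat_exp k (x : R) :
  is_derive x 1 (flat_exp k) (- k%:R * flat_exp k.+1 x + flat_exp k.+2 x).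
Proof.
have [x0|x0|x0] := ltgtP x 0.
- have -> : - k%:R * flat_exp k.+1 x + flat_exp k.+2 x = 0.
    by rewrite /flat_exp ltNge (ltW x0)/= mulr0 addr0.
  apply: (@near_eq_is_derive _ _ _ (cst 0)) => //.
  near=> y; rewrite /flat_exp ltNge ltW//=.
  by near: y; exact: lt_nbhsl.
- pose E := (fun y : R => expR (- y^-1)).
  pose V := (fun y : R => (y ^+ k)^-1).
  have xn0 : x != 0 by rewrite gt_eqF.
  apply: (@near_eq_is_derive _ _ _ (V * E)).
    near=> y; rewrite /flat_exp ifT//.
    by near: y; exact: lt_nbhsr.
  have dinv : is_derive x 1 (fun y : R => - y^-1) (x ^- 2).
    apply: is_derive_eq; first exact: (is_deriveN (is_deriveV xn0 (is_derive_id _ _))).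
    by rewrite scaleNr opprK /GRing.scale/= mulr1.
  have dE : is_derive x 1 E (E x * x ^- 2).
    exact: (@is_derive1_comp _ expR (fun y : R => - y^-1)).
  have dV : is_derive x 1 V (- (x ^+ k) ^- 2 *: ((k%:R * x ^+ k.-1) *: 1)).
    apply: (@is_deriveV _ (fun y : R => y ^+ k)); first by rewrite expf_neq0.
    have := is_deriveX k (is_derive_id x (1 : R)).
    by rewrite (_ : id ^+ k = (fun y => y ^+ k))//; apply/funext => y; rewrite exprfctE.
  apply: is_derive_eq (is_deriveM dV dE) _.
  rewrite /flat_exp x0 /V /E /GRing.scale/= -/(E x).
  have xk0 j : x ^+ j != 0 by rewrite expf_neq0.
  case: k @V dV => [|k] V dV /=; first by rewrite !expr0; field.
  by rewrite !exprS; field; rewrite xn0 xk0.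
- rewrite x0 /flat_exp ltxx mulr0 addr0; apply: DeriveDef.
    by apply/cvg_ex; exists 0; exact: flat_exp_cvg0.
  by apply: cvg_lim => //; exact: flat_exp_cvg0.
Unshelve. all: by end_near. Qed.

Lemma smooth_upto_flat_exp d m k (c e : R) (i : 'I_d) :
  smooth_upto m (fun x : 'rV[R]_d => flat_exp k (c * x 0 i + e)).
Proof.
elim: m k => [|m ih] k.
  apply: smooth_upto0 => x.
  by have [] := is_derive_affine_coord 0 (is_derive_flat_exp k (c * x 0 i + e)).
apply: smooth_uptoS => [x|j].
  by have [] := is_derive_affine_coord 0 (is_derive_flat_exp k (c * x 0 i + e)).
pose v : 'rV[R]_d := delta_mx 0 j.
rewrite (_ : partial j _ =
  (c * v 0 i * - k%:R) *: (fun x : 'rV[R]_d => flat_exp k.+1 (c * x 0 i + e)) +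
  ((c * v 0 i) *: (fun x : 'rV[R]_d => flat_exp k.+2 (c * x 0 i + e)) + 0)).
  apply: smooth_upto_lin => //; apply: smooth_upto_lin => //.
  exact: smooth_upto_cst.
apply/funext => x; rewrite /partial.
have [_ ->] := is_derive_affine_coord v (is_derive_flat_exp k (c * x 0 i + e)).
by rewrite mulrDr mulrA -[RHS]/(_ * _ + (_ * _ + 0)) addr0.
Qed.

Lemma smooth_flat_exp d k (c e : R) (i : 'I_d) :
  smooth (fun x : 'rV[R]_d => flat_exp k (c * x 0 i + e)).
Proof. by apply/smooth_uptoP => m; exact: smooth_upto_flat_exp. Qed.

End FlatExp.

(** * The fundamental lemma of the calculus of variations *)

Section Bump.
Context {R : realType} {d : nat}.
Implicit Types (a b : 'I_d -> R).

(** Smooth, with values in [0, 1], positive exactly on the open box, and increasing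
    to its indicator function as n grows. *)
Definition bump a b (n : nat) : 'rV[R]_d -> R :=
  \prod_i ((fun x : 'rV[R]_d => flat_exp 0 (n.+1%:R * x 0 i + - n.+1%:R * a i)) *
           (fun x : 'rV[R]_d => flat_exp 0 (- n.+1%:R * x 0 i + n.+1%:R * b i))).

Definition cbox a b : set 'rV[R]_d := [set x | forall i, a i <= x 0 i <= b i].

Lemma compact_cbox a b : compact (cbox a b).
Proof.
have := @rV_compact R d (fun i => `[a i, b i]%classic) (fun i => @segment_compact R _ _).
by congr compact; apply/funext => x; apply/propext; split=> h i; have := h i;
  rewrite /= in_itv.
Qed.

Lemma bumpE a b n x : bump a b n x =
  \prod_i (flat_exp 0 (n.+1%:R * (x 0 i - a i)) * flat_exp 0 (n.+1%:R * (b i - x 0 i))).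
Proof.
rewrite /bump (big_morph (fun f : 'rV[R]_d -> R => f x) (id1 := 1) (op1 := *%R))//.
apply: eq_bigr => i _; rewrite -[LHS]/(_ * _) mulrBr mulrBr.
by rewrite mulNr mulNr [- _ + _]addrC.
Qed.

Lemma smooth_bump a b n : smooth (bump a b n).
Proof. by apply: smooth_prod => i; apply: smoothM; exact: smooth_flat_exp. Qed.

Lemma bump_ge0 a b n x : 0 <= bump a b n x.
Proof. by rewrite bumpE prodr_ge0// => i _; rewrite mulr_ge0 ?flat_exp_ge0. Qed.

Lemma bump_le1 a b n x : bump a b n x <= 1.
Proof.
rewrite bumpE; apply: prodr_ile1 => i _.
by rewrite mulr_ge0 ?flat_exp_ge0//= mulr_ile1 ?flat_exp_ge0 ?flat_exp0_le1.
Qed.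

Lemma bump_out a b n x : ~ obox a b x -> bump a b n x = 0.
Proof.
move=> /existsNP[i /negP xi]; rewrite bumpE (bigD1 i)//=.
rewrite [X in X * _](_ : _ = 0) ?mul0r//.
move: xi; rewrite negb_and -!leNgt => /orP[xa|bx].
- by rewrite /flat_exp ifN ?mul0r// -leNgt pmulr_rle0// subr_le0.
- by rewrite mulrC /flat_exp ifN ?mul0r// -leNgt pmulr_rle0// subr_le0.
Qed.

Lemma cvg_flat_exp (c : R) : 0 < c -> flat_exp 0 (n.+1%:R * c) @[n --> \oo] --> (1 : R).
Proof.
move=> c0.
have -> : (fun n => flat_exp 0 (n.+1%:R * c)) = (fun n => expR (- (c^-1 * harmonic n))).
  apply/funext => n; rewrite /flat_exp pmulr_rgt0// c0 expr0 invr1 mul1r.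
  by rewrite invfM mulrC.
rewrite -expR0; apply: continuous_cvg; first exact: continuous_expR.
rewrite -oppr0; apply: cvgN; rewrite -(mulr0 c^-1).
by apply: cvgM; [exact: cvg_cst|exact: cvg_harmonic].
Qed.

Lemma cvg_bump a b x : bump a b n x @[n --> \oo] --> (\1_(obox a b) x : R).
Proof.
have [abx|/[dup] nx /bump_out h] := pselect (obox a b x); last first.
  by rewrite indicE memNset//; apply: cvg_near_cst; apply: nearW => n; rewrite h.
rewrite indicE mem_set//=.
have -> : (fun n => bump a b n x) = (fun n => \prod_i
    (flat_exp 0 (n.+1%:R * (x 0 i - a i)) * flat_exp 0 (n.+1%:R * (b i - x 0 i)))).
  by apply/funext => n; rewrite bumpE.
have E1 : \prod_(i < d) (1 * 1) = 1 :> R by rewrite big1// => i _; rewrite mul1r.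
rewrite -[X in _ --> X]E1; apply: cvg_big => //= [|i _]; first exact: mul_continuous.
have /andP[ax xb] := abx i.
by apply: cvgM; apply: cvg_flat_exp; rewrite subr_gt0.
Qed.

Lemma supported_bump (Omega : set 'rV[R]_d) a b n : cbox a b `<=` Omega ->
  supported_in Omega (bump a b n).
Proof.
move=> abO; exists (cbox a b); first by split => //; exact: compact_cbox.
move=> x nx; apply: bump_out => h; apply: nx => i.
by have /andP[/ltW-> /ltW->] := h i.
Qed.

End Bump.

Section FundamentalLemma.
Context {R : realType} {d : nat}.
Local Notation mu := (lebesgue_rV R d).
Variable Omega : set 'rV[R]_d.
Hypothesis dO : domain Omega.

Lemma measurable_domain : measurable Omega.
Proof. by case: dO => oO _ _ _; exact: open_measurable_rV. Qed.
Local Notation mO := measurable_domain.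

Lemma finite_domain : (mu Omega < +oo)%E.
Proof. by case: dO => _ _ _ bO; apply: lebesgue_rV_bounded => //; exact: mO. Qed.

Lemma semi_inner_L2 : semi_inner (L2 Omega) (inner Omega).
Proof. exact: (semi_inner_l2 mu mO). Qed.

Lemma subspace_L2 : subspace (L2 Omega).
Proof. by case: semi_inner_L2. Qed.

Lemma L2_bounded (f : 'rV[R]_d -> R) (M : R) : measurable_fun Omega f -> (forall x, Omega x -> `|f x| <= M) ->
  L2 Omega f.
Proof. by move=> mf; apply: bounded_sq_integrable => //; [exact: mO|exact: finite_domain]. Qed.

Lemma L2_integrable (f : 'rV[R]_d -> R) : L2 Omega f -> mu.-integrable Omega (EFin \o f).
Proof.
move=> Lf; have L1 : L2 Omega (cst 1).
  by apply: (@L2_bounded _ 1) => // x _; rewrite normr1.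
have := sq_integrableM mO Lf L1; congr (_.-integrable _ _).
by apply/funext => x /=; rewrite mulr1.
Qed.

(** Two functions of L^2 with the same integrals against test functions agree
    almost everywhere: the bumps of a box increase to its indicator, so their
    integrals agree on boxes, hence on all measurable sets. *)
Section Vanishing.
Variable g : 'rV[R]_d -> R.
Hypothesis Lg : L2 Omega g.
Hypothesis g0 : forall phi, smooth phi -> supported_in Omega phi -> inner Omega g phi = 0.

Let mg : measurable_fun Omega g. Proof. by case: Lg. Qed.

(** Dominated convergence along the bumps passes from test functions to boxes. *)
Lemma integral_obox_eq0 (a b : 'I_d -> R) : cbox a b `<=` Omega ->
  (\int[mu]_(x in obox a b) (g x)%:E)%E = 0%E.
Proof.
move=> abO; have mab := measurable_obox a b.
have obO : obox a b `<=` Omega.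
  by move=> x h; apply: abO => i; have /andP[/ltW-> /ltW->] := h i.
have mbump n : measurable_fun Omega (bump a b n).
  apply: (@measurable_funS _ _ _ _ setT) => //.
  by apply: continuous_measurable_rV; apply: smooth_continuous; exact: smooth_bump.
have m1 n : measurable_fun Omega (fun x => (g x * bump a b n x)%:E).
  by apply/measurable_EFinP; exact: measurable_funM.
have m2 : measurable_fun Omega (fun x => (g x * \1_(obox a b) x)%:E).
  by apply/measurable_EFinP; apply: measurable_funM => //; exact: measurable_indic.
have dcv : {ae mu, forall x, Omega x ->
    (g x * bump a b n x)%:E @[n --> \oo] --> (g x * \1_(obox a b) x)%:E}.
  apply: aeW => x _; apply: cvg_EFin; first exact: nearW.
  by apply: cvgM; [exact: cvg_cst|exact: cvg_bump].
have dom : {ae mu, forall x n, Omega x -> (`|(g x * bump a b n x)%:E| <= `|g x|%:E)%E}.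
  apply: aeW => x n _ /=; rewrite lee_fin normrM ler_piMr//.
  by rewrite ger0_norm ?bump_ge0 ?bump_le1.
have [_ _ cv] := dominated_convergence mO m1 m2 dcv
  (integrable_norm (L2_integrable Lg)) dom.
rewrite -(setIidr obO) integral_mkcondr.
transitivity (\int[mu]_(x in Omega) (g x * \1_(obox a b) x)%:E)%E.
  apply: eq_integral => x _; rewrite patchE indicE.
  by case: ifP => _; rewrite ?mulr1 ?mulr0.
rewrite -(cvg_lim _ cv)//; apply: lim_near_cst => //; apply: nearW => n /=.
have gn0 : inner Omega g (bump a b n) = 0.
  by apply: g0; [exact: smooth_bump|exact: supported_bump].
have Lb : L2 Omega (bump a b n).
  apply: (@L2_bounded _ 1) => // x _.
  by rewrite ger0_norm ?bump_ge0 ?bump_le1.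
have := sq_integrableM mO Lg Lb => /(integrable_fin_num mO)/fineK <-.
by rewrite -[X in X%:E]/(inner Omega g (bump a b n)) gn0.
Qed.

(** The measurable sets over which g integrates to 0 within a fixed box form a
    Dynkin system containing the boxes. *)
Lemma integral_obox_meas_eq0 (a b : 'I_d -> R) (S : set 'rV[R]_d) :
  cbox a b `<=` Omega -> measurable S ->
  (\int[mu]_(x in S `&` obox a b) (g x)%:E)%E = 0%E.
Proof.
move=> abO mS; have mab := measurable_obox a b.
have obO : obox a b `<=` Omega.
  by move=> x h; apply: abO => i; have /andP[/ltW-> /ltW->] := h i.
have ig A : measurable A -> mu.-integrable (A `&` obox a b) (EFin \o g).
  move=> mA; apply: integrableS (L2_integrable Lg); first exact: mO.
    exact: measurableI.
  by apply: subset_trans obO; exact: subIsetr.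
rewrite measurable_oboxes in mS; move: mS.
move: S; apply: (dynkin_induction (measurable_oboxes (n := d)) setI_closed_oboxes).
- by rewrite setTI integral_obox_eq0.
- move=> _ [a' [b' ->]].
  have [a2 [b2 [E E1 E2]]] : exists a2 b2, [/\ obox a' b' `&` obox a b = obox a2 b2,
      forall i, a i <= a2 i & forall i, b2 i <= b i].
    exists (fun i => Num.max (a' i) (a i)), (fun i => Num.min (b' i) (b i)); split.
    + apply/seteqP; split => x /=.
        move=> [h h'] i; have /andP[h1 h2] := h i; have /andP[h3 h4] := h' i.
        by rewrite gt_max lt_min h1 h2 h3 h4.
      by move=> h; split => i; move: (h i); rewrite gt_max lt_min =>
        /andP[/andP[h1 h2] /andP[h3 h4]]; rewrite ?h1 ?h2 ?h3 ?h4.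
    + by move=> i; rewrite le_max lexx orbT.
    + by move=> i; rewrite ge_min lexx orbT.
  rewrite E integral_obox_eq0// => x h; apply: abO => i.
  by have /andP[h1 h2] := h i; rewrite (le_trans _ h1)//= (le_trans h2).
- move=> S mS S0.
  have := integral_obox_eq0 abO.
  rewrite (_ : obox a b = (S `&` obox a b) `|` (~` S `&` obox a b)); last first.
    by rewrite -setIUl setUv setTI.
  rewrite integral_setU//.
  + by rewrite -[X in (\int[_]_(x in X `&` _) _)%E]/S S0 add0e => <-; rewrite -setIUl setUv setTI.
  + exact: measurableI.
  + by apply: measurableI => //; exact: measurableC.
  + rewrite -setIUl setUv; apply: measurable_int (ig _ measurableT).
  + by apply/disj_setPS => x [[Sx _] []].
- move=> F mF tF F0; rewrite setI_bigcupl integral_bigcup.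
  + by rewrite eseries0// => i _ _; exact: F0.
  + exact: trivIset_setIr.
  + by move=> k; exact: measurableI.
  + by rewrite -setI_bigcupl; apply: ig; exact: bigcupT_measurable.
Qed.

(** The domain is a countable union of rational boxes whose closures it contains. *)
Lemma ae_eq0_of_test : {ae mu, forall x, Omega x -> g x = 0}.
Proof.
have ae_box (q : {ffun 'I_d -> rat * rat}) : cbox (fun i => ratr (q i).1) (fun i => ratr (q i).2) `<=` Omega ->
    {ae mu, forall x, @ratbox R d q x -> g x = 0}.
  move=> qO; have mq : measurable (@ratbox R d q) by exact: measurable_obox.
  have obO : ratbox q `<=` Omega.
    by move=> x h; apply: qO => i; have /andP[/ltW-> /ltW->] := h i.
  have := @integral_ae_eq _ _ _ mu (ratbox q) mq (cst 0%E) (EFin \o g).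
  have -> : mu.-integrable (ratbox q) (EFin \o g).
    by apply: integrableS (L2_integrable Lg) => //; exact: mO.
  move=> /(_ isT (measurable_cst _)) H.
  have /H : forall E, E `<=` ratbox q -> measurable E ->
      (\int[mu]_(x in E) (EFin \o g) x = \int[mu]_(x in E) cst 0 x)%E.
    move=> E Eq mE; rewrite integral0 -(setIidl Eq).
    exact: integral_obox_meas_eq0.
  by apply: filterS => x /= h /h [].
have : {ae mu, forall x, forall k, (if @unpickle {ffun 'I_d -> rat * rat} k is Some q then
    if `[< cbox (fun i => ratr (q i).1) (fun i => ratr (q i).2) `<=` Omega >]
    then @ratbox R d q x -> g x = 0 else True else True)}.
  apply: ae_foralln => k; case: unpickle => [q|]; last exact: aeW.
  by case: asboolP => [/ae_box//|_]; exact: aeW.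
apply: filterS => x h Ox; case: dO => oO _ _ _.
have [e e0 eO] := open_obox_subset oO Ox.
have [q [qx _ qb]] := obox_ratbox x (divr_gt0 e0 (ltr0Sn R 1)).
have := h (pickle q); rewrite pickleK asboolT; first exact.
move=> y yq; apply: eO => i; have /andP[h1 h2] := yq i; have [h3 h4] := qb i.
have h5 : e / 2 < e by rewrite ltr_pdivrMr// ltr_pMr// ltr1n.
by move: h1 h2 h3 h4 h5; lra.
Qed.

End Vanishing.
End FundamentalLemma.

(** * Integration by parts *)

Section Slices.
Context {R : realType}.

(** A directional derivative only depends on the restriction to the line: this
    moves derivatives between a slice and the whole space. *)
Lemma is_derive_reparam (V V' : normedModType R) (F : V -> R) (F' : V' -> R)
    (x v : V) (x' v' : V') (l : R) :
  (forall h : R, F (h *: v + x) = F' (h *: v' + x')) -> F x = F' x' ->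
  is_derive x v F l -> is_derive x' v' F' l.
Proof.
move=> FF' Fx [dF DF].
have E : (fun h : R => h^-1 *: ((F \o shift x) (h *: v) - F x)) =
         (fun h : R => h^-1 *: ((F' \o shift x') (h *: v') - F' x')).
  by apply/funext => h /=; rewrite FF' Fx.
by split; [rewrite /derivable -E|rewrite /derive -E].
Qed.

Lemma rV_cons_shift0 n (a h : R) (y : 'rV[R]_n) :
  h *: delta_mx 0 ord0 + rV_cons (a, y) = rV_cons (h *: (1 : R) + a : R, y).
Proof.
apply/rowP => i; rewrite [LHS]mxE [X in X + _]mxE [X in _ * X + _]mxE.
case: (unliftP ord0 i) => [j|] ->; rewrite ?rV_cons_coordS ?rV_cons_coord0/=.
  by rewrite ?andbF /= mulr0 add0r.
by [].
Qed.

Lemma rV_cons_shiftS n (a h : R) (y : 'rV[R]_n) (j : 'I_n) :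
  h *: delta_mx 0 (lift ord0 j) + rV_cons (a, y) =
  rV_cons (a, h *: delta_mx 0 j + y).
Proof.
apply/rowP => i; rewrite [LHS]mxE [X in X + _]mxE [X in _ * X + _]mxE.
case: (unliftP ord0 i) => [k|] ->; rewrite ?rV_cons_coordS ?rV_cons_coord0/=.
  by rewrite [RHS]mxE [X in _ = X + _]mxE [X in _ = _ * X + _]mxE (inj_eq lift_inj).
by rewrite ?andbF mulr0 add0r.
Qed.

Lemma continuous_rV_consl n (y : 'rV[R]_n) : continuous (fun a : R => rV_cons (a, y)).
Proof.
move=> a A /nbhs_ballP[e /= e0 eA]; apply/nbhs_ballP; exists e => //= b ab.
apply: eA; split => // i j; rewrite ord1.
case: (unliftP ord0 j) => [k|] ->; rewrite ?rV_cons_coordS ?rV_cons_coord0//.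
exact: ballxx.
Qed.

Lemma continuous_rV_consr n (a : R) :
  continuous (fun y : 'rV[R]_n => rV_cons (a, y)).
Proof.
move=> y A /nbhs_ballP[e /= e0 eA]; apply/nbhs_ballP; exists e => //= z [_ yz].
apply: eA; split => // i j; rewrite ord1.
case: (unliftP ord0 j) => [k|] ->; rewrite ?rV_cons_coordS ?rV_cons_coord0//.
exact: ballxx.
Qed.

Lemma cube_rV_cons n (B a : R) (y : 'rV[R]_n) :
  cube n.+1 B (rV_cons (a, y)) <-> (`|a| <= B /\ cube n B y).
Proof.
have : (@rV_cons R n @^-1` cube n.+1 B) (a, y) = (`[- B, B]%classic `*` cube n B) (a, y).
  by rewrite preimage_rV_cons_cube.
by rewrite /= in_itv/= -ler_norml => ->.
Qed.

Lemma compact_cube n (B : R) : compact (cube n B).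
Proof.
have := @compact_cbox R n (fun=> - B) (fun=> B); congr compact.
by apply/seteqP; split => x h i; have := h i; rewrite ler_norml.
Qed.

Lemma integrable_cube_support n (G : 'rV[R]_n -> R) (B : R) : continuous G ->
  (forall x, ~ cube n B x -> G x = 0) -> (lebesgue_rV R n).-integrable setT (EFin \o G).
Proof.
move=> cG G0; have mc := @measurable_cube R n B.
have -> : EFin \o G = (EFin \o G) \_ (cube n B).
  apply/funext => x; rewrite patchE; case: ifPn => //; rewrite notin_setE => /G0 /=.
  by move=> ->.
apply/(integrable_mkcond (EFin \o G) mc).1; apply: (@measurable_bounded_integrable _ _ _ (lebesgue_rV R n) G _ mc).
- exact: lebesgue_rV_cube.
- by apply: measurable_funTS; exact: continuous_measurable_rV.
- have : compact (G @` cube n B).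
    by apply: continuous_compact (@compact_cube n B); exact: continuous_subspaceT.
  move=> /compact_bounded[M [Mr hM]]; exists M; split => // y My x cx.
  by apply: (hM _ My); exists x.
Qed.

Lemma integral_lebesgue_rVS n (f : 'rV[R]_n.+1 -> \bar R) :
  (lebesgue_rV R n.+1).-integrable setT f -> measurable_fun setT f ->
  (lebesgue_measure \x lebesgue_rV R n)%E.-integrable setT (f \o @rV_cons R n) ->
  (\int[lebesgue_rV R n.+1]_x f x =
   \int[(lebesgue_measure \x lebesgue_rV R n)%E]_z f (rV_cons z))%E.
Proof.
move=> If mf Ifc.
transitivity (\int[pushforward (lebesgue_measure \x lebesgue_rV R n)%E (@rV_cons R n)]_x f x)%E.
  by apply: eq_measure_integral => [|mc A mA _]; first exact: measurable_rV_cons.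
by rewrite (integral_pushforward (measurable_rV_cons (n := n))).
Qed.

(** The integral over the whole space of a partial derivative with bounded
    support vanishes: Fubini reduces it to one variable. *)
Lemma integral_derive_eq0 n (i : 'I_n) (F G : 'rV[R]_n -> R) (B : R) :
  continuous G -> (forall x, is_derive x (delta_mx 0 i) F (G x)) ->
  (forall x, ~ cube n B x -> F x = 0 /\ G x = 0) ->
  (\int[lebesgue_rV R n]_x (G x)%:E)%E = 0%E.
Proof.
elim: n i F G => [[]//|n ih] i F G cG dF FG0.
have mG := continuous_measurable_rV cG.
have IG : (lebesgue_rV R n.+1).-integrable setT (EFin \o G).
  by apply: (integrable_cube_support (B := B)) => // x /FG0[].
have IGc : (lebesgue_measure \x lebesgue_rV R n)%E.-integrable setT
    ((EFin \o G) \o @rV_cons R n).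
  apply/integrableP; split.
    apply: measurableT_comp; first exact/measurable_EFinP.
    exact: measurable_rV_cons.
  have /integrableP[_] := IG.
  rewrite (_ : integral _ _ _ = (\int[pushforward (lebesgue_measure \x lebesgue_rV R n)%E
     (@rV_cons R n)]_x `|(EFin \o G) x|)%E); last first.
    by apply: eq_measure_integral => [|mc A mA _]; first exact: measurable_rV_cons.
  rewrite ge0_integral_pushforward//; first exact: measurable_rV_cons.
  by apply: measurableT_comp => //; exact/measurable_EFinP.
rewrite integral_lebesgue_rVS//; last exact/measurable_EFinP.
case: (unliftP ord0 i) => [j|] ei; subst i.
  rewrite -(integral12_prod_meas1 IGc) integral0_eq// => a _.
  apply: (ih j (fun y => F (rV_cons (a, y))) (fun y => G (rV_cons (a, y)))).
  - move=> y; apply: (@continuous_comp _ _ _ (fun y => rV_cons (a, y)) G).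
      exact: continuous_rV_consr.
    exact: cG.
  - move=> y; apply: is_derive_reparam (dF (rV_cons (a, y))) => // h.
    by rewrite rV_cons_shiftS.
  - by move=> y nB; apply: FG0 => /cube_rV_cons[].
rewrite -(integral21_prod_meas1 IGc) integral0_eq// => y _.
pose g := fun a : R => G (rV_cons (a, y)); pose f := fun a : R => F (rV_cons (a, y)).
have cg : continuous g.
  move=> a; apply: (@continuous_comp _ _ _ (fun a : R => rV_cons (a, y)) G).
    exact: continuous_rV_consl.
  exact: cG.
have df (a : R) : is_derive a (1 : R) f (g a).
  apply: is_derive_reparam (dF (rV_cons (a, y))) => // h.
  by rewrite rV_cons_shift0.
have cf : continuous f.
  by move=> a; apply: differentiable_continuous; apply/derivable1_diffP; case: (df a).
(* The interval is longer than the support, so f vanishes at its ends. *)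
pose b : R := `|B| + 1; have b0 : 0 < b by rewrite ltr_pwDr.
have Bb : B < b by rewrite (le_lt_trans (ler_norm _))// ltrDl.
have out (a : R) : b <= `|a| -> f a = 0 /\ g a = 0.
  move=> ba; apply: FG0 => /cube_rV_cons[aB _].
  by have := lt_le_trans Bb (le_trans ba aB); rewrite ltxx.
transitivity (\int[lebesgue_measure]_(a in `[(- b)%R, b%R]) (g a)%:E)%E.
  rewrite [RHS]integral_mkcond; apply: eq_integral => a _; rewrite patchE /=.
  case: ifPn => //; rewrite notin_setE /= in_itv/= -ler_norml => /negP.
  by rewrite -ltNge => /ltW /out[_ ga]; rewrite -/(g a) ga.
rewrite (@continuous_FTC2 _ g f).
- by rewrite (out b _).1 ?(out (- b) _).1 ?normrN ?(gtr0_norm b0)// subee.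
- by rewrite gtrN.
- exact: continuous_subspaceT.
- split.
  + by move=> a _; case: (df a).
  + by apply: cvg_at_right_filter; exact: cf.
  + by apply: cvg_at_left_filter; exact: cf.
- by move=> a _; rewrite derive1E; case: (df a).
Qed.

End Slices.

Section ByParts.
Context {R : realType} {d : nat}.
Local Notation mu := (lebesgue_rV R d).
Implicit Types (Omega : set 'rV[R]_d) (phi psi : 'rV[R]_d -> R).

Lemma supported_partial Omega phi i : supported_in Omega phi ->
  supported_in Omega (partial i phi).
Proof.
move=> [C [cC CO] C0]; exists C => // x nCx.
have clC : closed C by apply: compact_closed => //; exact: norm_hausdorff.
rewrite /partial (@near_eq_derive _ _ _ phi (cst 0)) ?derive_cst//.
have : nbhs x (~` C) by apply: open_nbhs_nbhs; split => //; exact: closed_openC.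
by apply: filterS => y; exact: C0.
Qed.

Lemma supported_mpartial Omega phi (a : 'I_d -> nat) : supported_in Omega phi ->
  supported_in Omega (mpartial a phi).
Proof.
move=> sphi; rewrite /mpartial; elim: (enum _) => //= i s ih.
by elim: (a i) => //= m; exact: supported_partial.
Qed.

Lemma supported_cube Omega phi : supported_in Omega phi ->
  exists B, forall x, ~ cube d B x -> phi x = 0.
Proof.
move=> [C [cC _] C0]; have [B CB] := bounded_cube (compact_bounded cC).
by exists B => x nB; apply: C0 => /CB.
Qed.

Lemma continuous_supported_bounded Omega phi : continuous phi -> supported_in Omega phi ->
  exists M, forall x, `|phi x| <= M.
Proof.
move=> cphi /supported_cube[B hB].
have : compact (phi @` cube d B).
  by apply: continuous_compact (@compact_cube R d B); exact: continuous_subspaceT.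
move=> /compact_bounded[M [_ hM]]; exists (`|M| + 1) => x.
have [cx|/hB ->] := pselect (cube d B x); last by rewrite normr0 addr_ge0.
by apply: (hM (`|M| + 1)); [rewrite (le_lt_trans (ler_norm _))// ltrDl|exists x].
Qed.

Lemma integral_supported Omega phi : measurable Omega -> supported_in Omega phi ->
  (\int[mu]_(x in Omega) phi x = \int[mu]_x phi x)%R.
Proof.
move=> mO [C [_ CO] C0]; rewrite /Rintegral integral_mkcond; congr fine.
apply: eq_integral => x _; rewrite patchE; case: ifPn => //.
by rewrite notin_setE => nO; rewrite C0// => /CO.
Qed.

(** The product rule, the product having compact support: phi itself need not
    have its support in the domain. *)
Lemma integration_by_parts Omega phi psi i : measurable Omega ->
  smooth phi -> smooth psi -> supported_in Omega psi ->
  inner Omega phi (partial i psi) = - inner Omega (partial i phi) psi.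
Proof.
move=> mO sphi spsi supp.
have supM (f : 'rV[R]_d -> R) g : supported_in Omega g -> supported_in Omega (f * g).
  by move=> [C cC C0]; exists C => // x /C0 h; rewrite -[LHS]/(f x * g x) h mulr0.
pose f1 := phi * partial i psi; pose f2 := partial i phi * psi.
have s1 : supported_in Omega f1 by apply: supM; exact: supported_partial.
have s2 : supported_in Omega f2 by exact: supM.
have c1 : continuous f1.
  by apply: smooth_continuous; apply: smoothM => //; exact: smooth_partial.
have c2 : continuous f2.
  by apply: smooth_continuous; apply: smoothM => //; exact: smooth_partial.
have I1 : mu.-integrable setT (EFin \o f1).
  by have [B hB] := supported_cube s1; exact: integrable_cube_support hB.
have I2 : mu.-integrable setT (EFin \o f2).
  by have [B hB] := supported_cube s2; exact: integrable_cube_support hB.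
apply/eqP; rewrite -addr_eq0.
rewrite -[inner _ phi _]/(\int[mu]_(x in Omega) f1 x) integral_supported//.
rewrite -[inner _ _ psi]/(\int[mu]_(x in Omega) f2 x) integral_supported//.
rewrite -RintegralD//.
have [B hB] := supported_cube (supM phi _ supp).
have [B1 hB1] := supported_cube s1; have [B2 hB2] := supported_cube s2.
have sub (b b' : R) x : b <= b' -> ~ cube d b' x -> ~ cube d b x.
  by move=> bb' nb' cb; apply: nb' => j; exact: le_trans (cb j) bb'.
apply/eqP; rewrite /Rintegral; apply: (congr1 fine (y := 0%E)).
apply: (@integral_derive_eq0 R d i (phi * psi) (f1 + f2) (Num.max B (Num.max B1 B2))).
- have := smooth_continuous (smooth_lin 1
    (smoothM sphi (smooth_partial i spsi)) (smoothM (smooth_partial i sphi) spsi)).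
  by rewrite scale1r.
- move=> x; have dM : differentiable (phi * psi) x.
    by apply: smooth_diff; exact: smoothM.
  apply: is_derive_eq (partialP i dM) _.
  by rewrite partialM// => y; exact: smooth_diff.
- move=> x nx; split.
    by apply: hB; apply: sub nx; rewrite le_max lexx.
  rewrite -[LHS]/(f1 x + f2 x) hB1 ?hB2 ?addr0//; apply: sub nx;
    by rewrite !le_max lexx ?orbT.
Qed.

End ByParts.

(** * Sobolev spaces as semi-inner product spaces *)

Section SobolevLinear.
Context {R : realType} {d : nat}.
Local Notation mu := (lebesgue_rV R d).
Local Notation scal := ('rV[R]_d -> R).
Local Notation vec := ('I_d -> 'rV[R]_d -> R).
Variable Omega : set 'rV[R]_d.
Hypothesis dO : domain Omega.
Implicit Types (f g h phi psi z : scal) (u v : vec) (a : 'I_d -> nat).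
Local Notation mO := (measurable_domain dO).
Local Notation sL2 := (subspace_L2 dO).
Local Notation iL2 := (semi_inner_L2 dO).

Lemma L2norm_ge0 f : 0 <= L2norm Omega f.
Proof. exact: sqrtr_ge0. Qed.

Lemma inner_diag_ge0 f : 0 <= inner Omega f f.
Proof. by apply: Rintegral_ge0 => x _; rewrite -expr2 sqr_ge0. Qed.

Lemma L2norm_sqr f : L2norm Omega f ^+ 2 = inner Omega f f.
Proof. by rewrite sqr_sqrtr// inner_diag_ge0. Qed.

Lemma inner_cauchy_schwarz f g : L2 Omega f -> L2 Omega g ->
  `|inner Omega f g| <= L2norm Omega f * L2norm Omega g.
Proof. exact: (cauchy_schwarz iL2). Qed.

Lemma L2normD f g : L2 Omega f -> L2 Omega g ->
  L2norm Omega (f + g) <= L2norm Omega f + L2norm Omega g.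
Proof. exact: (semi_normD iL2). Qed.

Lemma L2normZ (c : R) f : L2 Omega f -> L2norm Omega (c *: f) = `|c| * L2norm Omega f.
Proof. exact: (semi_normZ iL2). Qed.

Lemma L2_supported phi : continuous phi -> supported_in setT phi -> L2 Omega phi.
Proof.
move=> cphi /(continuous_supported_bounded cphi)[M hM].
apply: (L2_bounded dO (M := M)) => //.
by apply: measurable_funTS; exact: continuous_measurable_rV.
Qed.

Lemma supported_inT phi : supported_in Omega phi -> supported_in setT phi.
Proof. by move=> [C [cC _] C0]; exists C. Qed.

Lemma L2_test phi : smooth phi -> supported_in Omega phi -> L2 Omega phi.
Proof.
move=> sphi supp; apply: L2_supported (supported_inT supp).
exact: smooth_continuous.
Qed.

Lemma L2_test_mpartial phi a : smooth phi -> supported_in Omega phi ->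
  L2 Omega (mpartial a phi).
Proof.
by move=> sphi supp; apply: L2_test; [exact: smooth_mpartial|exact: supported_mpartial].
Qed.

Lemma inner_ae0 f z : L2 Omega f -> L2 Omega z ->
  {ae mu, forall x, Omega x -> f x = 0} -> inner Omega f z = 0.
Proof.
move=> [mf _] [mz _] f0; rewrite /inner /Rintegral (ae_eq_integral (cst 0%E))//.
- by rewrite integral0.
- exact: mO.
- by apply/measurable_EFinP; exact: measurable_funM.
- by apply: filterS f0 => x h /h /= ->; rewrite mul0r.
Qed.

(** Weak derivatives agree almost everywhere, hence as seen through the inner
    product; as functions they may differ. *)
Lemma weak_mpartial_uniq a f g h z : L2 Omega g -> L2 Omega h -> L2 Omega z ->
  weak_mpartial Omega a f g -> weak_mpartial Omega a f h ->
  inner Omega g z = inner Omega h z.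
Proof.
move=> Lg Lh Lz wg wh; have Lgh : L2 Omega (g - h) by exact: (subspaceB sL2).
apply/eqP; rewrite -subr_eq0 -(formB (sip_lin iL2 Lz))//; apply/eqP.
apply: inner_ae0 => //; apply: (ae_eq0_of_test dO) => // phi sphi supp.
rewrite (formB (sip_lin iL2 _))//; last exact: L2_test.
have := wg phi sphi supp; rewrite (wh phi sphi supp) => /eqP.
rewrite eq_sym -subr_eq0 -mulrBr mulf_eq0 expf_eq0 oppr_eq0 oner_eq0 andbF/=.
by move=> /eqP.
Qed.

Lemma weak_mpartial_lin a (c : R) f g f' g' :
  L2 Omega f -> L2 Omega g -> L2 Omega f' -> L2 Omega g' ->
  weak_mpartial Omega a f f' -> weak_mpartial Omega a g g' ->
  weak_mpartial Omega a (c *: f + g) (c *: f' + g').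
Proof.
move=> Lf Lg Lf' Lg' wf wg phi sphi supp.
have Lphi := L2_test sphi supp; have Lpphi := L2_test_mpartial a sphi supp.
by rewrite !(sip_lin iL2)// wf// wg// mulrDr mulrCA.
Qed.

Lemma sobolev_L2 m f : sobolev Omega m f -> L2 Omega f. Proof. by case. Qed.

Lemma sobolev_le m m' f : (m <= m')%N -> sobolev Omega m' f -> sobolev Omega m f.
Proof.
by move=> mm' [Lf wf]; split=> // a am; apply: wf; exact: leq_trans mm'.
Qed.

Lemma subspace_sobolev m : subspace (sobolev Omega m).
Proof.
have L0 := sL2.1; split.
  split=> // a _; exists 0 => // phi sphi supp.
  rewrite (form0 sL2 (sip_lin iL2 (L2_test_mpartial _ sphi supp))).
  by rewrite (form0 sL2 (sip_lin iL2 (L2_test sphi supp))) mulr0.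
move=> c f g [Lf wf] [Lg wg]; split; first exact: sL2.2.
move=> a am; have [f' Lf' wf'] := wf a am; have [g' Lg' wg'] := wg a am.
exists (c *: f' + g'); first exact: sL2.2.
exact: weak_mpartial_lin.
Qed.

Lemma weakDP m a f : sobolev Omega m f -> (\sum_i a i <= m)%N ->
  L2 Omega (weakD Omega a f) /\ weak_mpartial Omega a f (weakD Omega a f).
Proof.
move=> [Lf wf] am; rewrite /weakD; case: xgetP => [g _ [//]|no].
by have [g Lg wg] := wf a am; case: (no g).
Qed.

Lemma seen_linear_weakD m a : (\sum_i a i <= m)%N ->
  seen_linear (sobolev Omega m) (L2 Omega) (inner Omega) (weakD Omega a).
Proof.
move=> am; split => [f sf|c f g z sf sg Lz]; first by case: (weakDP sf am).
have [Lf wf] := weakDP sf am; have [Lg wg] := weakDP sg am.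
have [Lfg wfg] := weakDP ((subspace_sobolev m).2 c _ _ sf sg) am.
rewrite -(sip_lin iL2)//; apply: weak_mpartial_uniq wfg _ => //.
  exact: sL2.2.
by apply: weak_mpartial_lin => //; [case: sf|case: sg].
Qed.

(** The chosen derivative of order 0 is a function equal to f almost everywhere. *)
Lemma inner_weakD0 m f z : sobolev Omega m f -> L2 Omega z ->
  inner Omega (weakD Omega (fun=> 0%N) f) z = inner Omega f z.
Proof.
move=> sf Lz; have [|L0 w0] := @weakDP m (fun=> 0%N) f sf; first by rewrite sum_nat_const muln0.
apply: weak_mpartial_uniq w0 _ => //; first exact: sobolev_L2 sf.
move=> phi _ _; rewrite sum_nat_const muln0 expr0 mul1r /mpartial.
by congr inner; elim: (enum _).
Qed.

(** The inner product of which [Hnorm] is the norm. *)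
Definition Hform (m : nat) f g : R :=
  \sum_(a : {ffun 'I_d -> 'I_m.+1} | (\sum_i a i <= m)%N)
     inner Omega (weakD Omega (fun i => a i) f) (weakD Omega (fun i => a i) g).

Lemma semi_inner_Hform m : semi_inner (sobolev Omega m) (Hform m).
Proof.
apply: semi_inner_sum => [|a am]; first exact: subspace_sobolev.
apply: semi_inner_pullback iL2 _; first exact: subspace_sobolev.
exact: seen_linear_weakD.
Qed.

Lemma HnormE m : Hnorm Omega m = semi_norm (Hform m).
Proof.
apply/funext => f; rewrite /Hnorm /semi_norm; congr Num.sqrt.
by apply: eq_bigr => a _; rewrite L2norm_sqr.
Qed.

Lemma Hnorm_ge0 m f : 0 <= Hnorm Omega m f.
Proof. exact: sqrtr_ge0. Qed.

Lemma L2norm_weakD_le m a f : (\sum_i a i <= m)%N ->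
  L2norm Omega (weakD Omega a f) <= Hnorm Omega m f.
Proof.
move=> am; rewrite ler_sqrt; last first.
  by apply: sumr_ge0 => b _; rewrite sqr_ge0.
have ai i : (a i < m.+1)%N.
  by rewrite ltnS (leq_trans _ am)// (bigD1 i)//= leq_addr.
pose b := [ffun i => Ordinal (ai i)] : {ffun 'I_d -> 'I_m.+1}.
have bE : (fun i => b i : nat) = a by apply/funext => i; rewrite ffunE.
have bm : (\sum_i b i <= m)%N.
  by rewrite (eq_bigr a)// => i _; rewrite -bE.
by rewrite (bigD1 b)//= bE L2norm_sqr lerDl sumr_ge0// => c _; rewrite sqr_ge0.
Qed.

Lemma L2norm_le_Hnorm m f : sobolev Omega m f -> L2norm Omega f <= Hnorm Omega m f.
Proof.
move=> sf; have s0 : (\sum_(i < d) 0 <= m)%N by rewrite sum_nat_const muln0.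
apply: le_trans (L2norm_weakD_le f s0).
have [L0 _] := weakDP sf s0; have Lf := sobolev_L2 sf.
rewrite /L2norm (inner_weakD0 sf L0) /inner; have [_ _ bC _] := iL2.
by rewrite -!/(inner _ _ _) bC// (inner_weakD0 sf Lf).
Qed.

Lemma Hnorm0 m : Hnorm Omega m 0 = 0.
Proof. by rewrite HnormE (semi_norm0 (semi_inner_Hform m)). Qed.

(** ** Functions vanishing on a part of the boundary *)

(** The smooth functions in the definition of [H1_0] live on the whole space; by
    integration by parts they are in H^1, so that their distance to a function
    of H^1 obeys the triangle inequality. *)
Lemma smooth_sobolev1 phi : smooth phi -> supported_in setT phi -> sobolev Omega 1 phi.
Proof.
move=> sphi supp; have Lphi : L2 Omega phi.
  by apply: L2_supported supp; exact: smooth_continuous.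
split => // a a1.
have [a0|[i ai]] : (forall i, a i = 0%N) \/ (exists i, forall j, a j = (j == i)).
  have [/forallP h|/forallPn[i ai]] := boolP [forall i, a i == 0%N].
    by left => i; apply/eqP.
  right; exists i => j; move: a1; rewrite (bigD1 i)//=.
  case: eqVneq => [-> |ji] /=.
    by move: ai; case: (a i) => // -[] // n _; rewrite !addSn.
  rewrite (bigD1 j)//= addnCA; case: (a j) => // n; rewrite addSn ltnS leqn0.
  by rewrite addn_eq0 addn_eq0 => /and3P[_ + _]; rewrite (negPf ai).
- exists phi => // psi spsi _; rewrite (eq_bigr (fun=> 0%N)) => [|i _]; last exact: a0.
  rewrite sum_nat_const muln0 expr0 mul1r; congr inner; rewrite /mpartial.
  by elim: (enum _) => //= i s ->; rewrite a0.
- exists (partial i phi).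
    by apply: L2_supported; [apply: smooth_continuous; exact: smooth_partial|
      exact: supported_partial].
  move=> psi spsi suppsi; rewrite (_ : \sum_i a i = 1)%N; last first.
    by rewrite (bigD1 i)//= ai eqxx big1// => j /negPf ji; rewrite ai ji.
  rewrite expr1 mulN1r -integration_by_parts//; last exact: mO.
  congr inner; rewrite /mpartial.
  have H s : uniq s -> foldr (fun i psi => iter (a i) (partial i) psi) psi s =
      if i \in s then partial i psi else psi.
    elim: s => //= j s ih /andP[js us]; rewrite ih// ai inE.
    by case: eqVneq js => [-> /negPf->|ji _] //=.
  by rewrite H ?enum_uniq// mem_enum.
Qed.

Lemma subspace_H1_0 Gamma : subspace (H1_0 Omega Gamma).
Proof.
have s1 := subspace_sobolev 1; have sH := semi_inner_Hform 1; split.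
  split; first exact: s1.1.
  move=> e e0; exists 0; split.
  - exact: smooth_cst.
  - by exists set0 => //; split => //; exact: compact0.
  - by exists setT => //; split => //; exact: openT.
  - by rewrite subr0 Hnorm0.
move=> c f g [sf hf] [sg hg]; split; first exact: s1.2.
move=> e e0; have c0 : 0 < 2 * (`|c| + 1) by rewrite mulr_gt0// ltr_pwDr.
have [phi [sphi suppphi [U [oU GU] U0] nphi]] := hf _ (divr_gt0 e0 c0).
have [psi [spsi supppsi [V [oV GV] V0] npsi]] := hg _ (divr_gt0 e0 (ltr0Sn R 1)).
exists (c *: phi + psi); split.
- exact: smooth_lin.
- move: suppphi supppsi => [C [cC _] C0] [D [cD _] D0].
  exists (C `|` D); first by split => //; exact: compactU.
  move=> x nx; rewrite -[LHS]/(c * phi x + psi x) C0 ?D0 ?mulr0 ?addr0//.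
  + by move=> Dx; apply: nx; right.
  + by move=> Cx; apply: nx; left.
- exists (U `&` V); first by split; [exact: openI|move=> x Gx; split; [exact: GU|exact: GV]].
  by move=> x [Ux Vx]; rewrite -[LHS]/(c * phi x + psi x) U0 ?V0 ?mulr0 ?addr0.
- have s1f : sobolev Omega 1 (f - phi) by apply: (subspaceB s1) => //; exact: smooth_sobolev1.
  have s1g : sobolev Omega 1 (g - psi) by apply: (subspaceB s1) => //; exact: smooth_sobolev1.
  have -> : c *: f + g - (c *: phi + psi) = c *: (f - phi) + (g - psi).
    by rewrite scalerBr opprD addrACA.
  rewrite HnormE in nphi npsi *.
  apply: le_lt_trans (semi_normD sH _ s1g) _; first exact: (subspaceZ s1).
  rewrite (semi_normZ sH)//.
  have h1 : `|c| * semi_norm (Hform 1) (f - phi) <= e / 2.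
    apply: (@le_trans _ _ ((`|c| + 1) * (e / (2 * (`|c| + 1))))).
      by apply: ler_pM => //; rewrite ?semi_norm_ge0// ?lerDl// ltW.
    rewrite le_eqVlt; apply/orP; left; apply/eqP; field.
    by rewrite gt_eqF// ltr_pwDr.
  by rewrite [ltRHS](splitr e); apply: ler_ltD.
Qed.

Lemma H1_0_sobolev Gamma f : H1_0 Omega Gamma f -> sobolev Omega 1 f.
Proof. by case. Qed.

(** ** Gradients and the diffusion form *)

Lemma sum_eq1 (i : 'I_d) : (\sum_j (j == i) = 1)%N.
Proof. by rewrite (bigD1 i)//= eqxx big1// => j /negPf->. Qed.

Lemma seen_linear_grad m i : (1 <= m)%N ->
  seen_linear (sobolev Omega m) (L2 Omega) (inner Omega) (grad Omega i).
Proof. by move=> m1; apply: seen_linear_weakD; rewrite sum_eq1. Qed.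

Lemma L2_grad i f : sobolev Omega 1 f -> L2 Omega (grad Omega i f).
Proof. by move=> sf; have [+ _] := seen_linear_grad i (leqnn 1); apply. Qed.

Lemma L2norm_grad_le m i f : (1 <= m)%N -> L2norm Omega (grad Omega i f) <= Hnorm Omega m f.
Proof. by move=> m1; apply: L2norm_weakD_le; rewrite sum_eq1. Qed.

Section DiffusionForm.
Variables (A : 'rV[R]_d -> 'M[R]_d) (am aM : R).
Hypothesis am0 : 0 < am.
Hypothesis spdA : spd_tensor Omega A am aM.

(** An entry is a coordinate of the image of a unit vector. *)
Lemma tensor_entry_le i j x : Omega x -> `|A x i j| <= aM.
Proof.
move=> Ox; have [_ /(_ (delta_mx j 0))[_]] := spdA.2 x Ox.
have -> : enorm (delta_mx j 0 : 'cV[R]_d) = 1.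
  rewrite /enorm (bigD1 j)//= big_ord1 mxE !eqxx expr1n big1 ?addr0 ?sqrtr1// => i' /negPf h.
  by rewrite big_ord1 mxE h expr0n.
rewrite mulr1; apply: le_trans; rewrite -colE /enorm -sqrtr_sqr ler_sqrt; last first.
  by apply: sumr_ge0 => i' _; apply: sumr_ge0 => j' _; rewrite sqr_ge0.
rewrite (bigD1 i)//= big_ord1 mxE lerDl; apply: sumr_ge0 => i' _.
by apply: sumr_ge0 => j' _; rewrite sqr_ge0.
Qed.

Lemma L2_tensor_mul i j f : L2 Omega f -> L2 Omega ((fun x => A x i j) \* f).
Proof.
move=> Lf; apply: (sq_integrable_mul mO (M := aM)) Lf; first exact: spdA.1.
by move=> x Ox; exact: tensor_entry_le.
Qed.

Lemma diff_formE f g : sobolev Omega 1 f -> sobolev Omega 1 g ->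
  diff_form Omega A f g = \sum_i \sum_j
    inner Omega (grad Omega j f) ((fun x => A x i j) \* grad Omega i g).
Proof.
move=> sf sg; apply: eq_bigr => i _.
have Lg := L2_grad i sg.
have -> : (fun x => \sum_j A x i j * grad Omega j f x) =
    \sum_j ((fun x => A x i j) \* grad Omega j f) :> scal.
  by apply/funext => x; rewrite fct_sumE.
rewrite (form_sum sL2 (sip_lin iL2 Lg)); last first.
  by move=> j; apply: L2_tensor_mul; exact: L2_grad.
apply: eq_bigr => j _; apply: eq_Rintegral => x _ /=.
by rewrite mulrCA mulrA.
Qed.

Lemma integrable_Rsum (I : Type) (r : seq I) (F : I -> scal) :
  (forall i, mu.-integrable Omega (EFin \o F i)) ->
  mu.-integrable Omega (EFin \o (fun x => \sum_(i <- r) F i x)).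
Proof.
move=> IF; rewrite (_ : EFin \o _ = fun x => (\sum_(i <- r) (EFin \o F i) x)%E).
  by apply: integrable_sum => //; exact: mO.
by apply/funext => x /=; rewrite sumEFin.
Qed.

Lemma Rintegral_sum (I : Type) (r : seq I) (F : I -> scal) :
  (forall i, mu.-integrable Omega (EFin \o F i)) ->
  \sum_(i <- r) \int[mu]_(x in Omega) F i x =
  \int[mu]_(x in Omega) (\sum_(i <- r) F i x).
Proof.
move=> IF; have mO' := mO; elim: r => [|i r ih].
  rewrite big_nil /Rintegral (eq_integral (cst 0%E)) ?integral0// => x _.
  by rewrite big_nil.
rewrite big_cons ih -RintegralD//; last exact: integrable_Rsum.
by apply: eq_Rintegral => x _; rewrite big_cons.
Qed.

(** The sum over the entries of the tensor is put under the integral sign, where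
    its pointwise positivity applies. *)
Lemma semi_inner_diff_form : semi_inner (sobolev Omega 1) (diff_form Omega A).
Proof.
have s1 := subspace_sobolev 1; split; first exact: s1.
- move=> c f g h sf sg sh; have sfg := s1.2 c f g sf sg.
  rewrite (diff_formE sfg sh) (diff_formE sf sh) (diff_formE sg sh).
  rewrite mulr_sumr -big_split/=; apply: eq_bigr => i _.
  rewrite mulr_sumr -big_split/=; apply: eq_bigr => j _.
  apply: (seen_linear_grad j (leqnn 1)).2 => //.
  by apply: L2_tensor_mul; exact: L2_grad.
- move=> f g sf sg.
  rewrite (diff_formE sf sg).
  rewrite (diff_formE sg sf).
  rewrite [LHS]exchange_big.
  apply: eq_bigr => j _.
  apply: eq_bigr => i _.
  apply: eq_Rintegral => x.
  rewrite inE => Ox /=; have [/matrixP/(_ i j) + _] := spdA.2 x Ox; rewrite mxE => ->.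
  by ring.
- move=> f sf; rewrite (diff_formE sf sf).
  have If i j : mu.-integrable Omega
      (EFin \o (fun x => grad Omega j f x * ((fun x => A x i j) \* grad Omega i f) x)).
    apply: (sq_integrableM mO); first exact: L2_grad.
    by apply: L2_tensor_mul; exact: L2_grad.
  under eq_bigr do rewrite /inner Rintegral_sum//.
  rewrite Rintegral_sum; last by move=> i; exact: integrable_Rsum.
  apply: Rintegral_ge0 => x Ox; pose w : 'cV[R]_d := \col_j grad Omega j f x.
  have [_ /(_ w)[+ _]] := spdA.2 x Ox.
  move=> h; have : 0 <= (w^T *m A x *m w) 0 0.
    by apply: le_trans h; rewrite mulr_ge0 ?sqr_ge0// ltW.
  rewrite mxE; under eq_bigr do rewrite mxE mulr_suml.
  rewrite exchange_big/=; congr (_ <= _); apply: eq_bigr => i _; apply: eq_bigr => j _.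
  by rewrite !mxE mulrC; congr (_ * _); rewrite mulrC.
Qed.

Lemma diff_form_bounded m g : (1 <= m)%N -> sobolev Omega 1 g ->
  exists K, forall f, sobolev Omega m f -> `|diff_form Omega A f g| <= K * Hnorm Omega m f.
Proof.
move=> m1 sg.
exists (\sum_i \sum_j L2norm Omega ((fun x => A x i j) \* grad Omega i g)) => f sf.
have sf1 := sobolev_le m1 sf.
rewrite (diff_formE sf1 sg) mulr_suml; apply: norm_sum_le => i.
rewrite mulr_suml; apply: norm_sum_le => j.
have Lf := L2_grad j sf1; have Lg := L2_tensor_mul i j (L2_grad i sg).
apply: (le_trans (inner_cauchy_schwarz Lf Lg)); rewrite [leRHS]mulrC.
by apply: ler_wpM2r; [exact: L2norm_ge0|exact: L2norm_grad_le].
Qed.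

End DiffusionForm.

(** ** Vector fields *)

Lemma subspace_vector (X : set scal) : subspace X ->
  subspace [set u : vec | forall i, X (u i)].
Proof. by move=> sX; split => [i|c u v Xu Xv i]; [exact: sX.1|exact: sX.2]. Qed.

Lemma subspace_vsobolev m : subspace (vsobolev Omega m).
Proof. exact: subspace_vector (subspace_sobolev m). Qed.

Lemma subspace_vH1_0 Gamma : subspace (vH1_0 Omega Gamma).
Proof. exact: subspace_vector (subspace_H1_0 Gamma). Qed.

Lemma vH1_0_vsobolev Gamma u : vH1_0 Omega Gamma u -> vsobolev Omega 1 u.
Proof. by move=> uV i; exact: H1_0_sobolev (uV i). Qed.

Lemma vsobolev_le m m' u : (m <= m')%N -> vsobolev Omega m' u -> vsobolev Omega m u.
Proof. by move=> mm' su i; exact: sobolev_le (su i). Qed.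

Lemma semi_inner_vector (X : set scal) (b : scal -> scal -> R) : semi_inner X b ->
  semi_inner [set u : vec | forall i, X (u i)] (fun u v => \sum_i b (u i) (v i)).
Proof.
move=> [sX lb bC b0]; split; first exact: subspace_vector.
- move=> c u v w Xu Xv Xw; rewrite mulr_sumr -big_split/=.
  by apply: eq_bigr => i _; rewrite -lb.
- by move=> u v Xu Xv; apply: eq_bigr => i _; exact: bC.
- by move=> u Xu; apply: sumr_ge0 => i _; exact: b0.
Qed.

Definition vHform m u v : R := \sum_i Hform m (u i) (v i).

Lemma semi_inner_vHform m : semi_inner (vsobolev Omega m) (vHform m).
Proof. exact: semi_inner_vector (semi_inner_Hform m). Qed.

Lemma vHnormE m u : vsobolev Omega m u -> vHnorm Omega m u = semi_norm (vHform m) u.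
Proof.
move=> su; congr Num.sqrt; apply: eq_bigr => i _.
by rewrite HnormE (semi_norm_sqr (semi_inner_Hform m)).
Qed.

Lemma vHnorm_ge0 m u : 0 <= vHnorm Omega m u.
Proof. exact: sqrtr_ge0. Qed.

Lemma Hnorm_le_vHnorm m u i : Hnorm Omega m (u i) <= vHnorm Omega m u.
Proof.
rewrite -[leLHS]ger0_norm ?Hnorm_ge0// -sqrtr_sqr ler_sqrt; last first.
  by apply: sumr_ge0 => j _; rewrite sqr_ge0.
by rewrite (bigD1 i)//= lerDl sumr_ge0// => j _; rewrite sqr_ge0.
Qed.

Lemma seen_linear_div :
  seen_linear (vsobolev Omega 1) (L2 Omega) (inner Omega) (div Omega).
Proof.
have divE u : div Omega u = \sum_i grad Omega i (u i).
  by apply/funext => x; rewrite fct_sumE.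
have Ld u : vsobolev Omega 1 u -> forall i, L2 Omega (grad Omega i (u i)).
  by move=> su i; exact: L2_grad.
split => [u su|c u v z su sv Lz].
  by rewrite divE; apply: (subspace_sum sL2) => i; exact: L2_grad.
have suv := (subspace_vsobolev 1).2 c _ _ su sv.
rewrite !divE !(form_sum sL2 (sip_lin iL2 Lz))//; [|exact: Ld..].
rewrite mulr_sumr -big_split/=; apply: eq_bigr => i _.
exact: (seen_linear_grad i (leqnn 1)).2.
Qed.

Lemma L2_div u : vsobolev Omega 1 u -> L2 Omega (div Omega u).
Proof. by have [+ _] := seen_linear_div; apply. Qed.

Lemma div_bounded m z : (1 <= m)%N -> L2 Omega z -> exists K, forall u,
  vsobolev Omega m u -> `|inner Omega (div Omega u) z| <= K * vHnorm Omega m u.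
Proof.
move=> m1 Lz; exists (\sum_(i < d) L2norm Omega z) => u sum_.
have su := vsobolev_le m1 sum_.
have -> : div Omega u = \sum_i grad Omega i (u i) by apply/funext => x; rewrite fct_sumE.
rewrite (form_sum sL2 (sip_lin iL2 Lz)); last by move=> i; exact: L2_grad.
rewrite mulr_suml; apply: norm_sum_le => i.
apply: (le_trans (inner_cauchy_schwarz (L2_grad i (su i)) Lz)); rewrite [leRHS]mulrC.
apply: ler_wpM2r; first exact: L2norm_ge0.
exact: le_trans (L2norm_grad_le _ _ m1) (Hnorm_le_vHnorm _ _ _).
Qed.

Lemma seen_linear_strain i j : seen_linear (vsobolev Omega 1) (L2 Omega) (inner Omega)
  (fun u => strain Omega u i j).
Proof.
have sE u : strain Omega u i j = 2^-1 *: (grad Omega j (u i) + grad Omega i (u j)).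
  by [].
have Ls u : vsobolev Omega 1 u -> L2 Omega (grad Omega j (u i) + grad Omega i (u j)).
  by move=> su; apply: (subspaceD sL2); exact: L2_grad.
split => [u su|c u v z su sv Lz]; first by rewrite sE; apply: (subspaceZ sL2); exact: Ls.
have inS w : vsobolev Omega 1 w -> inner Omega (strain Omega w i j) z =
    2^-1 * (inner Omega (grad Omega j (w i)) z + inner Omega (grad Omega i (w j)) z).
  move=> sw; rewrite sE (formZ sL2 (sip_lin iL2 Lz)); last exact: Ls.
  by rewrite (formD (sip_lin iL2 Lz)) //; exact: L2_grad.
have suv := (subspace_vsobolev 1).2 c _ _ su sv.
have Ej := (seen_linear_grad j (leqnn 1)).2 c _ _ _ (su i) (sv i) Lz.
have Ei := (seen_linear_grad i (leqnn 1)).2 c _ _ _ (su j) (sv j) Lz.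
rewrite (inS _ suv) (inS _ su) (inS _ sv).
rewrite -[(c *: u + v) i]/(c *: u i + v i) -[(c *: u + v) j]/(c *: u j + v j) Ej Ei.
move: (inner _ _ _) (inner _ _ _) (inner _ _ _) (inner _ _ _) => p q r s.
by ring.
Qed.

Lemma semi_inner_strain_form : semi_inner (vsobolev Omega 1) (strain_form Omega).
Proof.
apply: semi_inner_sum => [|i _]; first exact: subspace_vsobolev.
apply: semi_inner_sum => [|j _]; first exact: subspace_vsobolev.
apply: semi_inner_pullback iL2 (seen_linear_strain i j).
exact: subspace_vsobolev.
Qed.

Lemma L2norm_strain_le m i j u : (1 <= m)%N -> vsobolev Omega m u ->
  L2norm Omega (strain Omega u i j) <= vHnorm Omega m u.
Proof.
move=> m1 sum_; have su := vsobolev_le m1 sum_.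
have Lji := L2_grad j (su i); have Lij := L2_grad i (su j).
have := L2normZ (2^-1) (subspaceD sL2 Lji Lij); rewrite ger0_norm ?invr_ge0// => E.
have bji := le_trans (L2norm_grad_le j (u i) m1) (Hnorm_le_vHnorm m u i).
have bij := le_trans (L2norm_grad_le i (u j) m1) (Hnorm_le_vHnorm m u j).
have D := L2normD Lji Lij.
rewrite -[strain _ _ _ _]/(2^-1 *: (grad Omega j (u i) + grad Omega i (u j))) E.
rewrite mulrC ler_pdivrMr// mulr_natr mulr2n.
by apply: (le_trans D); exact: lerD bji bij.
Qed.

Lemma strain_form_bounded m v : (1 <= m)%N -> vsobolev Omega 1 v -> exists K, forall u,
  vsobolev Omega m u -> `|strain_form Omega u v| <= K * vHnorm Omega m u.
Proof.
move=> m1 sv; exists (\sum_i \sum_j L2norm Omega (strain Omega v i j)) => u sum_.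
have su := vsobolev_le m1 sum_.
rewrite mulr_suml; apply: norm_sum_le => i; rewrite mulr_suml; apply: norm_sum_le => j.
have Lu : L2 Omega (strain Omega u i j) by exact: (seen_linear_strain i j).1.
have Lv : L2 Omega (strain Omega v i j) by exact: (seen_linear_strain i j).1.
apply: (le_trans (inner_cauchy_schwarz Lu Lv)); rewrite [leRHS]mulrC.
by apply: ler_wpM2r; [exact: L2norm_ge0|exact: L2norm_strain_le].
Qed.

End SobolevLinear.

(** * Functions of time *)

(** The square of the norm of a time derivative is not known to be measurable,
    but its integral, a supremum over simple functions, is still superadditive
    and monotone up to null sets. *)
Section LowerIntegral.
Context {dT : measure_display} {T : measurableType dT} {R : realType}.
Variable m : {measure set T -> \bar R}.
Local Open Scope ereal_scope.
Implicit Types (A B D : set T) (f g : T -> \bar R).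
Import HBNNSimple.

Lemma ge0_integral_sup D f : (forall x, 0 <= f x) ->
  \int[m]_(x in D) f x =
  ereal_sup [set sintegral m h | h in
    [set h : {nnsfun T >-> R} | forall x, (h x)%:E <= (f \_ D) x]].
Proof. by move=> f0; rewrite ge0_integralE//. Qed.

Lemma integral_setU_ge A B f : measurable A -> measurable B -> (forall x, 0 <= f x) ->
  A `&` B = set0 ->
  \int[m]_(x in A) f x + \int[m]_(x in B) f x <= \int[m]_(x in A `|` B) f x.
Proof.
move=> mA mB f0 AB0.
have h_le (h1 h2 : {nnsfun T >-> R}) : (forall x, (h1 x)%:E <= (f \_ A) x) ->
    (forall x, (h2 x)%:E <= (f \_ B) x) ->
    sintegral m h1 + sintegral m h2 <= \int[m]_(x in A `|` B) f x.
  move=> hA hB; rewrite (ge0_integral_sup _ f0); apply: ereal_sup_ubound.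
  exists (add_nnsfun h1 h2); last by rewrite /= sintegralD.
  move=> x /=; move: (hA x) (hB x); rewrite EFinD !patchE in_setU.
  have [xA|xA] := boolP (x \in A); have [xB|xB] := boolP (x \in B) => /=.
  - by have : (A `&` B) x; [split; exact/set_mem|rewrite AB0].
  - by move=> h1f h2f; apply: le_trans (leeD h1f h2f) _; rewrite adde0.
  - by move=> h1f h2f; apply: le_trans (leeD h1f h2f) _; rewrite add0e.
  - by move=> h1f h2f; apply: le_trans (leeD h1f h2f) _; rewrite adde0.
set I := integral m (A `|` B) f in h_le *.
have I0 : 0 <= I by exact: integral_ge0.
have [Ioo|] := ltP I +oo; last by rewrite leye_eq => /eqP ->; rewrite leey.
have If : I \is a fin_num by rewrite ge0_fin_numE.
have z0 : forall A' x, (cst_nnsfun T (NngNum (lexx (0 : R))) x)%:E <= (f \_ A') x.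
  by move=> A' x /=; rewrite patchE; case: ifP.
have leA : \int[m]_(x in A) f x <= I.
  rewrite (ge0_integral_sup _ f0); apply: ge_ereal_sup => _ [h1 /= h1A <-].
  have := h_le h1 _ h1A (z0 B); apply: le_trans.
  by rewrite leeDl// sintegral_ge0.
have Af : \int[m]_(x in A) f x \is a fin_num.
  by rewrite ge0_fin_numE; [exact: le_lt_trans leA Ioo|exact: integral_ge0].
rewrite -leeBrDl//; rewrite [X in X <= _](ge0_integral_sup _ f0).
apply: ge_ereal_sup => _ [h2 /= h2B <-].
have s2 : sintegral m h2 <= I.
  by have := h_le _ _ (z0 A) h2B; apply: le_trans; rewrite leeDr// sintegral_ge0.
have s2f : sintegral m h2 \is a fin_num.
  by rewrite ge0_fin_numE; [exact: le_lt_trans s2 Ioo|exact: sintegral_ge0].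
rewrite leeBrDl// -leeBrDr// [X in X <= _](ge0_integral_sup _ f0).
apply: ge_ereal_sup => _ [h1 /= h1A <-].
by rewrite leeBrDr//; exact: h_le.
Qed.

Lemma subset_integral_le A B f : measurable A -> measurable B -> (forall x, 0 <= f x) ->
  A `<=` B -> \int[m]_(x in A) f x <= \int[m]_(x in B) f x.
Proof.
move=> mA mB f0 AB; have mBA : measurable (B `\` A) by exact: measurableD.
have AB0 : A `&` (B `\` A) = set0 by apply/seteqP; split => x // [Ax []].
have := integral_setU_ge mA mBA f0 AB0; rewrite setDUK//.
by apply: le_trans; rewrite leeDl// integral_ge0.
Qed.

Lemma ae_ge0_le_integral_nomeas D f g : measurable D ->
  (forall x, 0 <= f x) -> (forall x, 0 <= g x) ->
  {ae m, forall x, D x -> f x <= g x} ->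
  \int[m]_(x in D) f x <= \int[m]_(x in D) g x.
Proof.
move=> mD f0 g0 [N [mN N0 subN]].
rewrite (ge0_integral_sup _ f0); apply: ge_ereal_sup => _ [h /= hf <-].
have mCN : measurable (~` N) by exact: measurableC.
pose h' := mul_nnsfun h (indic_nnsfun R mCN).
have -> : sintegral m h = sintegral m h'.
  rewrite -!integralT_nnsfun; apply: ae_eq_integral => //; last first.
    exists N; split => // x /= /not_implyP[_]; apply: contra_notP => Nx.
    by rewrite /= mindicE mem_set ?mulr1.
  - exact: measurableT_comp.
  - exact: measurableT_comp.
rewrite (ge0_integral_sup _ g0); apply: ereal_sup_ubound; exists h' => //= x.
have [Nx|nNx] := pselect (N x).
  by rewrite mindicE memNset ?mulr0//= ?patchE; case: ifP.
rewrite mindicE mem_set ?mulr1//; apply: le_trans (hf x) _; rewrite !patchE.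
case: ifPn => // xD; have := contra_not (subN x) nNx => /= /contrapT.
by apply; exact/set_mem.
Qed.

Lemma ae_eq_integral_nomeas D f g : measurable D ->
  {ae m, forall x, D x -> f x = g x} ->
  \int[m]_(x in D) f x = \int[m]_(x in D) g x.
Proof.
move=> mD fg; rewrite integralE [RHS]integralE.
by congr (_ - _); apply/eqP; rewrite eq_le; apply/andP; split;
  apply: ae_ge0_le_integral_nomeas => //; apply: filterS fg => x /= h /h fgx;
  rewrite ?funeposE ?funenegE fgx.
Qed.

End LowerIntegral.

Section TimeFunctional.
Context {R : realType} {E : lmodType R}.
Variables (tau : R) (X : set E) (nrm : E -> R).
Local Notation leb := (@lebesgue_measure R).
Local Notation J := (`]0, tau[%classic).
Hypothesis sX : subspace X.
Implicit Types (w : R -> E) (l : E -> R).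

(** A bounded functional of a strongly measurable function is, up to a null
    set, a measurable real function. *)
Lemma functional_representative w l : strongly_measurable J X nrm w ->
  bounded_functional X nrm l ->
  exists (N : set R) (q : R -> R),
    [/\ measurable N, leb N = 0%E, measurable_fun setT q &
        forall t, t \in `[0, tau] -> ~ N t -> [/\ t \in `]0, tau[, X (w t) & q t = l (w t)]].
Proof.
move=> [n [A [x [mA Xx [N [mN N0 subN]]]]]] [llin [C lC]].
(* The endpoints join the null set: w is only controlled inside the interval. *)
pose N' := N `|` ([set 0] `|` [set tau]).
have mN' : measurable N'.
  by apply: measurableU => //; apply: measurableU; exact: measurable_set1.
have N'0 : leb N' = 0%E.
  have m0 : measurable ([set 0] : set R) by exact: measurable_set1.
  have mt : measurable ([set tau] : set R) by exact: measurable_set1.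
  rewrite null_set_setU//; first exact: measurableU.
  by apply: null_set_setU => //; exact: lebesgue_measure_set1.
pose D := J `\` N'.
have mD : measurable D by apply: measurableD => //; exact: measurable_itv.
pose q := (l \o w) \_ D.
exists N', q; split => //; last first.
  move=> t t0tau nN.
  have tJ : t \in `]0, tau[.
    move: t0tau; rewrite !in_itv/= => /andP[t0 tt].
    rewrite !lt_neqAle t0 tt !andbT; apply/andP; split.
      by apply/eqP => t0'; apply: nN; right; left.
    by apply/eqP => t0'; apply: nN; right; right.
  have nNt : ~ N t by move=> Nt; apply: nN; left.
  have := contra_not (subN t) nNt => /= /contrapT /(_ tJ)[Xw _]; split => //.
  by rewrite /q patchE mem_set.
pose S k t := \sum_(i < n k) (\1_(A k i) t : R) *: x k i.
have XS k t : X (S k t) by rewrite /S; apply: (subspace_sum sX) => i; apply: (subspaceZ sX).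
apply/(measurable_restrictT (l \o w) mD).
apply: (@measurable_fun_cvg _ _ R D (fun k t => l (S k t)) (l \o w)).
  move=> k; rewrite (_ : (fun t => l (S k t)) =
      (fun t => \sum_(i < n k) \1_(A k i) t * l (x k i))).
    apply: measurable_sum => i; apply: measurable_funM; last exact: measurable_cst.
    by apply: measurable_indic; exact: mA.
  apply/funext => t; rewrite (form_sum sX llin); last by move=> i; apply: (subspaceZ sX).
  by apply: eq_bigr => i _; rewrite (formZ sX llin).
move=> t [Jt nN]; have nNt : ~ N t by move=> Nt; apply: nN; left.
have := contra_not (subN t) nNt => /= /contrapT /(_ Jt)[Xw cv].
apply/cvgrPdist_le => e e0; have C0 : 0 < `|C| + 1 by rewrite ltr_pwDr.
move/cvgrPdist_le : cv => /(_ _ (divr_gt0 e0 C0)); apply: filterS => k.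
rewrite sub0r normrN => hk; rewrite -(formB llin)//.
have XwS : X (w t - S k t) by exact: subspaceB.
apply: le_trans (lC _ XwS) _; apply: le_trans (ler_norm _) _.
rewrite normrM -(divfK (lt0r_neq0 C0) e) mulrC; apply: ler_pM => //.
by rewrite lerDl.
Qed.

(** The fundamental theorem of calculus for a functional of w, with a measurable
    representative of the integrand. *)
Lemma bounded_functionalP w w' l : time_derivative tau X nrm w w' ->
  bounded_functional X nrm l ->
  forall (N : set R) (q : R -> R), measurable N -> leb N = 0%E ->
  (forall t : R, t \in `[0, tau] -> ~ N t -> q t = l (w' t)) ->
  forall s t : R, 0 <= s -> s <= t -> t <= tau ->
  l (w t) - l (w s) = \int[leb]_(r in `[s, t]) q r.
Proof.
move=> [_ dw] bl N q mN N0 qN s t s0 st ttau; rewrite (dw _ bl)//.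
rewrite /Rintegral; congr fine; apply: ae_eq_integral_nomeas.
  exact: measurable_itv.
exists N; split => // r /= /not_implyP[]; rewrite in_itv/= => /andP[sr rt].
apply: contra_notP => nN; rewrite qN// in_itv/=.
by rewrite (le_trans s0 sr) (le_trans rt ttau).
Qed.

(** The squared L^2 norm of a time derivative up to time t: the bounds of
    increments over disjoint time intervals add up to it. *)
Definition energy (w' : R -> E) (t : R) : R := \int[leb]_(s in `]0, t[) (nrm (w' s)) ^+ 2.

Lemma energy0 w' : energy w' 0 = 0.
Proof. by rewrite /energy set_itv_ge ?Rintegral_set0// bnd_simp ltxx. Qed.

Section Increment.
Variable (w' : R -> E).
Hypothesis Lw' : bochner_L2 J X nrm w'.
Local Notation F := (fun s => ((nrm (w' s)) ^+ 2)%:E).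

Let F0 s : (0 <= F s)%E. Proof. by rewrite lee_fin sqr_ge0. Qed.

Lemma energy_split (s t : R) : 0 <= s -> s <= t -> t <= tau ->
  [/\ (\int[leb]_(r in `]s, t[%classic) F r < +oo)%E,
      (energy w' s)%:E = (\int[leb]_(r in `]0%R, s[%classic) F r)%E &
      (\int[leb]_(r in `]s, t[%classic) F r <= (energy w' t - energy w' s)%R%:E)%E].
Proof.
move=> s0 st ttau.
have lefin (u v : R) : 0 <= u -> v <= tau -> (\int[leb]_(r in `]u, v[%classic) F r < +oo)%E.
  move=> u0 vtau; apply: le_lt_trans Lw'.2; apply: subset_integral_le => //.
  move=> x /=; rewrite !in_itv/= => /andP[ux xv].
  by rewrite (le_lt_trans u0 ux) (lt_le_trans xv vtau).
have eE (v : R) : v <= tau -> (energy w' v)%:E = (\int[leb]_(r in `]0%R, v[%classic) F r)%E.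
  move=> vtau; rewrite /energy /Rintegral fineK// ge0_fin_numE; last exact: integral_ge0.
  exact: lefin.
split; [exact: lefin|by rewrite eE// (le_trans st)|].
have stau := le_trans st ttau; have t0 := le_trans s0 st.
rewrite EFinB leeBrDl// (eE s stau) (eE t ttau).
have dis : `]0, s[%classic `&` `]s, t[%classic = set0.
  apply/seteqP; split => x //=; rewrite !in_itv/= => -[/andP[_ xs] /andP[sx _]].
  by have := lt_trans xs sx; rewrite ltxx.
have m1 : measurable (`]0%R, s[%classic : set R) by exact: measurable_itv.
have m2 : measurable (`]s, t[%classic : set R) by exact: measurable_itv.
apply: (le_trans (@integral_setU_ge _ _ _ leb _ _ F m1 m2 F0 dis)).
apply: subset_integral_le => //; first exact: measurableU.
move=> x /=; rewrite !in_itv/= => -[/andP[x0 xs]|/andP[sx xt]].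
  by rewrite x0 (lt_le_trans xs st).
by rewrite (le_lt_trans s0 sx).
Qed.

Lemma energy_nd (s t : R) : 0 <= s -> s <= t -> t <= tau -> energy w' s <= energy w' t.
Proof.
move=> s0 st ttau; have [_ _ h] := energy_split s0 st ttau.
rewrite -subr_ge0 -lee_fin; apply: le_trans h; exact: integral_ge0.
Qed.

(** Cauchy-Schwarz in time for a functional of norm at most 1. *)
Lemma increment_unit w l : time_derivative tau X nrm w w' ->
  (forall (a : R) x y, X x -> X y -> l (a *: x + y) = a * l x + l y) ->
  (forall x, X x -> `|l x| <= nrm x) ->
  forall s t : R, 0 <= s -> s <= t -> t <= tau ->
  (l (w t) - l (w s)) ^+ 2 <= (t - s) * (energy w' t - energy w' s).
Proof.
move=> dw llin l1 s t s0 st ttau.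
have bl : bounded_functional X nrm l.
  by split => //; exists 1 => x Xx; rewrite mul1r; exact: l1.
have [N [q [mN N0 mq qN]]] := functional_representative Lw'.1 bl.
have qE r : r \in `[0, tau] -> ~ N r -> q r = l (w' r) by move=> r0 /(qN _ r0)[].
rewrite (bounded_functionalP dw bl mN N0 qE s0 st ttau).
have mst : measurable (`[s, t]%classic : set (measurableTypeR R)) by exact: measurable_itv.
have [oo _ le] := energy_split s0 st ttau.
have mq2 : measurable_fun setT (fun r => ((q r) ^+ 2)%:E).
  by apply/measurable_EFinP; exact: measurable_funX.
have qle : (\int[leb]_(r in `[s, t]) ((q r) ^+ 2)%:E <= \int[leb]_(r in `]s, t[%classic) F r)%E.
  rewrite (@integral_itv_bndoo _ s t (fun r => ((q r) ^+ 2)%:E) true false); last first.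
    exact: measurable_funTS.
  apply: ae_ge0_le_integral_nomeas => // [r|]; first by rewrite lee_fin sqr_ge0.
  exists N; split => // r /= /not_implyP[]; rewrite in_itv/= => /andP[sr rt].
  apply: contra_notP => nN; have [|_ Xr ->] := qN r _ nN.
    by rewrite in_itv/= (le_trans s0 (ltW sr)) (le_trans (ltW rt) ttau).
  rewrite lee_fin -[l (w' r) ^+ 2]real_normK ?num_real// ler_pXn2r ?nnegrE//.
    exact: l1.
  exact: le_trans (l1 _ Xr).
have Lq : sq_integrable leb `[s, t] q.
  by split; [exact: measurable_funTS|exact: le_lt_trans qle oo].
have stE : leb `[s, t]%classic = (t - s)%:E.
  rewrite lebesgue_measure_itv/= lte_fin; case: ltP => // ts.
  by rewrite (_ : t = s) ?subrr//; apply/eqP; rewrite eq_le ts st.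
have L1 : sq_integrable leb `[s, t] (cst 1 : R -> R).
  apply: (@bounded_sq_integrable _ _ _ leb _ mst _ 1).
  - by rewrite [X in (X < _)%E]stE ltry.
  - exact: measurable_cst.
  - by move=> x _; rewrite normr1.
have := cauchy_schwarz_sqr (@semi_inner_l2 _ _ R (@lebesgue_measure R) _ mst) Lq L1.
have -> : l2_form leb `[s, t] q (cst 1) = \int[leb]_(r in `[s, t]) q r.
  by apply: eq_Rintegral => r _; rewrite mulr1.
have -> : l2_form leb `[s, t] (cst 1) (cst 1) = t - s.
  rewrite /l2_form; under eq_Rintegral do rewrite /= mulr1.
  by rewrite Rintegral_cst// mul1r [X in fine X]stE.
move=> h; apply: le_trans h _; rewrite mulrC ler_wpM2l ?subr_ge0//.
rewrite -lee_fin; apply: le_trans le; apply: le_trans qle.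
rewrite /l2_form /Rintegral fineK; last exact: (integrable_fin_num mst (sq_integrableM mst Lq Lq)).
by under eq_integral do rewrite -expr2.
Qed.

(** By homogeneity, from a functional of norm at most 1. *)
Lemma increment_le w l (K : R) : time_derivative tau X nrm w w' -> 0 <= K ->
  (forall (a : R) x y, X x -> X y -> l (a *: x + y) = a * l x + l y) ->
  (forall x, X x -> `|l x| <= K * nrm x) ->
  forall s t : R, 0 <= s -> s <= t -> t <= tau ->
  (l (w t) - l (w s)) ^+ 2 <= K ^+ 2 * ((t - s) * (energy w' t - energy w' s)).
Proof.
move=> dw K0 llin lK s t s0 st ttau.
have Xt : X (w t) by apply: dw.1; rewrite (le_trans s0 st).
have Xs : X (w s) by apply: dw.1; rewrite s0 (le_trans st ttau).
have [K0e|Kn0] := eqVneq K 0.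
  have l0 x : X x -> l x = 0 by move/lK; rewrite K0e mul0r normr_le0 => /eqP.
  by rewrite !l0// subrr K0e expr0n/= !mul0r.
have Kp : 0 < K by rewrite lt_def Kn0.
have lin' (a : R) x y : X x -> X y -> K^-1 * l (a *: x + y) = a * (K^-1 * l x) + K^-1 * l y.
  by move=> Xx Xy; rewrite llin// mulrDr mulrCA.
have bnd' x : X x -> `|K^-1 * l x| <= nrm x.
  by move=> Xx; rewrite normrM ger0_norm ?invr_ge0// ler_pdivrMl// lK.
have := increment_unit dw lin' bnd' s0 st ttau.
by rewrite -mulrBr exprMn exprVn ler_pdivrMl ?exprn_gt0.
Qed.

End Increment.

End TimeFunctional.

Section SecondIncrement.
Context {R : realType} {E : lmodType R}.
Variables (tau : R) (X Y : set E) (nX nY : E -> R) (w w1 w2 : R -> E).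
Local Notation leb := (@lebesgue_measure R).
Local Notation J := (`]0, tau[%classic).
Hypotheses (sX : subspace X) (sY : subspace Y).
Hypotheses (dw : time_derivative tau X nX w w1) (Lw1 : bochner_L2 J X nX w1).
Hypotheses (dw1 : time_derivative tau Y nY w1 w2) (Lw2 : bochner_L2 J Y nY w2).

(** Consistency error of a difference quotient: the increment is the integral
    of l(w1), which stays within the bound of [increment_le] of its value at
    the later time t'. *)
Lemma second_increment_le l (K : R) : bounded_functional X nX l -> 0 <= K ->
  (forall (a : R) x y, Y x -> Y y -> l (a *: x + y) = a * l x + l y) ->
  (forall x, Y x -> `|l x| <= K * nY x) ->
  forall s t t' : R, 0 <= s -> s <= t -> t <= t' -> t' <= tau ->
  (l (w t) - l (w s) - (t - s) * l (w1 t')) ^+ 2 <=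
  K ^+ 2 * (t - s) ^+ 2 * ((t' - s) * (energy nY w2 t' - energy nY w2 s)).
Proof.
move=> bl K0 lin lK s t t' s0 st tt' t'tau; have st' := le_trans st tt'.
have ttau := le_trans tt' t'tau.
have [N [q [mN N0 mq qN]]] := functional_representative sX Lw1.1 bl.
pose c := l (w1 t'); pose B2 := K ^+ 2 * ((t' - s) * (energy nY w2 t' - energy nY w2 s)).
have B20 : 0 <= B2.
  by rewrite mulr_ge0 ?sqr_ge0// mulr_ge0 ?subr_ge0// (energy_nd Lw2).
pose B := Num.sqrt B2.
pose q2 := fun r => (q r - c) * \1_(~` N) r.
have mCN : measurable (~` N) by exact: measurableC.
have mq2 : measurable_fun setT q2.
  apply: measurable_funM; last exact: measurable_indic.
  by apply: measurable_funB => //; exact: measurable_cst.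
have mst : measurable (`[s, t]%classic : set (measurableTypeR R)) by exact: measurable_itv.
have q2B r : `[s, t]%classic r -> `|q2 r| <= B.
  rewrite /= in_itv/= => /andP[sr rt]; rewrite /q2 indicE.
  have r0 := le_trans s0 sr; have rt' := le_trans rt tt'; have rtau := le_trans rt' t'tau.
  have [Nr|nNr] := pselect (N r).
    by rewrite memNset ?mulr0 ?normr0 ?sqrtr_ge0//= => /(_ Nr).
  rewrite mem_set// mulr1; have [|_ _ ->] := qN r _ nNr.
    by rewrite in_itv/= r0 rtau.
  rewrite -sqrtr_sqr ler_sqrt// /c -sqrrN opprB.
  apply: le_trans (increment_le sY Lw2 dw1 K0 lin lK r0 rt' t'tau) _.
  rewrite ler_wpM2l ?sqr_ge0// ler_pM ?subr_ge0 ?(energy_nd Lw2)//.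
    by rewrite lerD2l lerN2.
  by rewrite lerD2l lerN2 (energy_nd Lw2).
have stE : leb `[s, t]%classic = (t - s)%:E.
  rewrite lebesgue_measure_itv/= lte_fin; case: ltP => // ts.
  by rewrite (_ : t = s) ?subrr//; apply/eqP; rewrite eq_le ts st.
have bdd (h : R -> R) (b : R) : measurable_fun setT h ->
    (forall r, `[s, t]%classic r -> `|h r| <= b) -> leb.-integrable `[s, t] (EFin \o h).
  move=> mh hb; apply: measurable_bounded_integrable => //.
  - by rewrite [X in (X < _)%E]stE ltry.
  - exact: measurable_funTS.
  - by exists b; split; [exact: num_real|move=> y b_y r sr; exact: le_trans (hb r sr) (ltW b_y)].
have Iq2 : leb.-integrable `[s, t] (EFin \o q2) by exact: bdd q2B.
have Ic (b : R) : leb.-integrable `[s, t] (EFin \o cst b).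
  by apply: (bdd _ `|b|) => //; exact: measurable_cst.
have qE r : r \in `[0, tau] -> ~ N r -> q2 r + c = l (w1 r).
  by move=> r0 nN; rewrite /q2 indicE mem_set// mulr1 subrK; case: (qN r r0 nN).
rewrite (bounded_functionalP dw bl mN N0 qE s0 st ttau) RintegralD//; last exact: Ic.
rewrite Rintegral_cst// [X in fine X]stE /= -/c [c * _]mulrC addrK.
have : `|\int[leb]_(r in `[s, t]) q2 r| <= B * (t - s).
  apply: le_trans (le_normr_Rintegral mst Iq2) _.
  have <- : \int[leb]_(r in `[s, t]) (cst B r) = B * (t - s).
    by rewrite Rintegral_cst// [X in fine X]stE.
  by apply: le_Rintegral => //; exact: integrable_norm.
move=> h; rewrite -[leLHS]real_normK ?num_real//.
apply: (@le_trans _ _ ((B * (t - s)) ^+ 2)).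
  by rewrite ler_pXn2r ?nnegrE// mulr_ge0 ?sqrtr_ge0// subr_ge0.
by rewrite exprMn sqr_sqrtr// /B2 mulrAC.
Qed.

End SecondIncrement.

(** ** Continuity in time *)

Section ContinuousUpto.
Context {R : realType}.
Variable tau : R.
Hypothesis tau0 : 0 < tau.
Implicit Types h : R -> R.
Local Notation leb := (@lebesgue_measure R).

Definition continuous_upto h := forall t, 0 <= t <= tau -> forall e, 0 < e ->
  exists2 r, 0 < r & forall s, 0 <= s <= tau -> `|s - t| < r -> `|h s - h t| < e.

Lemma continuous_uptoD h1 h2 : continuous_upto h1 -> continuous_upto h2 ->
  continuous_upto (fun t => h1 t + h2 t).
Proof.
move=> c1 c2 t tt e e0; have e20 : 0 < e / 2 by rewrite divr_gt0.
have [r1 r10 H1] := c1 t tt _ e20; have [r2 r20 H2] := c2 t tt _ e20.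
exists (Num.min r1 r2); first by rewrite lt_min r10.
move=> s ss; rewrite lt_min => /andP[s1 s2].
rewrite opprD addrACA (le_lt_trans (ler_normD _ _))// [ltRHS](splitr e).
by apply: ltrD; [exact: H1|exact: H2].
Qed.

Lemma continuous_uptoZ (a : R) h : continuous_upto h -> continuous_upto (fun t => a * h t).
Proof.
move=> c1 t tt e e0; have a0 : 0 < `|a| + 1 by rewrite ltr_pwDr.
have [r r0 H] := c1 t tt _ (divr_gt0 e0 a0); exists r => // s ss sr.
rewrite -mulrBr normrM.
have := H s ss sr; rewrite ltr_pdivlMr// => h1; apply: le_lt_trans h1.
by rewrite mulrC ler_wpM2l// lerDl.
Qed.

Lemma continuous_uptoB h1 h2 : continuous_upto h1 -> continuous_upto h2 ->
  continuous_upto (fun t => h1 t - h2 t).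
Proof.
move=> c1 c2; have := continuous_uptoD c1 (continuous_uptoZ (-1) c2).
by under eq_fun do rewrite mulN1r.
Qed.

(** Absolutely continuous functions with a square-integrable derivative are
    Hoelder continuous of exponent 1/2. *)
Lemma continuous_upto_hoelder h (C : R) : 0 <= C ->
  (forall s t, 0 <= s -> s <= t -> t <= tau -> (h t - h s) ^+ 2 <= C * (t - s)) ->
  continuous_upto h.
Proof.
move=> C0 hC t /andP[t0 ttau] e e0; have C1 : 0 < C + 1 by rewrite ltr_pwDr.
exists (e ^+ 2 / (C + 1)); first by rewrite divr_gt0 ?exprn_gt0.
move=> s /andP[s0 stau]; rewrite ltr_pdivlMr// => st.
rewrite -(@ltr_pXn2r _ 2) ?nnegrE// ?ltW// real_normK ?num_real//.
apply: le_lt_trans st; apply: (@le_trans _ _ (C * `|s - t|)).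
  have [ts|/ltW ts] := leP t s; first by rewrite ger0_norm ?subr_ge0//; exact: hC.
  by rewrite distrC ger0_norm ?subr_ge0// -sqrrN opprB; exact: hC.
by rewrite mulrC ler_wpM2l// lerDl.
Qed.

Lemma continuous_upto_time (E : lmodType R) (X : set E) (nrm : E -> R) (w : R -> E) h (K : R) :
  time_continuous tau X nrm w ->
  (forall s t, 0 <= s <= tau -> 0 <= t <= tau -> `|h s - h t| <= K * nrm (w s - w t)) ->
  continuous_upto h.
Proof.
move=> cw hK t tt e e0; have [_ cv] := cw t tt.
have K0 : 0 < `|K| + 1 by rewrite ltr_pwDr.
move/cvgrPdist_lt : cv => /(_ _ (divr_gt0 e0 K0)); rewrite near_withinE.
move=> /nbhs_ballP[r /= r0 hr]; exists r => // s ss sr.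
have := hr s; rewrite /ball/= distrC => /(_ sr); rewrite in_itv/= => /(_ ss).
rewrite sub0r normrN ltr_pdivlMr// => h1; apply: le_lt_trans h1.
apply: le_trans (hK _ _ ss tt) _; apply: le_trans (ler_norm _) _.
by rewrite normrM mulrC ler_wpM2l// lerDl.
Qed.

(** A continuous function vanishing almost everywhere vanishes: an interval
    is not a null set. *)
Lemma continuous_upto_ae0 h : continuous_upto h ->
  {ae leb, forall t, 0 < t <= tau -> h t = 0} -> forall t, 0 <= t <= tau -> h t = 0.
Proof.
move=> ch [N [mN N0 subN]] t /[dup] tt /andP[t0 ttau].
apply/eqP/negPn/negP => ht0; have e0 : 0 < `|h t| by rewrite normr_gt0.
have [r r0 H] := ch t tt _ e0.
pose a := Num.max 0 (t - r); pose b := Num.min tau (t + r).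
have ab : a < b.
  have h1 : 0 < t + r by lra.
  have h2 : t - r < tau by lra.
  have h3 : t - r < t + r by lra.
  by rewrite gt_max !lt_min tau0 h1 h2 h3.
have sub : `]a, b[%classic `<=` N.
  move=> s; rewrite /= in_itv/= gt_max lt_min => /andP[/andP[s0 ts] /andP[stau st]].
  apply: subN => /= /(_ _)/=; rewrite s0 ltW// => /(_ isT) hs.
  have str : `|s - t| < r by rewrite ltr_norml; apply/andP; split; lra.
  have ss : 0 <= s <= tau by rewrite (ltW s0) (ltW stau).
  by have := H s ss str; rewrite hs sub0r normrN ltxx.
have : (leb `]a, b[%classic <= leb N)%E.
  by apply: le_measure => //; rewrite inE//; exact: measurable_itv.
by rewrite N0 lebesgue_measure_itv/= lte_fin ab -EFinB lee_fin subr_le0 leNgt ab.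
Qed.

End ContinuousUpto.

(** * The discrete energy estimate *)

Section Recursion.
Context {R : realType}.

Lemma sqr_sum_le (n : nat) (a : 'I_n -> R) :
  (\sum_i a i) ^+ 2 <= n%:R * \sum_i a i ^+ 2.
Proof.
rewrite expr2 big_distrlr/=.
pose S := \sum_i a i ^+ 2.
have row i : \sum_j (a i ^+ 2 + a j ^+ 2) / 2 = (n%:R * a i ^+ 2 + S) / 2.
  by rewrite -mulr_suml big_split/= sumr_const card_ord mulr_natl.
have -> : n%:R * S = \sum_i \sum_j (a i ^+ 2 + a j ^+ 2) / 2.
  under [RHS]eq_bigr do rewrite row.
  rewrite -mulr_suml big_split/= -mulr_sumr sumr_const card_ord -mulr_natl -/S.
  by field.
apply: ler_sum => i _; apply: ler_sum => j _.
rewrite ler_pdivlMr// -subr_ge0 (_ : _ - _ = (a i - a j) ^+ 2) ?sqr_ge0//.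
by ring.
Qed.

(** The increments x_n of the fluid unknowns dominate: y_(n-1) is the increment
    of the total pressure entering with a time lag, and its bound by w and z
    lets the quantity w_n^2 / (2 la) carry it over to the next step. *)
Lemma energy_recursion (m0 la s0 dt : R) (x w y z r g : nat -> R) (N : nat) :
  0 < m0 -> 0 < la -> 0 < s0 -> 0 < dt ->
  (forall n, (n <= N)%N -> 0 <= x n) -> (forall n, 0 <= w n) -> (forall n, 0 <= y n) ->
  (forall n, 0 <= z n) -> (forall n, (n <= N)%N -> 0 <= r n) ->
  g 0%N = 0 -> (forall n, (n <= N)%N -> 0 <= g n.+1) ->
  (forall n, (n <= N)%N -> y n <= w n + la * z n) ->
  (forall n, (n <= N)%N -> w n ^+ 2 <= s0 * x n) ->
  (forall n, (n <= N)%N -> m0 * x n + la^-1 * w n ^+ 2 + dt / 2 * (g n.+1 - g n) <=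
     la^-1 * (y n.-1 * w n) + m0 / 4 * x n + m0^-1 * r n) ->
  forall n, (n <= N)%N ->
  m0 / 2 * \sum_(k < n.+1) x k + dt / 2 * g n.+1 <=
  (3 + s0 / (la * m0)) * (2 * (s0 / m0 + la / 2) + m0^-1) *
    \sum_(k < n.+1) (z k ^+ 2 + r k).
Proof.
move=> m00 la0 s00 dt0 x0 w0 y0 z0 r0 g0 gp yw ws step.
pose K1 := s0 / m0 + la / 2; pose K2 := 3 + s0 / (la * m0).
have im0 : 0 < m0^-1 by rewrite invr_gt0.
have il0 : 0 < la^-1 by rewrite invr_gt0.
have K10 : 0 < K1 by rewrite addr_gt0// divr_gt0.
have K21 : 1 <= K2.
  have : 0 < s0 / (la * m0) by rewrite divr_gt0// mulr_gt0.
  by rewrite /K2; lra.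
pose a n := K1 * z n.-1 ^+ 2 + m0^-1 * r n.
have a0 n : (n <= N)%N -> 0 <= a n.
  by move=> nN; rewrite addr_ge0// mulr_ge0 ?sqr_ge0 ?r0// ltW.
have lag n : (n <= N)%N -> la^-1 * (y n.-1 * w n) <=
    la^-1 * w n ^+ 2 / 2 + la^-1 * w n.-1 ^+ 2 / 2 + m0 / 4 * x n.-1 + K1 * z n.-1 ^+ 2.
  move=> nN; have n1N : (n.-1 <= N)%N by rewrite (leq_trans (leq_pred n)).
  have h1 : y n.-1 * w n <= w n ^+ 2 / 2 + (w n.-1 + la * z n.-1) ^+ 2 / 2.
    have h : y n.-1 ^+ 2 <= (w n.-1 + la * z n.-1) ^+ 2.
      by rewrite ler_pXn2r ?nnegrE ?yw// addr_ge0// mulr_ge0// ltW.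
    have := sqr_ge0 (y n.-1 - w n); nra.
  apply: le_trans (ler_wpM2l (ltW il0) h1) _.
  have -> : la^-1 * (w n ^+ 2 / 2 + (w n.-1 + la * z n.-1) ^+ 2 / 2) =
      la^-1 * w n ^+ 2 / 2 + la^-1 * w n.-1 ^+ 2 / 2 + w n.-1 * z n.-1 +
      la / 2 * z n.-1 ^+ 2.
    by field; rewrite gt_eqF.
  have h2 : w n.-1 * z n.-1 <= m0 / 4 * x n.-1 + s0 / m0 * z n.-1 ^+ 2.
    have h3 : m0 / (4 * s0) * w n.-1 ^+ 2 <= m0 / 4 * x n.-1.
      have -> : m0 / 4 * x n.-1 = m0 / (4 * s0) * (s0 * x n.-1).
        by field; rewrite gt_eqF.
      by rewrite ler_wpM2l ?ws// ltW// divr_gt0// mulr_gt0.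
    apply: le_trans (lerD h3 (lexx _)).
    have p0 : 0 < m0 / s0 by rewrite divr_gt0.
    rewrite -subr_ge0 (_ : _ - _ = m0 / (4 * s0) * (w n.-1 - 2 * (s0 / m0) * z n.-1) ^+ 2).
      by rewrite mulr_ge0 ?sqr_ge0// ltW// divr_gt0// mulr_gt0.
    by field; rewrite !gt_eqF.
  rewrite /K1; lra.
(* En is what one step passes on to the next. *)
pose En n := m0 / 4 * x n + la^-1 * w n ^+ 2 / 2 + dt / 2 * g n.+1.
have base : m0 / 2 * x 0%N + dt / 2 * g 1%N <= a 0%N.
  have := step 0%N (leq0n N); have := lag 0%N (leq0n N); rewrite /a /= g0; lra.
have rec n : (n.+1 <= N)%N -> m0 / 2 * x n.+1 + En n.+1 <= En n + a n.+1.
  move=> nN; have := step n.+1 nN; have := lag n.+1 nN; rewrite /a /En /=; lra.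
have main n : (n <= N)%N ->
    En n + m0 / 2 * \sum_(k < n.+1) x k <= K2 * \sum_(k < n.+1) a k.
  elim: n => [_|n ih nN].
    rewrite !big_ord_recr !big_ord0/= !add0r /En.
    have g10 : 0 <= dt / 2 * g 1%N by rewrite mulr_ge0 ?gp// ltW// divr_gt0.
    have h : la^-1 * w 0%N ^+ 2 / 2 <= s0 / (la * m0) * a 0%N.
      have h4 : m0 / 2 * x 0%N <= a 0%N by move: base; lra.
      have -> : la^-1 * w 0%N ^+ 2 / 2 = (2 * la)^-1 * w 0%N ^+ 2 by field; rewrite gt_eqF.
      apply: (@le_trans _ _ ((2 * la)^-1 * (s0 * x 0%N))).
        by rewrite ler_wpM2l ?ws// invr_ge0 mulr_ge0// ltW.
      have -> : (2 * la)^-1 * (s0 * x 0%N) = s0 / (la * m0) * (m0 / 2 * x 0%N).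
        by field; rewrite !gt_eqF.
      by rewrite ler_wpM2l// ltW// divr_gt0// mulr_gt0.
    have := x0 0%N (leq0n N); have := a0 0%N (leq0n N); rewrite /K2 mulrDl; move: base h g10; nra.
  have := ih (ltnW nN); have := rec n nN.
  rewrite [in X in _ -> _ -> X]big_ord_recr [in X in _ -> _ -> _ <= X]big_ord_recr /=.
  have : a n.+1 <= K2 * a n.+1 by rewrite ler_peMl ?a0.
  rewrite !mulrDr; lra.
have suma n : (n <= N)%N -> \sum_(k < n.+1) a k <=
    (2 * K1 + m0^-1) * \sum_(k < n.+1) (z k ^+ 2 + r k).
  move=> nN; have h : \sum_(k < n.+1) z k.-1 ^+ 2 <= 2 * \sum_(k < n.+1) z k ^+ 2.
    rewrite big_ord_recl /= mulr_natl mulr2n; apply: lerD.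
      by rewrite big_ord_recl lerDl sumr_ge0// => k _; rewrite sqr_ge0.
    by rewrite [leRHS]big_ord_recr /= lerDl sqr_ge0.
  rewrite /a big_split/= -!mulr_sumr big_split/=.
  have S1 : 0 <= \sum_(k < n.+1) z k ^+ 2 by apply: sumr_ge0 => k _; rewrite sqr_ge0.
  have S2 : 0 <= \sum_(k < n.+1) r k.
    by apply: sumr_ge0 => k _; apply: r0; rewrite (leq_trans _ nN)// -ltnS.
  have h5 := ler_wpM2l (ltW K10) h.
  have h6 : 0 <= m0^-1 * \sum_(k < n.+1) z k ^+ 2 by rewrite mulr_ge0// ltW.
  have h7 : 0 <= K1 * \sum_(k < n.+1) r k by rewrite mulr_ge0// ltW.
  by move: h5 h6 h7; rewrite !mulrDl !mulrDr; lra.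
move=> n nN; rewrite -/K1 -/K2 -[leRHS]mulrA.
apply: (@le_trans _ _ (K2 * \sum_(k < n.+1) a k)); last first.
  by rewrite ler_wpM2l ?suma//; lra.
apply: le_trans (main n nN); rewrite /En addrC lerD2r.
have : 0 <= m0 / 4 * x n by rewrite mulr_ge0 ?x0// ltW// divr_gt0.
have : 0 <= la^-1 * w n ^+ 2 / 2 by rewrite divr_ge0// mulr_ge0 ?sqr_ge0// ltW.
lra.
Qed.

End Recursion.

Section Telescope.
Context {R : realType} {E : lmodType R}.
Variables (X : set E) (b : E -> E -> R).
Hypothesis sb : semi_inner X b.
Local Notation N := (semi_norm b).
Let sX : subspace X. Proof. by case: sb. Qed.

(** Adding a vector of norm 0 does not change the norm. *)
Lemma semi_norm_triangle_null x y : X x -> X y -> b y y = 0 -> b x x = b (x - y) (x - y).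
Proof.
move=> Xx Xy y0; have Ny : N y = 0 by rewrite /semi_norm y0 sqrtr0.
have Xxy := subspaceB sX Xx Xy.
rewrite -!(semi_norm_sqr sb)//; congr (_ ^+ 2); apply/eqP; rewrite eq_le.
have h1 := semi_normD sb Xxy Xy; have h2 := semi_normB sb Xx Xy.
by move: h1 h2; rewrite subrK Ny !addr0 => -> ->.
Qed.

(** Cauchy-Schwarz for the sum of the increments. *)
Lemma telescope_sqr (f : nat -> E) n : (forall k, (k <= n)%N -> X (f k)) ->
  b (f n - f 0%N) (f n - f 0%N) <=
  n%:R * \sum_(k < n) b (f k.+1 - f k) (f k.+1 - f k).
Proof.
move=> Xf.
have XD k : (k < n)%N -> X (f k.+1 - f k).
  by move=> kn; apply: (subspaceB sX); apply: Xf => //; exact: ltnW.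
have XD0 k : (k <= n)%N -> X (f k - f 0%N) by move=> kn; apply: (subspaceB sX); exact: Xf.
have h m : (m <= n)%N -> N (f m - f 0%N) <= \sum_(k < m) N (f k.+1 - f k).
  elim: m => [_|m ih mn]; first by rewrite big_ord0 subrr (semi_norm0 sb).
  rewrite big_ord_recr /= addrC -(subrKA (f m)).
  apply: le_trans (semi_normD sb (XD m mn) (XD0 m (ltnW mn))) _.
  by rewrite lerD2l ih// ltnW.
rewrite -(semi_norm_sqr sb); last exact: XD0.
apply: (@le_trans _ _ ((\sum_(k < n) N (f k.+1 - f k)) ^+ 2)).
  rewrite ler_pXn2r ?nnegrE ?semi_norm_ge0 ?h//.
  by apply: sumr_ge0 => k _; exact: semi_norm_ge0.
apply: le_trans (sqr_sum_le _) _; rewrite ler_wpM2l//.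
by apply: ler_sum => k _; rewrite (semi_norm_sqr sb)//; exact: XD.
Qed.

End Telescope.

Section ElasticSolve.
Context {R : realType} {E F : lmodType R}.
Variables (H : set E) (ip : E -> E -> R) (V : set F) (s : F -> F -> R) (dv : F -> E).
Hypotheses (sip : semi_inner H ip) (ss : semi_inner V s).
Hypothesis dvH : forall v, V v -> H (dv v).
Variables (mu la : R).
Hypotheses (mu0 : 0 < mu) (la0 : 0 < la).
Local Notation N := (semi_norm ip).

(** Testing elasticity with u and the constraint with x eliminates div u: the
    total pressure x depends on the fluid contents o with constant 1. *)
Lemma elastic_bound u x o rho : V u -> H x -> H o -> H rho ->
  2 * mu * s u u = ip (dv u) x ->
  ip (dv u) x + la^-1 * ip x x - la^-1 * ip o x = ip rho x ->
  N x <= N o + la * N rho /\ mu * s u u <= la / 8 * (la^-1 * N o + N rho) ^+ 2.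
Proof.
move=> Vu Hx Ho Hr e1 e2; have s0 := sip_ge0 ss Vu.
have il0 : 0 < la^-1 by rewrite invr_gt0.
have h1 := le_trans (ler_norm _) (cauchy_schwarz sip Ho Hx).
have h2 := le_trans (ler_norm _) (cauchy_schwarz sip Hr Hx).
have xx := semi_norm_sqr sip Hx.
have key : 2 * mu * s u u + la^-1 * N x ^+ 2 <= (la^-1 * N o + N rho) * N x.
  rewrite xx e1; have := ler_wpM2l (ltW il0) h1; rewrite mulrDl -mulrA; lra.
have Nx := semi_norm_ge0 ip x.
have mus : 0 <= mu * s u u by rewrite mulr_ge0// ltW.
split.
  have [->|xn0] := eqVneq (N x) 0.
    by rewrite addr_ge0 ?semi_norm_ge0// mulr_ge0 ?semi_norm_ge0// ltW.
  have xp : 0 < N x by rewrite lt_def xn0.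
  have : la^-1 * N x <= la^-1 * N o + N rho.
    rewrite -(ler_pM2r xp); move: key; rewrite expr2 !mulrA; lra.
  by rewrite -(ler_pM2l la0) mulrDr !mulrA divff ?gt_eqF// !mul1r.
have sq := sqr_ge0 (N x - la / 2 * (la^-1 * N o + N rho)).
set B := la^-1 * N o + N rho in key sq *.
have : la^-1 * (N x - la / 2 * B) ^+ 2 = la^-1 * N x ^+ 2 - B * N x + la / 4 * B ^+ 2.
  by field; rewrite gt_eqF.
have : 0 <= la^-1 * (N x - la / 2 * B) ^+ 2 by rewrite mulr_ge0// ltW.
move: key; lra.
Qed.

End ElasticSolve.

(** The margin m0 by which the mass matrix of pressure and temperature exceeds
    the coupling through the total pressure, and s0 with
    |al x + be y|^2 <= s0 (|x|^2 + |y|^2), determine the factor k of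
    [energy_recursion]. The four summands bound, in order, the displacement, the
    total pressure, the pressure with the temperature, and the diffusion terms. *)
Definition stability_const {R : realType} (al be la a0 b0 c0 : R) : R :=
  let m0 := Num.min (c0 - b0) (a0 - b0) in
  let s0 := 2 * (al ^+ 2 + be ^+ 2) in
  let k := (3 + s0 / (la * m0)) * (2 * (s0 / m0 + la / 2) + m0^-1) in
  let kx := 2 / m0 * k in
  (s0 * kx / (4 * la) + la / 4) + (2 * (s0 * kx) + 2 * la ^+ 2) +
  (c0 - b0 + (a0 - b0)) * kx + 2 * k.

Section SchemeStability.
Context {R : realType} {E F : lmodType R}.
Variables (H W Q : set E) (ip aK aT : E -> E -> R).
Variables (V : set F) (s : F -> F -> R) (dv : F -> E).
Hypotheses (sip : semi_inner H ip) (ss : semi_inner V s).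
Hypotheses (sK : semi_inner W aK) (sT : semi_inner W aT).
Hypotheses (WH : W `<=` H) (QH : Q `<=` H) (sQ : subspace Q).
Hypothesis sdv : seen_linear V H ip dv.
Variables (mu la al be a0 b0 c0 dt : R).
Hypotheses (mu_gt0 : 0 < mu) (la_gt0 : 0 < la) (al_gt0 : 0 < al) (be_gt0 : 0 < be).
Hypotheses (b0a0 : b0 < a0) (b0c0 : b0 < c0) (b0_ge0 : 0 <= b0) (dt_gt0 : 0 < dt).
Variables (ep eT ex : nat -> E) (eu : nat -> F) (rho Rp RT : nat -> E) (N : nat).
Hypotheses (Wp : forall n, (n <= N.+1)%N -> W (ep n))
  (WT : forall n, (n <= N.+1)%N -> W (eT n))
  (Qx : forall n, (n <= N.+1)%N -> Q (ex n)) (Vu : forall n, (n <= N.+1)%N -> V (eu n))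
  (Hrho : forall n, (n <= N.+1)%N -> H (rho n))
  (HRp : forall n, (n <= N)%N -> H (Rp n)) (HRT : forall n, (n <= N)%N -> H (RT n)).
Hypotheses (p0 : ip (ep 0%N) (ep 0%N) = 0) (T0 : ip (eT 0%N) (eT 0%N) = 0)
  (x0 : ip (ex 0%N) (ex 0%N) = 0) (Kp0 : aK (ep 0%N) (ep 0%N) = 0)
  (TT0 : aT (eT 0%N) (eT 0%N) = 0)
  (du0 : forall phi, Q phi -> ip (dv (eu 0%N)) phi = 0).
Hypothesis pressure_step : forall n q, (n <= N)%N -> W q ->
  (c0 + al ^+ 2 / la) * ip (ep n.+1 - ep n) q + (al * be / la - b0) * ip (eT n.+1 - eT n) q
  + dt * aK (ep n.+1) q - al / la * ip (ex n.-1.+1 - ex n.-1) q = ip (Rp n) q.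
Hypothesis temperature_step : forall n q, (n <= N)%N -> W q ->
  (a0 + be ^+ 2 / la) * ip (eT n.+1 - eT n) q + (al * be / la - b0) * ip (ep n.+1 - ep n) q
  + dt * aT (eT n.+1) q - be / la * ip (ex n.-1.+1 - ex n.-1) q = ip (RT n) q.
Hypothesis elasticity : forall n v, (n <= N.+1)%N -> V v ->
  2 * mu * s (eu n) v = ip (dv v) (ex n).
Hypothesis constraint : forall n phi, (n <= N.+1)%N -> Q phi ->
  ip (dv (eu n)) phi + la^-1 * ip (ex n) phi - la^-1 * ip (al *: ep n + be *: eT n) phi
  = ip (rho n) phi.

Let om n := al *: ep n + be *: eT n.
Let D (f : nat -> E) n := f n.+1 - f n.
Let sH : subspace H. Proof. by case: sip. Qed.
Let sW : subspace W. Proof. by case: sK. Qed.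
Let sV : subspace V. Proof. by case: ss. Qed.
Let nrm := semi_norm ip.
Let lin z (Hz : H z) := sip_lin sip Hz.
Let Hp n : (n <= N.+1)%N -> H (ep n). Proof. by move=> /Wp /WH. Qed.
Let HT n : (n <= N.+1)%N -> H (eT n). Proof. by move=> /WT /WH. Qed.
Let Hx n : (n <= N.+1)%N -> H (ex n). Proof. by move=> /Qx /QH. Qed.
Let Hom n : (n <= N.+1)%N -> H (om n).
Proof.
by move=> nN; apply: (subspaceD sH); apply: (subspaceZ sH); [exact: Hp|exact: HT].
Qed.

(** Both relations are linear in time, so they hold for differences of levels. *)
Let elastic_diff n m : (n <= N.+1)%N -> (m <= N.+1)%N ->
  nrm (ex n - ex m) <= nrm (om n - om m) + la * nrm (rho n - rho m) /\
  mu * s (eu n - eu m) (eu n - eu m) <=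
    la / 8 * (la^-1 * nrm (om n - om m) + nrm (rho n - rho m)) ^+ 2.
Proof.
move=> nN mN; have Vd : V (eu n - eu m) by apply: (subspaceB sV); exact: Vu.
have Qd : Q (ex n - ex m) by apply: (subspaceB sQ); exact: Qx.
have Hxd := QH Qd.
apply: (@elastic_bound _ _ _ H ip V s dv sip ss mu la mu_gt0 la_gt0
  (eu n - eu m) (ex n - ex m) (om n - om m) (rho n - rho m)) => //.
- by apply: (subspaceB sH); exact: Hom.
- by apply: (subspaceB sH); exact: Hrho.
- rewrite (formB (sip_lin ss Vd)) ?mulrBr ?elasticity//; [|exact: Vu..].
  have Hd := sdv.1 _ Vd.
  by rewrite (formB (sip_linr sip Hd))//; exact: Hx.
- have dB : ip (dv (eu n - eu m)) (ex n - ex m) =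
      ip (dv (eu n)) (ex n - ex m) - ip (dv (eu m)) (ex n - ex m).
    rewrite addrC -scaleN1r sdv.2//; [|exact: Vu..].
    by rewrite mulN1r addrC.
  have xB := formB (lin Hxd) (Hx nN) (Hx mN).
  have oB := formB (lin Hxd) (Hom nN) (Hom mN).
  have rB := formB (lin Hxd) (Hrho nN) (Hrho mN).
  rewrite dB xB oB rB -(constraint nN Qd) -(constraint mN Qd).
  by ring.
Qed.

Let m0 : R := Num.min (c0 - b0) (a0 - b0).
Let s0 : R := 2 * (al ^+ 2 + be ^+ 2).
Let xs n := ip (D ep n) (D ep n) + ip (D eT n) (D eT n).
Let gs n := aK (ep n) (ep n) + aT (eT n) (eT n).
Let rs n := ip (Rp n) (Rp n) + ip (RT n) (RT n).

Let HDp n : (n <= N)%N -> H (D ep n).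
Proof. by move=> nN; apply: (subspaceB sH); apply: Hp => //; exact: leqW. Qed.
Let HDT n : (n <= N)%N -> H (D eT n).
Proof. by move=> nN; apply: (subspaceB sH); apply: HT => //; exact: leqW. Qed.
Let HDx n : (n <= N)%N -> H (D ex n).
Proof. by move=> nN; apply: (subspaceB sH); apply: Hx => //; exact: leqW. Qed.
Let DomE n : om n.+1 - om n = al *: D ep n + be *: D eT n.
Proof. by rewrite /om opprD addrACA -!scalerBr. Qed.

Let m0_gt0 : 0 < m0. Proof. by rewrite lt_min !subr_gt0 b0c0. Qed.
Let s0_gt0 : 0 < s0. Proof. by rewrite mulr_gt0// addr_gt0// exprn_gt0. Qed.

Let Dom_le n : (n <= N)%N -> nrm (om n.+1 - om n) ^+ 2 <= s0 * xs n.
Proof.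
move=> nN; have hp := HDp nN; have hT := HDT nN; rewrite DomE.
have h1 := semi_normD sip (subspaceZ sH al hp) (subspaceZ sH be hT).
rewrite !(semi_normZ sip)// !gtr0_norm// in h1.
have n1 := semi_norm_sqr sip hp; have n2 := semi_norm_sqr sip hT.
rewrite /xs -n1 -n2 /nrm.
move: (semi_norm_ge0 ip (D ep n)) (semi_norm_ge0 ip (D eT n)) h1 {n1 n2}.
move: (semi_norm ip (D ep n)) (semi_norm ip (D eT n)) => P T P0 T0' h1.
apply: (@le_trans _ _ ((al * P + be * T) ^+ 2)).
  have aa : 0 <= al * P + be * T by apply: addr_ge0; apply: mulr_ge0 => //; exact: ltW.
  by rewrite ler_pXn2r// nnegrE; exact: semi_norm_ge0.
have q1 := sqr_ge0 (al * P - be * T); have q2 := sqr_ge0 (al * T).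
have q3 := sqr_ge0 (be * P); rewrite !exprMn in q2 q3.
by rewrite /s0; move: q1 q2 q3; nra.
Qed.

(** Testing the step with the increments of the pressure and temperature. *)
Let step n : (n <= N)%N ->
  m0 * xs n + la^-1 * nrm (om n.+1 - om n) ^+ 2 + dt / 2 * (gs n.+1 - gs n) <=
  la^-1 * (nrm (D ex n.-1) * nrm (om n.+1 - om n)) + m0 / 4 * xs n + m0^-1 * rs n.
Proof.
move=> nN; have n1 : (n.-1 <= N)%N by rewrite (leq_trans (leq_pred n)).
have hp := HDp nN; have hT := HDT nN; have hx := HDx n1.
have wp : W (D ep n) by apply: (subspaceB sW); apply: Wp => //; exact: leqW.
have wT : W (D eT n) by apply: (subspaceB sW); apply: WT => //; exact: leqW.
have hom : H (om n.+1 - om n) by apply: (subspaceB sH); apply: Hom => //; exact: leqW.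
have := pressure_step nN wp; have := temperature_step nN wT.
rewrite -!/(D _ _).
have [_ _ ipC _] := sip.
rewrite (ipC (D ep n) (D eT n))//.
have omR z : H z -> ip z (al *: D ep n + be *: D eT n) =
    al * ip z (D ep n) + be * ip z (D eT n).
  move=> hz; have lr := sip_linr sip hz.
  rewrite (formD lr (subspaceZ sH al hp) (subspaceZ sH be hT)).
  by rewrite (formZ sH lr al hp) (formZ sH lr be hT).
have -> : nrm (om n.+1 - om n) ^+ 2 = al ^+ 2 * ip (D ep n) (D ep n)
    + 2 * (al * be) * ip (D eT n) (D ep n) + be ^+ 2 * ip (D eT n) (D eT n).
  rewrite (semi_norm_sqr sip hom) DomE.
  have hs : H (al *: D ep n + be *: D eT n) by rewrite -DomE.
  have ZT := subspaceZ sH be hT.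
  rewrite (lin hs al hp ZT) (formZ sH (lin hs) be hT).
  by rewrite (omR _ hp) (omR _ hT) (ipC (D ep n) (D eT n))//; ring.
have CS : ip (D ex n.-1) (om n.+1 - om n) <= nrm (D ex n.-1) * nrm (om n.+1 - om n).
  exact: le_trans (ler_norm _) (cauchy_schwarz sip hx hom).
rewrite {1}DomE (omR _ hx) in CS.
have half (a : E -> E -> R) (f : nat -> E) : semi_inner W a -> W (f n.+1) -> W (f n) ->
    (a (f n.+1) (f n.+1) - a (f n) (f n)) / 2 <= a (f n.+1) (D f n).
  move=> sa w1 w0; have wd := subspaceB sW w1 w0; have := sip_ge0 sa wd.
  have [_ _ aC _] := sa.
  rewrite (formB (sip_lin sa wd) w1 w0) (formB (sip_linr sa w1) w1 w0).
  rewrite (formB (sip_linr sa w0) w1 w0) (aC _ _ w0 w1); lra.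
have hK := half aK ep sK (Wp (leq_ltn_trans nN (ltnSn N))) (Wp (leqW nN)).
have hT' := half aT eT sT (WT (leq_ltn_trans nN (ltnSn N))) (WT (leqW nN)).
(* The weight m0 / 4 is small enough for both products to be absorbed. *)
have young z d : H z -> H d -> ip z d <= m0 / 4 * ip d d + m0^-1 * ip z z.
  move=> hz hd; have hm : H (m0 / 2 *: d - z).
    by apply: (subspaceB sH) => //; exact: (subspaceZ sH).
  have := sip_ge0 sip hm; have hZ := subspaceZ sH (m0 / 2) hd.
  rewrite (formB (lin hm) hZ hz) (formB (sip_linr sip hZ) hZ hz).
  rewrite (formB (sip_linr sip hz) hZ hz) (formZ sH (lin hZ) _ hd) (formZ sH (lin hz) _ hd).
  rewrite !(formZ sH (sip_linr sip hd) _ hd) ?(formZ sH (sip_linr sip hz) _ hd) (ipC d z)// => h.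
  have := mulr_ge0 (ltW (_ : 0 < m0^-1)) h; rewrite invr_gt0 => /(_ m0_gt0).
  have -> : m0^-1 * (m0 / 2 * (m0 / 2 * ip d d) - m0 / 2 * ip z d -
     (m0 / 2 * ip z d - ip z z)) = m0 / 4 * ip d d - ip z d + m0^-1 * ip z z.
    by field; rewrite gt_eqF.
  lra.
have y1 := young _ _ (HRp nN) hp; have y2 := young _ _ (HRT nN) hT.
have pp := sip_ge0 sip hp; have tt := sip_ge0 sip hT.
have cross : 2 * ip (D eT n) (D ep n) <= ip (D ep n) (D ep n) + ip (D eT n) (D eT n).
  have := sip_ge0 sip (subspaceB sH hp hT).
  have hd := subspaceB sH hp hT.
  rewrite (formB (lin hd) hp hT) (formB (sip_linr sip hp) hp hT).
  rewrite (formB (sip_linr sip hT) hp hT) (ipC (D ep n) (D eT n))//; lra.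
have m1 : m0 <= c0 - b0 by rewrite ge_min lexx.
have m2 : m0 <= a0 - b0 by rewrite ge_min lexx orbT.
have k1 := ler_wpM2l (ltW dt_gt0) hK; have k2 := ler_wpM2l (ltW dt_gt0) hT'.
have k3 := ler_wpM2l b0_ge0 cross.
have k4 := ler_wpM2r pp m1; have k5 := ler_wpM2r tt m2.
have il0 : 0 <= la^-1 by rewrite invr_ge0 ltW.
have k6 := ler_wpM2l il0 CS.
rewrite /xs /gs /rs; move: k1 k2 k3 k4 k5 k6 y1 y2.
move: (aK _ _) (aK _ _) (aK _ _) (aT _ _) (aT _ _) (aT _ _) => g1 g2 g3 g4 g5 g6.
move: (nrm _ * _) => nn; lra.
Qed.

(** The recursion bounds the squared increments of pressure and temperature and
    each diffusion energy by the sum of the defects. The errors start from 0 in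
    every norm, so the values at the last level are sums of N+1 increments: this
    is where the factor N+1 comes from. *)
Theorem scheme_stability :
  mu * s (eu N.+1) (eu N.+1) + ip (ex N.+1) (ex N.+1) +
  (c0 - b0) / 2 * ip (ep N.+1) (ep N.+1) + (a0 - b0) / 2 * ip (eT N.+1) (eT N.+1) +
  dt * (\sum_(1 <= n < N.+1) (aK (ep n.+1) (ep n.+1) + aT (eT n.+1) (eT n.+1))) <=
  stability_const al be la a0 b0 c0 *
  (N.+1%:R * \sum_(n < N.+1) (ip (rho n.+1 - rho n) (rho n.+1 - rho n) +
     (ip (Rp n) (Rp n) + ip (RT n) (RT n)))).
Proof.
pose z n := nrm (rho n.+1 - rho n).
have Hz n : (n <= N)%N -> H (rho n.+1 - rho n).
  by move=> nN; apply: (subspaceB sH); apply: Hrho => //; exact: leqW.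
have le1 (k : 'I_N.+1) : (k <= N)%N by rewrite -ltnS.
have xs0 n : (n <= N)%N -> 0 <= xs n.
  by move=> nN; apply: addr_ge0; apply: (sip_ge0 sip); [exact: HDp|exact: HDT].
have rs0 n : (n <= N)%N -> 0 <= rs n.
  by move=> nN; apply: addr_ge0; apply: (sip_ge0 sip); [exact: HRp|exact: HRT].
have gs0 n : (n <= N.+1)%N -> 0 <= gs n.
  by move=> nN; apply: addr_ge0; [apply: (sip_ge0 sK)|apply: (sip_ge0 sT)]; auto.
have z2 n : (n <= N)%N -> z n ^+ 2 = ip (rho n.+1 - rho n) (rho n.+1 - rho n).
  by move=> nN; rewrite (semi_norm_sqr sip)//; exact: Hz.
pose S := \sum_(n < N.+1) (z n ^+ 2 + rs n).
have -> : \sum_(n < N.+1) (ip (rho n.+1 - rho n) (rho n.+1 - rho n) +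
     (ip (Rp n) (Rp n) + ip (RT n) (RT n))) = S.
  by apply: eq_bigr => n _; rewrite z2.
have t0 n : (n <= N)%N -> 0 <= z n ^+ 2 + rs n.
  by move=> nN; rewrite addr_ge0 ?sqr_ge0 ?rs0.
have S0 : 0 <= S by apply: sumr_ge0 => n _; exact: t0.
pose k := (3 + s0 / (la * m0)) * (2 * (s0 / m0 + la / 2) + m0^-1).
have k0 : 0 < k.
  have h1 : 0 < s0 / (la * m0) by rewrite divr_gt0// mulr_gt0.
  have h2 : 0 < s0 / m0 by rewrite divr_gt0.
  have h3 : 0 < m0^-1 by rewrite invr_gt0.
  by rewrite /k mulr_gt0//; [lra|move: la_gt0 h2 h3; lra].
have rec n : (n <= N)%N -> m0 / 2 * \sum_(j < n.+1) xs j + dt / 2 * gs n.+1 <= k * S.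
  move=> nN; apply: (@le_trans _ _ (k * \sum_(j < n.+1) (z j ^+ 2 + rs j))).
    apply: (@energy_recursion _ m0 la s0 dt xs (fun n => nrm (om n.+1 - om n))
      (fun n => nrm (D ex n)) z rs gs N) => //.
    - by move=> j; exact: semi_norm_ge0.
    - by move=> j; exact: semi_norm_ge0.
    - by move=> j; exact: semi_norm_ge0.
    - by rewrite /gs Kp0 TT0 addr0.
    - by move=> j jN; exact: gs0.
    - by move=> j jN; have [] := elastic_diff (leq_ltn_trans jN (ltnSn N)) (leqW jN).
  apply: ler_wpM2l; first exact: ltW.
  rewrite /S -!(big_mkord xpredT (fun j => z j ^+ 2 + rs j)).
  rewrite (@big_cat_nat _ _ _ n.+1 0 N.+1)//= lerDl.
  rewrite big_nat_cond; apply: sumr_ge0 => j /andP[/andP[_ jN] _]; exact: t0.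
have X0 n : (n <= N)%N -> 0 <= \sum_(j < n.+1) xs j.
  by move=> nN; apply: sumr_ge0 => j _; apply: xs0; rewrite (leq_trans _ nN)// -ltnS.
pose kx := 2 / m0 * k.
have kx0 : 0 < kx by rewrite mulr_gt0// divr_gt0.
have XS : \sum_(j < N.+1) xs j <= kx * S.
  rewrite /kx -mulrA -ler_pdivrMl ?divr_gt0// invf_div.
  apply: le_trans (rec N (leqnn N)); rewrite lerDl mulr_ge0 ?gs0//.
  by rewrite ltW// divr_gt0.
have gS n : (n <= N)%N -> dt * gs n.+1 <= 2 * k * S.
  move=> nN; have := rec n nN; have : 0 <= m0 / 2 * \sum_(j < n.+1) xs j.
    by rewrite mulr_ge0 ?X0// ltW// divr_gt0.
  lra.
have n1 : 0 <= N.+1%:R :> R by [].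
have pT : ip (ep N.+1) (ep N.+1) + ip (eT N.+1) (eT N.+1) <= N.+1%:R * (kx * S).
  rewrite (semi_norm_triangle_null sip (Hp (leqnn _)) (Hp (leq0n _)) p0).
  rewrite (semi_norm_triangle_null sip (HT (leqnn _)) (HT (leq0n _)) T0).
  apply: le_trans (lerD (telescope_sqr sip Hp) (telescope_sqr sip HT)) _.
  by rewrite -mulrDr -big_split ler_wpM2l.
have omS : nrm (om N.+1 - om 0%N) ^+ 2 <= N.+1%:R * (s0 * (kx * S)).
  rewrite (semi_norm_sqr sip); last by apply: (subspaceB sH); exact: Hom.
  apply: le_trans (telescope_sqr sip Hom) _; rewrite ler_wpM2l//.
  apply: (@le_trans _ _ (s0 * \sum_(j < N.+1) xs j)); last by rewrite ler_wpM2l// ltW.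
  rewrite mulr_sumr; apply: ler_sum => j _.
  have jN := le1 j; rewrite -(semi_norm_sqr sip); first exact: Dom_le.
  by apply: (subspaceB sH); apply: Hom => //; exact: leqW.
have rhoS : nrm (rho N.+1 - rho 0%N) ^+ 2 <= N.+1%:R * S.
  rewrite (semi_norm_sqr sip); last by apply: (subspaceB sH); exact: Hrho.
  apply: le_trans (telescope_sqr sip Hrho) _; rewrite ler_wpM2l//.
  by apply: ler_sum => j _; rewrite -z2// lerDl rs0.
have [xb ub] := elastic_diff (leqnn N.+1) (leq0n N.+1).
have u0 : s (eu 0%N) (eu 0%N) = 0.
  have V0 := Vu (leq0n N.+1); have := elasticity (leq0n N.+1) V0.
  rewrite du0; last exact: Qx.
  by move/eqP; rewrite mulf_eq0 mulf_eq0 pnatr_eq0/= gt_eqF//= => /eqP.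
rewrite (semi_norm_triangle_null ss (Vu (leqnn _)) (Vu (leq0n _)) u0).
rewrite (semi_norm_triangle_null sip (Hx (leqnn _)) (Hx (leq0n _)) x0).
rewrite -(semi_norm_sqr sip); last by apply: (subspaceB sH); exact: Hx.
have sumg : dt * (\sum_(1 <= n < N.+1) (aK (ep n.+1) (ep n.+1) + aT (eT n.+1) (eT n.+1)))
    <= N.+1%:R * (2 * k * S).
  rewrite mulr_sumr big_nat; apply: (@le_trans _ _ (\sum_(1 <= n < N.+1) 2 * k * S)).
    by rewrite [leRHS]big_nat; apply: ler_sum => n /andP[_ nN]; exact: gS.
  rewrite sumr_const_nat subn1 /= -[leLHS]mulr_natl ler_wpM2r ?ler_nat//.
  by rewrite mulr_ge0// mulr_ge0// ltW.
have := semi_norm_ge0 ip (ex N.+1 - ex 0%N).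
have p1 := sip_ge0 sip (Hp (leqnn N.+1)); have p2 := sip_ge0 sip (HT (leqnn N.+1)).
have c1 : 0 < c0 - b0 by rewrite subr_gt0.
have c2 : 0 < a0 - b0 by rewrite subr_gt0.
move: (semi_norm_ge0 ip (om N.+1 - om 0%N)) (semi_norm_ge0 ip (rho N.+1 - rho 0%N)).
have -> : stability_const al be la a0 b0 c0 = s0 * kx / (4 * la) + la / 4 +
    (2 * (s0 * kx) + 2 * la ^+ 2) + (c0 - b0 + (a0 - b0)) * kx + 2 * k by [].
move: xb ub omS rhoS sumg pT p1 p2; rewrite /nrm.
set o := semi_norm ip (om _ - _); set r := semi_norm ip (rho _ - _).
set x := semi_norm ip (ex _ - _); set us := mu * _; set g := dt * _.
set pp := ip _ _; set tt := ip _ _ => xb ub omS rhoS sumg pT p1 p2 o0 r0 x0'.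
have hx : x ^+ 2 <= 2 * o ^+ 2 + 2 * la ^+ 2 * r ^+ 2.
  apply: (@le_trans _ _ ((o + la * r) ^+ 2)).
    by rewrite ler_pXn2r// nnegrE addr_ge0// mulr_ge0// ltW.
  by have := sqr_ge0 (o - la * r); nra.
have hu : us <= (4 * la)^-1 * o ^+ 2 + la / 4 * r ^+ 2.
  apply: le_trans ub _.
  have -> : (4 * la)^-1 * o ^+ 2 + la / 4 * r ^+ 2 =
      la / 8 * (la^-1 * o + r) ^+ 2 + la / 8 * (la^-1 * o - r) ^+ 2.
    by field; rewrite gt_eqF.
  by rewrite lerDl mulr_ge0 ?sqr_ge0// ltW// divr_gt0.
set M := N.+1%:R * S.
have M0 : 0 <= M by rewrite mulr_ge0.
have oM : o ^+ 2 <= s0 * kx * M by apply: le_trans omS _; rewrite /M; lra.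
have gM : g <= 2 * k * M by apply: le_trans sumg _; rewrite /M; lra.
have pM : (c0 - b0) / 2 * pp + (a0 - b0) / 2 * tt <= (c0 - b0 + (a0 - b0)) * kx * M.
  have pT' : pp + tt <= kx * M by apply: le_trans pT _; rewrite /M; lra.
  have h1 := ler_wpM2l (ltW c1) pT'; have h2 := ler_wpM2l (ltW c2) pT'.
  have h3 : 0 <= (c0 - b0) * pp by rewrite mulr_ge0// ltW.
  have h4 : 0 <= (c0 - b0) * tt by rewrite mulr_ge0// ltW.
  have h5 : 0 <= (a0 - b0) * pp by rewrite mulr_ge0// ltW.
  have h6 : 0 <= (a0 - b0) * tt by rewrite mulr_ge0// ltW.
  by move: h1 h2 h3 h4 h5 h6; lra.
have i4 : 0 <= (4 * la)^-1 by rewrite invr_ge0 mulr_ge0// ltW.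
have q1 := ler_wpM2l i4 oM.
have l4 : 0 <= la / 4 by rewrite divr_ge0// ltW.
have q2 := ler_wpM2l l4 rhoS; have q3 := ler_wpM2l (sqr_ge0 la) rhoS.
rewrite -/M in q2 q3.
have -> : (s0 * kx / (4 * la) + la / 4 + (2 * (s0 * kx) + 2 * la ^+ 2) +
    (c0 - b0 + (a0 - b0)) * kx + 2 * k) * M =
  (4 * la)^-1 * (s0 * kx * M) + la / 4 * M + (2 * (s0 * kx * M) + 2 * (la ^+ 2 * M)) +
  (c0 - b0 + (a0 - b0)) * kx * M + 2 * k * M by ring.
by move: hx hu gM pM q1 q2 q3 oM; lra.
Qed.

End SchemeStability.

(** * Time increments in a semi-inner product space *)

Section NormIncrement.
Context {R : realType} {E : lmodType R}.
Variable tau : R.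
Local Notation J := (`]0, tau[%classic).

Lemma semi_inner_sub (X Z : set E) (b : E -> E -> R) : subspace X -> X `<=` Z ->
  semi_inner Z b -> semi_inner X b.
Proof.
move=> sX XZ [_ lb bC b0]; split => //.
- by move=> a x y z Xx Xy Xz; apply: lb; exact: XZ.
- by move=> x y Xx Xy; apply: bC; exact: XZ.
- by move=> x Xx; apply: b0; exact: XZ.
Qed.

Section First.
Variables (X Z : set E) (b : E -> E -> R) (nrm : E -> R) (w w' : R -> E).
Hypotheses (sb : semi_inner Z b) (sX : subspace X) (XZ : X `<=` Z).
Hypothesis nrmE : forall x, X x -> nrm x = semi_norm b x.
Hypotheses (Lw' : bochner_L2 J X nrm w') (dw : time_derivative tau X nrm w w').

(** Duality: the increment is tested against itself. *)
Lemma norm_increment (s t : R) : 0 <= s -> s <= t -> t <= tau ->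
  nrm (w t - w s) ^+ 2 <= (t - s) * (energy nrm w' t - energy nrm w' s).
Proof.
move=> s0 st ttau.
have Xt : X (w t) by apply: dw.1; rewrite (le_trans s0 st).
have Xs : X (w s) by apply: dw.1; rewrite s0 (le_trans st ttau).
have Xz := subspaceB sX Xt Xs; set z := w t - w s in Xz *.
have Zz := XZ Xz; have nz := nrmE Xz.
have n0 : 0 <= nrm z by rewrite nz; exact: semi_norm_ge0.
have lin : forall (a : R) x y, X x -> X y -> b (a *: x + y) z = a * b x z + b y z.
  by move=> a x y Xx Xy; apply: (sip_lin sb Zz); exact: XZ.
have bnd : forall x, X x -> `|b x z| <= nrm z * nrm x.
  move=> x Xx; rewrite mulrC nz (nrmE Xx).
  exact: (cauchy_schwarz sb (XZ Xx) Zz).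
have := increment_le sX Lw' dw n0 lin bnd s0 st ttau.
rewrite -(formB lin Xt Xs) -(semi_norm_sqr sb Zz) -nz.
have d0 : 0 <= (t - s) * (energy nrm w' t - energy nrm w' s).
  by apply: mulr_ge0; rewrite subr_ge0//; exact: (energy_nd Lw').
have [->|zn0] := eqVneq (nrm z) 0; first by rewrite expr0n.
by rewrite [in leLHS]expr2 ler_pM2l// exprn_gt0// lt_def zn0.
Qed.

(** The square of an increment in time is at most linear in the time step. *)
Lemma continuous_upto_functional (l : E -> R) : 0 < tau ->
  (forall (a : R) x y, X x -> X y -> l (a *: x + y) = a * l x + l y) ->
  (exists K, forall x, X x -> `|l x| <= K * nrm x) ->
  continuous_upto tau (fun t => l (w t)).
Proof.
move=> tau0 lin [K lK].
have K1 : forall x, X x -> `|l x| <= `|K| * nrm x.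
  move=> x Xx; apply: le_trans (lK x Xx) _; apply: ler_wpM2r; last exact: ler_norm.
  by rewrite (nrmE Xx); exact: semi_norm_ge0.
have en0 t : 0 <= t -> t <= tau -> 0 <= energy nrm w' t.
  by move=> t0 ttau; rewrite -(energy0 nrm w'); exact: (energy_nd Lw').
apply: (@continuous_upto_hoelder _ tau _ (`|K| ^+ 2 * energy nrm w' tau)).
  by apply: mulr_ge0; [exact: sqr_ge0|apply: en0 => //; exact: ltW].
move=> s t s0 st ttau.
apply: le_trans (increment_le sX Lw' dw (normr_ge0 K) lin K1 s0 st ttau) _.
rewrite -[leRHS]mulrA; apply: ler_wpM2l; first exact: sqr_ge0.
rewrite mulrC; apply: ler_wpM2r; first by rewrite subr_ge0.
have h1 := energy_nd Lw' (le_trans s0 st) ttau (lexx tau).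
have h2 := en0 s s0 (le_trans st ttau).
by move: h1 h2; lra.
Qed.

End First.

Section Second.
Variables (X Y : set E) (b : E -> E -> R) (nX nY : E -> R) (w w1 w2 : R -> E).
Hypotheses (sb : semi_inner Y b) (sX : subspace X) (XY : X `<=` Y).
Hypothesis nYE : forall y, Y y -> nY y = semi_norm b y.
Hypothesis nYX : forall x, X x -> nY x <= nX x.
Hypotheses (dw : time_derivative tau X nX w w1) (Lw1 : bochner_L2 J X nX w1).
Hypotheses (dw1 : time_derivative tau Y nY w1 w2) (Lw2 : bochner_L2 J Y nY w2).

(** The same duality, in the weaker space Y in which the second derivative lives. *)
Lemma norm_second_increment (s t t' : R) :
  0 <= s -> s <= t -> t <= t' -> t' <= tau ->
  nY (w t - w s - (t - s) *: w1 t') ^+ 2 <=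
  (t - s) ^+ 2 * ((t' - s) * (energy nY w2 t' - energy nY w2 s)).
Proof.
move=> s0 st tt' t'tau; have sY : subspace Y by case: sb.
have ttau := le_trans tt' t'tau; have t0 := le_trans s0 st.
have Xt : X (w t) by apply: dw.1; rewrite t0.
have Xs : X (w s) by apply: dw.1; rewrite s0 (le_trans st ttau).
have Y1 : Y (w1 t') by apply: dw1.1; rewrite (le_trans t0 tt').
have YD := subspaceB sY (XY Xt) (XY Xs); have YZ := subspaceZ sY (t - s) Y1.
have Yz := subspaceB sY YD YZ; set z := w t - w s - _ in Yz *.
have nz := nYE Yz.
have n0 : 0 <= nY z by rewrite nz; exact: semi_norm_ge0.
have lin := sip_lin sb Yz.
have bnd : forall x, Y x -> `|b x z| <= nY z * nY x.
  by move=> x Yx; rewrite mulrC nz (nYE Yx); exact: (cauchy_schwarz sb Yx Yz).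
have bl : bounded_functional X nX (fun x => b x z).
  split; first by move=> a x y Xx Xy; apply: lin; exact: XY.
  exists (nY z) => x Xx; apply: le_trans (bnd x (XY Xx)) _.
  by apply: ler_wpM2l => //; exact: nYX.
have := second_increment_le sX sY dw Lw1 dw1 Lw2 bl n0 lin bnd s0 st tt' t'tau.
rewrite -(formB lin (XY Xt) (XY Xs)) -(formZ sY lin (t - s) Y1) -(formB lin YD YZ).
rewrite -/z -(semi_norm_sqr sb Yz) -nz -mulrA.
have d0 : 0 <= (t - s) ^+ 2 * ((t' - s) * (energy nY w2 t' - energy nY w2 s)).
  apply: mulr_ge0; first exact: sqr_ge0.
  have st' := le_trans st tt'.
  by apply: mulr_ge0; rewrite subr_ge0//; exact: (energy_nd Lw2).
have [->|zn0] := eqVneq (nY z) 0; first by rewrite expr0n.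
by rewrite [in leLHS]expr2 ler_pM2l// exprn_gt0// lt_def zn0.
Qed.

End Second.
End NormIncrement.

(** * Finite element spaces and projections *)

Section FiniteElements.
Context {R : realType} {d : nat}.
Local Notation scal := ('rV[R]_d -> R).
Local Notation vec := ('I_d -> 'rV[R]_d -> R).
Variables (Omega Gammad : set 'rV[R]_d) (Th : seq 'M[R]_(d.+1, d)) (k l : nat).
Hypothesis dO : domain Omega.
Local Notation Vh := (fe_V Omega Gammad Th k).
Local Notation Qh := (fe_Q Omega Th k).
Local Notation Wh := (fe_W Omega Th l).
Local Notation V := (vH1_0 Omega Gammad).
Local Notation W := (H1_0 Omega (boundary Omega)).

Lemma subspace_setI (E : lmodType R) (A B : set E) :
  subspace A -> subspace B -> subspace (A `&` B).
Proof.
move=> [A0 Al] [B0 Bl]; split => // a x y [Ax Bx] [Ay By].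
by split; [exact: Al|exact: Bl].
Qed.

Lemma subspace_polynomial_on m (A : set 'rV[R]_d) : subspace (polynomial_on m A).
Proof.
split; first by exists (fun=> 0) => x _; rewrite big1// => a _; rewrite mul0r.
move=> a f g [c fE] [c' gE]; exists (fun b => a * c b + c' b) => x Ax.
rewrite -[LHS]/(a * f x + g x) fE// gE// mulr_sumr -big_split/=.
by apply: eq_bigr => b _; rewrite mulrDl mulrA.
Qed.

Lemma subspace_lagrange m : subspace (Defs.lagrange Omega Th m).
Proof.
split; first split.
- exact: cst_continuous.
- by move=> S _; exact: (subspace_polynomial_on m (hull S)).1.
- move=> a f g [cf pf] [cg pg]; split.
    move=> x; apply: (@cvgD _ _ _ _ _ (a *: f) g (a *: f x) (g x)); last exact: cg.
    by apply: cvgZr; exact: cf.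
  by move=> S /[dup] /pf fS /pg gS; exact: (subspace_polynomial_on m (hull S)).2.
Qed.

Lemma subspace_fe_V : subspace Vh.
Proof.
by apply: subspace_setI; [exact: subspace_vH1_0|exact: subspace_vector (subspace_lagrange k)].
Qed.

Lemma subspace_fe_Q : subspace Qh.
Proof. by apply: subspace_setI; [exact: subspace_L2|exact: subspace_lagrange]. Qed.

Lemma subspace_fe_W : subspace Wh.
Proof. by apply: subspace_setI; [exact: subspace_H1_0|exact: subspace_lagrange]. Qed.

Lemma fe_V_vsobolev v : Vh v -> vsobolev Omega 1 v.
Proof. by move=> [vV _]; exact: vH1_0_vsobolev vV. Qed.

Lemma fe_W_sobolev q : Wh q -> sobolev Omega 1 q.
Proof. by move=> [qW _]; exact: H1_0_sobolev qW. Qed.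

Lemma fe_W_L2 q : Wh q -> L2 Omega q.
Proof. by move=> /fe_W_sobolev; exact: sobolev_L2. Qed.

Lemma fe_Q_L2 q : Qh q -> L2 Omega q.
Proof. by case. Qed.

Lemma mesh_size_ge0 : 0 <= mesh_size Th.
Proof. by rewrite /mesh_size; elim/big_rec: _ => // S x _ x0; rewrite le_max x0 orbT. Qed.

Section Projections.
Variable P : medium R d.
Local Notation iL2 := (semi_inner_L2 dO).
Local Notation iS := (semi_inner_strain_form dO).

(** A projection is specified by equations and is not a function of its data, but
    the equations are linear: differences of projections project differences.
    Approximation properties thus extend to time increments. *)
Lemma stokes_projectionB u1 u2 x1 x2 Pu1 Pu2 Px1 Px2 :
  vsobolev Omega 1 u1 -> vsobolev Omega 1 u2 -> L2 Omega x1 -> L2 Omega x2 ->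
  stokes_projection Omega Gammad P Th k u1 x1 Pu1 Px1 ->
  stokes_projection Omega Gammad P Th k u2 x2 Pu2 Px2 ->
  stokes_projection Omega Gammad P Th k (u1 - u2) (x1 - x2) (Pu1 - Pu2) (Px1 - Px2).
Proof.
move=> su1 su2 Lx1 Lx2 [V1 Q1 E1 D1] [V2 Q2 E2 D2].
have s1 := fe_V_vsobolev V1; have s2 := fe_V_vsobolev V2.
have L1 := fe_Q_L2 Q1; have L2' := fe_Q_L2 Q2.
have divB a b z : vsobolev Omega 1 a -> vsobolev Omega 1 b -> L2 Omega z ->
    inner Omega (div Omega (a - b)) z = inner Omega (div Omega a) z - inner Omega (div Omega b) z.
  move=> sa sb' Lz; rewrite addrC -scaleN1r.
  have -> := (seen_linear_div dO).2 (-1) b a z sb' sa Lz.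
  by rewrite mulN1r addrC.
split.
- exact: (subspaceB subspace_fe_V V1 V2).
- exact: (subspaceB subspace_fe_Q Q1 Q2).
- move=> v Vv; have sv := fe_V_vsobolev Vv; have Ld := L2_div dO sv.
  rewrite (formB (sip_lin iS sv) s1 s2) (formB (sip_lin iS sv) su1 su2).
  rewrite (formB (sip_linr iL2 Ld) L1 L2') (formB (sip_linr iL2 Ld) Lx1 Lx2).
  have sub (m a b c e x y z t : R) : m * a - x = m * c - z -> m * b - y = m * e - t ->
      m * (a - b) - (x - y) = m * (c - e) - (z - t) by lra.
  exact: sub (E1 v Vv) (E2 v Vv).
- move=> phi Qphi; have Lphi := fe_Q_L2 Qphi.
  by rewrite (divB _ _ _ s1 s2 Lphi) (divB _ _ _ su1 su2 Lphi) (D1 _ Qphi) (D2 _ Qphi).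
Qed.

Lemma elliptic_projectionB A am aM w1 w2 Pw1 Pw2 : 0 < am ->
  spd_tensor Omega A am aM ->
  sobolev Omega 1 w1 -> sobolev Omega 1 w2 ->
  elliptic_projection Omega Th l A w1 Pw1 -> elliptic_projection Omega Th l A w2 Pw2 ->
  elliptic_projection Omega Th l A (w1 - w2) (Pw1 - Pw2).
Proof.
move=> am0 spdA sw1 sw2 [W1 E1] [W2 E2]; have iA := semi_inner_diff_form dO am0 spdA.
split; first exact: (subspaceB subspace_fe_W W1 W2).
move=> q Wq; have sq := fe_W_sobolev Wq.
rewrite (formB (sip_lin iA sq) (fe_W_sobolev W1) (fe_W_sobolev W2)).
by rewrite (formB (sip_lin iA sq) sw1 sw2) (E1 _ Wq) (E2 _ Wq).
Qed.

Lemma stokes_increment (C : R) u1 u2 x1 x2 Pu1 Pu2 Px1 Px2 : 0 <= C ->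
  stokes_projection_bound Omega Gammad P Th k C ->
  V u1 -> V u2 -> vsobolev Omega k.+1 u1 -> vsobolev Omega k.+1 u2 ->
  sobolev Omega k x1 -> sobolev Omega k x2 ->
  stokes_projection Omega Gammad P Th k u1 x1 Pu1 Px1 ->
  stokes_projection Omega Gammad P Th k u2 x2 Pu2 Px2 ->
  L2norm Omega (Px1 - Px2 - (x1 - x2)) ^+ 2 <=
  2 * C ^+ 2 * mesh_size Th ^+ (2 * k) *
    (vHnorm Omega k.+1 (u1 - u2) ^+ 2 + Hnorm Omega k (x1 - x2) ^+ 2).
Proof.
move=> C0 bnd Vu1 Vu2 su1 su2 sx1 sx2 P1 P2.
have SB := stokes_projectionB (vH1_0_vsobolev Vu1) (vH1_0_vsobolev Vu2)
  (sobolev_L2 sx1) (sobolev_L2 sx2) P1 P2.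
have VB := subspaceB (subspace_vH1_0 dO Gammad) Vu1 Vu2.
have sB := subspaceB (subspace_vsobolev dO k.+1) su1 su2.
have xB := subspaceB (subspace_sobolev dO k) sx1 sx2.
have := bnd _ _ _ _ VB sB xB SB.
have g0 : 0 <= vgrad_norm Omega (Pu1 - Pu2 - (u1 - u2)) by exact: sqrtr_ge0.
have n0 := L2norm_ge0 Omega (Px1 - Px2 - (x1 - x2)).
have v0 := vHnorm_ge0 Omega k.+1 (u1 - u2); have h0 := Hnorm_ge0 Omega k (x1 - x2).
have m0 : 0 <= mesh_size Th ^+ k by apply: exprn_ge0; exact: mesh_size_ge0.
rewrite [(2 * k)%N]mulnC exprM.
move: (vgrad_norm _ _) (L2norm _ _) (vHnorm _ _ _) (Hnorm _ _ _) (mesh_size Th ^+ k)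
  g0 n0 v0 h0 m0 => g n v h m g0 n0 v0 h0 m0 le.
have le' : n <= C * (m * v + m * h) by move: le g0; lra.
apply: (@le_trans _ _ ((C * (m * v + m * h)) ^+ 2)).
  by rewrite ler_pXn2r// nnegrE// mulr_ge0// addr_ge0// mulr_ge0.
rewrite -subr_ge0 (_ : _ - _ = (C * m * (v - h)) ^+ 2) ?sqr_ge0//.
by ring.
Qed.

Lemma elliptic_increment A am aM (C : R) w1 w2 Pw1 Pw2 : 0 <= C -> 0 < am ->
  spd_tensor Omega A am aM -> elliptic_projection_bound Omega Th l A C ->
  W w1 -> W w2 -> sobolev Omega l.+1 w1 -> sobolev Omega l.+1 w2 ->
  elliptic_projection Omega Th l A w1 Pw1 -> elliptic_projection Omega Th l A w2 Pw2 ->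
  L2norm Omega (Pw1 - Pw2 - (w1 - w2)) ^+ 2 <=
  C ^+ 2 * mesh_size Th ^+ (2 * l + 2) * Hnorm Omega l.+1 (w1 - w2) ^+ 2.
Proof.
move=> C0 am0 spdA bnd Ww1 Ww2 sw1 sw2 P1 P2.
have PB := elliptic_projectionB am0 spdA (H1_0_sobolev Ww1) (H1_0_sobolev Ww2) P1 P2.
have WB := subspaceB (subspace_H1_0 dO (boundary Omega)) Ww1 Ww2.
have sB := subspaceB (subspace_sobolev dO l.+1) sw1 sw2.
have := bnd _ _ WB sB PB.
have g0 : 0 <= mesh_size Th * grad_norm Omega (Pw1 - Pw2 - (w1 - w2)).
  by apply: mulr_ge0; [exact: mesh_size_ge0|exact: sqrtr_ge0].
have n0 := L2norm_ge0 Omega (Pw1 - Pw2 - (w1 - w2)).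
have h0 := Hnorm_ge0 Omega l.+1 (w1 - w2).
have m0 : 0 <= mesh_size Th ^+ l.+1 by apply: exprn_ge0; exact: mesh_size_ge0.
have -> : mesh_size Th ^+ (2 * l + 2) = (mesh_size Th ^+ l.+1) ^+ 2.
  by rewrite -exprM [(l.+1 * 2)%N]mulSn addnC [(2 * l)%N]mulnC.
move: (mesh_size Th * _) (L2norm _ _) (Hnorm _ _ _) (mesh_size Th ^+ l.+1)
  g0 n0 h0 m0 => g n h m g0 n0 h0 m0 le.
have le' : n <= C * (m * h) by move: le g0; lra.
apply: (@le_trans _ _ ((C * (m * h)) ^+ 2)).
  by rewrite ler_pXn2r// nnegrE// mulr_ge0// mulr_ge0.
by rewrite !exprMn mulrA.
Qed.

End Projections.
End FiniteElements.

(** * The variational equations at the nodes *)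

Section NodalEquations.
Context {R : realType} {d : nat}.
Local Notation scal := ('rV[R]_d -> R).
Local Notation vec := ('I_d -> 'rV[R]_d -> R).
Variables (Omega Gammad : set 'rV[R]_d) (P : medium R d) (km kM thm thM tau : R).
Variables (k l : nat) (u0 : vec) (p0 T0 : scal) (f : R -> vec) (g Hs : R -> scal).
Variables (u : trajectory vec) (xi p T : trajectory scal).
Hypotheses (dO : domain Omega) (tau0 : 0 < tau) (km0 : 0 < km) (thm0 : 0 < thm).
Hypotheses (spdK : spd_tensor Omega (perm P) km kM) (spdT : spd_tensor Omega (cond P) thm thM).
Hypotheses (cf : time_continuous tau (vL2 Omega) (vL2norm Omega) f)
  (cg : time_continuous tau (L2 Omega) (L2norm Omega) g)
  (cH : time_continuous tau (L2 Omega) (L2norm Omega) Hs).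
Hypothesis sol : vp_solution Omega Gammad P tau u0 p0 T0 f g Hs u xi p T.
Hypothesis reg : regular_solution Omega Gammad tau k l u xi p T.

Local Notation V := (vH1_0 Omega Gammad).
Local Notation W := (H1_0 Omega (boundary Omega)).
Local Notation Q := (L2 Omega).
Local Notation la := (lambda P).
Local Notation al := (alpha P).
Local Notation be := (beta P).
Local Notation iL2 := (semi_inner_L2 dO).
Local Notation iS := (semi_inner_strain_form dO).
Local Notation iK := (semi_inner_diff_form dO km0 spdK).
Local Notation iT := (semi_inner_diff_form dO thm0 spdT).

Lemma subspace_Vk : subspace (V `&` vsobolev Omega k.+1).
Proof. by apply: subspace_setI; [exact: subspace_vH1_0|exact: subspace_vsobolev]. Qed.

Lemma subspace_Wl : subspace (W `&` sobolev Omega l.+1).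
Proof. by apply: subspace_setI; [exact: subspace_H1_0|exact: subspace_sobolev]. Qed.

Lemma u_level t : 0 <= t <= tau -> V (u t) /\ vsobolev Omega k.+1 (u t).
Proof. by move=> tt; case: reg => -[_ _ _ [h _] _] _ _ _; have [] := h t tt. Qed.

Lemma xi_level t : 0 <= t <= tau -> sobolev Omega k (xi t).
Proof. by move=> tt; case: reg => _ [_ _ _ [h _] _] _ _; exact: h. Qed.

Lemma p_level t : 0 <= t <= tau -> W (p t) /\ sobolev Omega l.+1 (p t).
Proof. by move=> tt; case: reg => _ _ [_ _ _ [h _] _] _; have [] := h t tt. Qed.

Lemma T_level t : 0 <= t <= tau -> W (T t) /\ sobolev Omega l.+1 (T t).
Proof. by move=> tt; case: reg => _ _ _ [_ _ _ [h _] _]; have [] := h t tt. Qed.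

(** The equations hold for almost every time. Both sides are continuous in time
    when the test function is fixed, so they hold at every node. *)
Lemma continuous_u (lf : vec -> R) :
  (forall (a : R) x y, vsobolev Omega 1 x -> vsobolev Omega 1 y ->
     lf (a *: x + y) = a * lf x + lf y) ->
  (exists K, forall x, vsobolev Omega k.+1 x -> `|lf x| <= K * vHnorm Omega k.+1 x) ->
  continuous_upto tau (fun t => lf (u t)).
Proof.
move=> lin [K lK]; case: reg => -[_ Lw _ dw _] _ _ _.
apply: (@continuous_upto_functional _ _ tau _ (vHform Omega k.+1)
  (vHnorm Omega k.+1) u (traj_t u) subspace_Vk _ Lw dw lf tau0).
- by move=> x [_ sx]; exact: vHnormE.
- by move=> a x y [/vH1_0_vsobolev sx _] [/vH1_0_vsobolev sy _]; exact: lin.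
- by exists K => x [_ sx]; exact: lK.
Qed.

Lemma continuous_xi (z : scal) : L2 Omega z ->
  continuous_upto tau (fun t => inner Omega (xi t) z).
Proof.
move=> Lz; case: reg => _ [_ Lw _ dw _] _ _.
apply: (@continuous_upto_functional _ _ tau _ (Hform Omega k)
  (Hnorm Omega k) xi (traj_t xi) (subspace_sobolev dO k) _ Lw dw
  (fun x => inner Omega x z) tau0) => //.
- by move=> x _; rewrite HnormE.
- by move=> a x y /sobolev_L2 Lx /sobolev_L2 Ly; exact: (sip_lin iL2 Lz).
- exists (L2norm Omega z) => x sx.
  apply: le_trans (inner_cauchy_schwarz dO (sobolev_L2 sx) Lz) _; rewrite mulrC.
  by apply: ler_wpM2l; [exact: L2norm_ge0|exact: L2norm_le_Hnorm].
Qed.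

Lemma continuous_fluid (w : trajectory scal) (lf : scal -> R) :
  regular tau (W `&` sobolev Omega l.+1) (Hnorm Omega l.+1) Q (L2norm Omega) w ->
  (forall (a : R) x y, sobolev Omega 1 x -> sobolev Omega 1 y ->
     lf (a *: x + y) = a * lf x + lf y) ->
  (exists K, forall x, sobolev Omega l.+1 x -> `|lf x| <= K * Hnorm Omega l.+1 x) ->
  continuous_upto tau (fun t => lf (w t)).
Proof.
move=> [_ Lw _ dw _] lin [K lK].
apply: (@continuous_upto_functional _ _ tau _ (Hform Omega l.+1)
  (Hnorm Omega l.+1) w (traj_t w) subspace_Wl _ Lw dw lf tau0).
- by move=> x _; rewrite HnormE.
- by move=> a x y [/H1_0_sobolev sx _] [/H1_0_sobolev sy _]; exact: lin.
- by exists K => x [_ sx]; exact: lK.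
Qed.

Lemma continuous_fluid_inner (w : trajectory scal) (z : scal) :
  regular tau (W `&` sobolev Omega l.+1) (Hnorm Omega l.+1) Q (L2norm Omega) w ->
  L2 Omega z -> continuous_upto tau (fun t => inner Omega (w t) z).
Proof.
move=> rw Lz; apply: (continuous_fluid (lf := fun x => inner Omega x z) rw).
  by move=> a x y /sobolev_L2 Lx /sobolev_L2 Ly; exact: (sip_lin iL2 Lz).
exists (L2norm Omega z) => x sx.
apply: le_trans (inner_cauchy_schwarz dO (sobolev_L2 sx) Lz) _; rewrite mulrC.
by apply: ler_wpM2l; [exact: L2norm_ge0|exact: L2norm_le_Hnorm].
Qed.

Lemma continuous_rate (X : set scal) (nX : scal -> R) (w : trajectory scal) (z : scal) :
  regular tau X nX Q (L2norm Omega) w -> L2 Omega z ->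
  continuous_upto tau (fun t => inner Omega (traj_t w t) z).
Proof.
move=> [_ _ Lw _ dw] Lz.
apply: (@continuous_upto_functional _ _ tau Q (inner Omega) (L2norm Omega)
  (traj_t w) (traj_tt w) (subspace_L2 dO) _ Lw dw (fun x => inner Omega x z) tau0) => //.
- by move=> a x y Lx Ly; exact: (sip_lin iL2 Lz).
- exists (L2norm Omega z) => x Lx; rewrite mulrC; exact: inner_cauchy_schwarz.
Qed.

Lemma continuous_source (w : R -> scal) (z : scal) :
  time_continuous tau (L2 Omega) (L2norm Omega) w -> L2 Omega z ->
  continuous_upto tau (fun t => inner Omega (w t) z).
Proof.
move=> cw Lz; apply: (continuous_upto_time (K := L2norm Omega z) cw) => s t ss tt.
have Ls := (cw s ss).1; have Lt := (cw t tt).1.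
rewrite -(formB (sip_lin iL2 Lz) Ls Lt) mulrC.
by apply: (inner_cauchy_schwarz dO _ Lz); exact: (subspaceB (subspace_L2 dO)).
Qed.

Lemma continuous_force (v : vec) : vL2 Omega v ->
  continuous_upto tau (fun t => vinner Omega (f t) v).
Proof.
move=> Lv; have iv := semi_inner_vector iL2.
apply: (continuous_upto_time (K := vL2norm Omega v) cf) => s t ss tt.
have Ls := (cf ss).1; have Lt := (cf tt).1.
have := formB (sip_lin iv Lv) Ls Lt; rewrite -/(vinner _ _ _) => <-.
rewrite mulrC.
apply: (cauchy_schwarz iv _ Lv); apply: (subspaceB _ Ls Lt); by case: iv.
Qed.

Lemma nodal_elasticity t v : 0 <= t <= tau -> V v ->
  2 * mu P * strain_form Omega (u t) v - inner Omega (div Omega v) (xi t)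
  = vinner Omega (f t) v.
Proof.
move=> tt Vv; have sv := vH1_0_vsobolev Vv; have Ld := L2_div dO sv.
apply/eqP; rewrite -subr_eq0; apply/eqP.
apply: (@continuous_upto_ae0 _ tau tau0 (fun t => 2 * mu P * strain_form Omega (u t) v -
  inner Omega (div Omega v) (xi t) - vinner Omega (f t) v)) tt.
- apply: continuous_uptoB; first apply: continuous_uptoB.
  + apply: continuous_uptoZ.
    apply: (continuous_u (lf := fun x => strain_form Omega x v)).
      by move=> a x y sx sy; exact: (sip_lin iS sv).
    exact: strain_form_bounded.
  + have -> : (fun t => inner Omega (div Omega v) (xi t)) =
        (fun t => inner Omega (xi t) (div Omega v)).
      apply/funext => s; apply: eq_Rintegral => x _; exact: mulrC.
    exact: continuous_xi.
  + by apply: continuous_force => i; exact: sobolev_L2 (sv i).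
- have [s1 _] := sol; apply: (@filterS _ _ (ae_filter_ringOfSetsType (@lebesgue_measure R)) _ _ _ s1) => s /= h s0.
  have [_ H] := h s0.
  have [e _ _ _] := H v 0 0 0 Vv (subspace_L2 dO).1 (subspace_H1_0 dO _).1
    (subspace_H1_0 dO _).1.
  by rewrite e subrr.
Qed.

Lemma nodal_constraint t phi : 0 <= t <= tau -> Q phi ->
  inner Omega (div Omega (u t)) phi + la^-1 * inner Omega (xi t) phi
  - al / la * inner Omega (p t) phi - be / la * inner Omega (T t) phi = 0.
Proof.
move=> tt Lphi; case: (reg) => _ _ rp rT.
apply: (@continuous_upto_ae0 _ tau tau0 (fun t => inner Omega (div Omega (u t)) phi +
  la^-1 * inner Omega (xi t) phi - al / la * inner Omega (p t) phi -
  be / la * inner Omega (T t) phi)) tt.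
- apply: continuous_uptoB; first apply: continuous_uptoB; first apply: continuous_uptoD.
  + apply: (continuous_u (lf := fun x => inner Omega (div Omega x) phi)).
      by move=> a x y sx sy; exact: (seen_linear_div dO).2.
    exact: div_bounded.
  + by apply: continuous_uptoZ; exact: continuous_xi.
  + by apply: continuous_uptoZ; exact: continuous_fluid_inner.
  + by apply: continuous_uptoZ; exact: continuous_fluid_inner.
- have [s1 _] := sol; apply: (@filterS _ _ (ae_filter_ringOfSetsType (@lebesgue_measure R)) _ _ _ s1) => s /= h s0.
  have [_ H] := h s0.
  have [_ e _ _] := H 0 phi 0 0 (subspace_vH1_0 dO _).1 Lphi (subspace_H1_0 dO _).1
    (subspace_H1_0 dO _).1.
  have neg (a b c e' : R) : - a - b + c + e' = 0 -> a + b - c - e' = 0 by lra.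
  exact: neg e.
Qed.

Lemma nodal_pressure t q : 0 <= t <= tau -> W q ->
  - (al / la) * inner Omega (traj_t xi t) q + c_alpha P * inner Omega (traj_t p t) q
  + c_alphabeta P * inner Omega (traj_t T t) q + diff_form Omega (perm P) (p t) q
  = inner Omega (g t) q.
Proof.
move=> tt Wq; have sq := H1_0_sobolev Wq; have Lq := sobolev_L2 sq.
case: (reg) => _ rx rp rT; apply/eqP; rewrite -subr_eq0; apply/eqP.
apply: (@continuous_upto_ae0 _ tau tau0 (fun t => - (al / la) * inner Omega (traj_t xi t) q +
  c_alpha P * inner Omega (traj_t p t) q + c_alphabeta P * inner Omega (traj_t T t) q +
  diff_form Omega (perm P) (p t) q - inner Omega (g t) q)) tt.
- apply: continuous_uptoB; last exact: continuous_source.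
  apply: continuous_uptoD; first apply: continuous_uptoD; first apply: continuous_uptoD.
  + by apply: continuous_uptoZ; exact: continuous_rate rx Lq.
  + by apply: continuous_uptoZ; exact: continuous_rate rp Lq.
  + by apply: continuous_uptoZ; exact: continuous_rate rT Lq.
  + apply: (continuous_fluid (lf := fun x => diff_form Omega (perm P) x q) rp).
      by move=> a x y sx sy; exact: (sip_lin iK sq).
    exact: (diff_form_bounded dO spdK).
- have [s1 _] := sol; apply: (@filterS _ _ (ae_filter_ringOfSetsType (@lebesgue_measure R)) _ _ _ s1) => s /= h s0.
  have [_ H] := h s0.
  have [_ _ e _] := H 0 0 q 0 (subspace_vH1_0 dO _).1 (subspace_L2 dO).1 Wq
    (subspace_H1_0 dO _).1.
  by rewrite e subrr.
Qed.

Lemma nodal_temperature t q : 0 <= t <= tau -> W q ->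
  - (be / la) * inner Omega (traj_t xi t) q + c_alphabeta P * inner Omega (traj_t p t) q
  + c_beta P * inner Omega (traj_t T t) q + diff_form Omega (cond P) (T t) q
  = inner Omega (Hs t) q.
Proof.
move=> tt Wq; have sq := H1_0_sobolev Wq; have Lq := sobolev_L2 sq.
case: (reg) => _ rx rp rT; apply/eqP; rewrite -subr_eq0; apply/eqP.
apply: (@continuous_upto_ae0 _ tau tau0 (fun t => - (be / la) * inner Omega (traj_t xi t) q +
  c_alphabeta P * inner Omega (traj_t p t) q + c_beta P * inner Omega (traj_t T t) q +
  diff_form Omega (cond P) (T t) q - inner Omega (Hs t) q)) tt.
- apply: continuous_uptoB; last exact: continuous_source.
  apply: continuous_uptoD; first apply: continuous_uptoD; first apply: continuous_uptoD.
  + by apply: continuous_uptoZ; exact: continuous_rate rx Lq.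
  + by apply: continuous_uptoZ; exact: continuous_rate rp Lq.
  + by apply: continuous_uptoZ; exact: continuous_rate rT Lq.
  + apply: (continuous_fluid (lf := fun x => diff_form Omega (cond P) x q) rT).
      by move=> a x y sx sy; exact: (sip_lin iT sq).
    exact: (diff_form_bounded dO spdT).
- have [s1 _] := sol; apply: (@filterS _ _ (ae_filter_ringOfSetsType (@lebesgue_measure R)) _ _ _ s1) => s /= h s0.
  have [_ H] := h s0.
  have [_ _ _ e] := H 0 0 0 q (subspace_vH1_0 dO _).1 (subspace_L2 dO).1
    (subspace_H1_0 dO _).1 Wq.
  by rewrite e subrr.
Qed.

End NodalEquations.

(** * Consistency of the time stepping *)

Section Consistency.
Context {R : realType} {E : lmodType R}.
Variables (H W : set E) (ip : E -> E -> R).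
Hypotheses (sip : semi_inner H ip) (WH : W `<=` H).
Local Notation N := (semi_norm ip).
Let sH : subspace H. Proof. by case: sip. Qed.

(** The scheme subtracted from the exact equation at the new level. The
    projections may replace the exact increments because the elliptic
    projection leaves the diffusion term unchanged. *)
Lemma error_step (l a : E -> R) (c1 c2 c3 dt gq : R)
    (P P' p p' pt S S' s s' st X X' x x' xt w : E) :
  (forall (b : R) y z, H y -> H z -> l (b *: y + z) = b * l y + l z) ->
  (forall (b : R) y z, W y -> W z -> a (b *: y + z) = b * a y + a z) ->
  [/\ H P, W P', H p, W p' & H pt] -> [/\ H S, H S', H s, H s' & H st] ->
  [/\ H X, H X', H x, H x' & H xt] ->
  c1 * l (p' - p) + c2 * l (s' - s) + dt * a p' - c3 * l (x' - x) = dt * gq ->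
  c1 * l pt + c2 * l st - c3 * l xt + a w = gq -> a P' = a w ->
  c1 * l (P' - p' - (P - p)) + c2 * l (S' - s' - (S - s)) + dt * a (P' - p')
  - c3 * l (X' - x' - (X - x)) =
  l (c1 *: (P' - P - dt *: pt) + c2 *: (S' - S - dt *: st) - c3 *: (X' - X - dt *: xt)).
Proof.
move=> ll la [HP WP Hp Wp Hpt] [HS HS' Hs Hs' Hst] [HX HX' Hx Hx' Hxt] scheme exact proj.
have HP' := WH WP; have Hp' := WH Wp.
have lB y z : H y -> H z -> l (y - z) = l y - l z by move=> Hy Hz; exact: (formB ll Hy Hz).
have lZ c y : H y -> l (c *: y) = c * l y by move=> Hy; exact: (formZ sH ll c Hy).
have HB y z : H y -> H z -> H (y - z) by exact: (subspaceB sH).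
have HZ c y : H y -> H (c *: y) by exact: (subspaceZ sH).
have dE (y' y0 z' z0 : E) : H y' -> H y0 -> H z' -> H z0 ->
    l (y' - z' - (y0 - z0)) = l y' - l z' - (l y0 - l z0).
  by move=> h1 h2 h3 h4; rewrite (lB _ _ (HB _ _ h1 h3) (HB _ _ h2 h4)) !lB.
have rE c (y' y0 z : E) : H y' -> H y0 -> H z ->
    H (c *: (y' - y0 - dt *: z)) /\
    l (c *: (y' - y0 - dt *: z)) = c * (l y' - l y0 - dt * l z).
  move=> h1 h2 h3; have h4 := HB _ _ (HB _ _ h1 h2) (HZ dt _ h3); split; first exact: HZ.
  by rewrite (lZ _ _ h4) (lB _ _ (HB _ _ h1 h2) (HZ dt _ h3)) (lB _ _ h1 h2) (lZ _ _ h3).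
have [hp ep] := rE c1 _ _ _ HP' HP Hpt; have [hs es] := rE c2 _ _ _ HS' HS Hst.
have [hx ex] := rE c3 _ _ _ HX' HX Hxt.
rewrite (lB _ _ (subspaceD sH hp hs) hx) (formD ll hp hs) ep es ex.
rewrite !dE// (formB la WP Wp) proj.
move: scheme; rewrite !lB// -exact; lra.
Qed.

Lemma sqr_addr3_le (a b c : R) : (a + b + c) ^+ 2 <= 3 * (a ^+ 2 + b ^+ 2 + c ^+ 2).
Proof.
have h1 := sqr_ge0 (a - b); have h2 := sqr_ge0 (a - c); have h3 := sqr_ge0 (b - c).
by move: h1 h2 h3; rewrite !expr2; lra.
Qed.

Lemma semi_norm_comb3 (a b c : R) x y z : H x -> H y -> H z ->
  ip (a *: x + b *: y - c *: z) (a *: x + b *: y - c *: z) <=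
  3 * (a ^+ 2 * N x ^+ 2 + b ^+ 2 * N y ^+ 2 + c ^+ 2 * N z ^+ 2).
Proof.
move=> Hx Hy Hz.
have hx := subspaceZ sH a Hx; have hy := subspaceZ sH b Hy; have hz := subspaceZ sH c Hz.
have hxy := subspaceD sH hx hy; have hw := subspaceB sH hxy hz.
rewrite -(semi_norm_sqr sip hw).
have := semi_normB sip hxy hz; have := semi_normD sip hx hy.
rewrite (semi_normZ sip a Hx) (semi_normZ sip b Hy) (semi_normZ sip c Hz) => h1 h2.
have n0 := semi_norm_ge0 ip (a *: x + b *: y - c *: z).
apply: (@le_trans _ _ ((`|a| * N x + `|b| * N y + `|c| * N z) ^+ 2)).
  have h3 : N (a *: x + b *: y - c *: z) <= `|a| * N x + `|b| * N y + `|c| * N z.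
    by apply: le_trans h2 _; rewrite lerD2r.
  by rewrite ler_pXn2r// nnegrE (le_trans n0 h3).
by apply: le_trans (sqr_addr3_le _ _ _) _; rewrite !exprMn !real_normK ?num_real.
Qed.

Lemma semi_norm_split x y z : H (x - y) -> H (y - z) ->
  N (x - z) ^+ 2 <= 2 * (N (x - y) ^+ 2 + N (y - z) ^+ 2).
Proof.
move=> h1 h2; have := semi_normD sip h1 h2; rewrite subrKA => le.
have n0 := semi_norm_ge0 ip (x - z).
apply: (@le_trans _ _ ((N (x - y) + N (y - z)) ^+ 2)).
  by rewrite ler_pXn2r// nnegrE (le_trans n0 le).
move: (N (x - y)) (N (y - z)) => a b; have := sqr_ge0 (a - b); rewrite !expr2; lra.
Qed.

End Consistency.

(** Sums of the increments of a nondecreasing sequence, with and without the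
    time lag of the scheme, which makes a step count at most twice. *)
Lemma increment_sum {R : realType} (e : nat -> R) (B : R) (N : nat) :
  e 0%N = 0 -> (forall n, (n <= N)%N -> e n <= e n.+1) -> e N.+1 <= B ->
  [/\ \sum_(n < N.+1) (e n.+1 - e n) <= B,
      \sum_(n < N.+1) (e n.-1.+1 - e n.-1) <= 2 * B &
      \sum_(n < N.+1) (e n.+1 - e n.-1) <= 2 * B].
Proof.
move=> e0 nd eB.
have tel n : \sum_(k < n) (e k.+1 - e k) = e n.
  by rewrite -(big_mkord xpredT (fun k => e k.+1 - e k)) telescope_sumr// e0 subr0.
have e1 : e 1%N <= e N.+1.
  have : forall n, (n <= N)%N -> e 1%N <= e n.+1.
    by elim=> [//|n ih nN]; apply: le_trans (ih (ltnW nN)) (nd _ nN).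
  exact.
have eN := nd N (leqnn N).
have lag : \sum_(n < N.+1) (e n.+1 - e n.-1) = e N.+1 + e N.
  have -> : \sum_(n < N.+1) (e n.+1 - e n.-1) =
      \sum_(n < N.+1) ((e n.+1 - e n) + (e n - e n.-1)).
    by apply: eq_bigr => n _; rewrite subrKA.
  by rewrite big_split/= tel [X in _ + X]big_ord_recl/= subrr add0r tel.
split; first by rewrite tel.
- by rewrite big_ord_recl /= e0 tel; lra.
- by rewrite lag; lra.
Qed.

(** * Collecting the constants *)

(** Dominates the squares of all the coefficients of the defects. *)
Definition defect_weight {R : realType} (al be la a0 b0 c0 : R) : R :=
  1 + (c0 + al ^+ 2 / la) ^+ 2 + (al * be / la - b0) ^+ 2 + (a0 + be ^+ 2 / la) ^+ 2 +
  (la^-1 ^+ 2 + (al / la) ^+ 2 + (be / la) ^+ 2).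

Lemma defect_weight_ge {R : realType} (al be la a0 b0 c0 : R) :
  let q := defect_weight al be la a0 b0 c0 in
  [/\ 0 <= q, la^-1 ^+ 2 <= q, (al / la) ^+ 2 <= q & (be / la) ^+ 2 <= q] /\
  [/\ (c0 + al ^+ 2 / la) ^+ 2 <= q, (al * be / la - b0) ^+ 2 <= q &
      (a0 + be ^+ 2 / la) ^+ 2 <= q].
Proof.
rewrite /defect_weight /=; move: (sqr_ge0 (c0 + al ^+ 2 / la)) (sqr_ge0 (al * be / la - b0))
  (sqr_ge0 (a0 + be ^+ 2 / la)) (sqr_ge0 la^-1) (sqr_ge0 (al / la)) (sqr_ge0 (be / la)).
move: (_ ^+ 2) (_ ^+ 2) (_ ^+ 2) (_ ^+ 2) (_ ^+ 2) (_ ^+ 2) => a b c d e f *.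
by split; split; lra.
Qed.

Lemma stability_const_ge0 {R : realType} (al be la a0 b0 c0 : R) :
  0 < al -> 0 < be -> 0 < la -> b0 < a0 -> b0 < c0 ->
  0 <= stability_const al be la a0 b0 c0.
Proof.
move=> al0 be0 la0 ba bc; rewrite /stability_const.
have m00 : 0 < Num.min (c0 - b0) (a0 - b0) by rewrite lt_min !subr_gt0 bc.
move: (Num.min _ _) m00 => m m0.
have s0 : 0 < 2 * (al ^+ 2 + be ^+ 2) by rewrite mulr_gt0// addr_gt0// exprn_gt0.
move: (2 * _) s0 => s s0.
have k0 : 0 < (3 + s / (la * m)) * (2 * (s / m + la / 2) + m^-1).
  by rewrite mulr_gt0// addr_gt0// ?invr_gt0// ?divr_gt0// mulr_gt0// addr_gt0// divr_gt0.
move: (_ * (2 * _ + _)) k0 => K K0.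
have kx0 : 0 < 2 / m * K by rewrite mulr_gt0// divr_gt0.
move: (2 / m * K) kx0 => Kx Kx0.
have c1 : 0 < c0 - b0 by rewrite subr_gt0.
have c2 : 0 < a0 - b0 by rewrite subr_gt0.
move: (c0 - b0) (a0 - b0) c1 c2 => x y x0 y0; apply: ltW.
by do ?[apply: addr_gt0 | apply: divr_gt0 | apply: mulr_gt0] => //; rewrite invr_gt0 mulr_gt0.
Qed.

(** Three summands in each of the three defects give the factor 3, splitting a
    summand in two the factor 6; a fluid projection error occurs once in the
    constraint and once in each of the two equations, whence 15. *)
Lemma defect_le {R : realType} (q i1 i2 i3 c1 c2 c3 a a' b c e e' f Dr Dp DT sp sT sx : R) :
  [/\ i1 ^+ 2 <= q, i2 ^+ 2 <= q & i3 ^+ 2 <= q] ->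
  [/\ c1 ^+ 2 <= q, c2 ^+ 2 <= q & c3 ^+ 2 <= q] ->
  [/\ 0 <= q, 0 <= a, 0 <= a', 0 <= b & 0 <= c] -> [/\ 0 <= e, 0 <= e' & 0 <= f] ->
  [/\ 0 <= sp, 0 <= sT & 0 <= sx] ->
  Dr <= 3 * (i1 ^+ 2 * a + i2 ^+ 2 * b + i3 ^+ 2 * c) ->
  Dp <= 3 * (c1 ^+ 2 * sp + c2 ^+ 2 * sT + i2 ^+ 2 * sx) ->
  DT <= 3 * (c3 ^+ 2 * sT + c2 ^+ 2 * sp + i3 ^+ 2 * sx) ->
  sp <= 2 * (b + e) -> sT <= 2 * (c + e') -> sx <= 2 * (a' + f) ->
  Dr + (Dp + DT) <= 15 * q * (a + a' + b + c + e + e' + f).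
Proof.
move=> [i1q i2q i3q] [c1q c2q c3q] [q0 a0 a0' b0 c0] [e0 e0' f0] [sp0 sT0 sx0].
move=> hr hp hT hsp hsT hsx.
have := ler_wpM2r a0 i1q; have := ler_wpM2r b0 i2q; have := ler_wpM2r c0 i3q.
have := ler_wpM2r sp0 c1q; have := ler_wpM2r sT0 c2q; have := ler_wpM2r sx0 i2q.
have := ler_wpM2r sT0 c3q; have := ler_wpM2r sp0 c2q; have := ler_wpM2r sx0 i3q.
have := ler_wpM2l q0 hsp; have := ler_wpM2l q0 hsT; have := ler_wpM2l q0 hsx.
have := mulr_ge0 q0 a0; have := mulr_ge0 q0 a0'; have := mulr_ge0 q0 b0.
have := mulr_ge0 q0 c0; have := mulr_ge0 q0 e0; have := mulr_ge0 q0 e0'.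
have := mulr_ge0 q0 f0; move: hr hp hT; lra.
Qed.

(** The sums of lagged increments are at most twice the total, so the total
    pressure contributes three times: once through the constraint and twice
    through the lag. *)
Lemma weighted_sum_le {R : realType} (N : nat) (A B s : R)
    (du dx du' dx' dp dT gp gT gx : nat -> R) (bu bx bp bT bgp bgT bgx : R) :
  0 <= A -> 0 <= B -> 0 <= s ->
  \sum_(n < N) du n <= bu -> \sum_(n < N) dx n <= bx ->
  \sum_(n < N) du' n <= 2 * bu -> \sum_(n < N) dx' n <= 2 * bx ->
  \sum_(n < N) dp n <= bp -> \sum_(n < N) dT n <= bT ->
  \sum_(n < N) gp n <= bgp -> \sum_(n < N) gT n <= bgT ->
  \sum_(n < N) gx n <= 2 * bgx ->
  \sum_(n < N) (A * (s * du n + s * dx n) + A * (s * du' n + s * dx' n)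
    + B * (s * dp n) + B * (s * dT n) + s ^+ 2 * (s * gp n) + s ^+ 2 * (s * gT n)
    + s ^+ 2 * (2 * s * gx n)) <=
  s * (3 * A * (bu + bx) + B * (bp + bT) + s ^+ 2 * (bgp + bgT + 4 * bgx)).
Proof.
move=> A0 B0 s0 hu hx hu' hx' hp hT hgp hgT hgx.
rewrite !big_split/= -!mulr_sumr !big_split/= -!mulr_sumr.
have sA := mulr_ge0 A0 s0; have sB := mulr_ge0 B0 s0; have s3 := mulr_ge0 (sqr_ge0 s) s0.
have := ler_wpM2l sA hu; have := ler_wpM2l sA hx; have := ler_wpM2l sA hu'.
have := ler_wpM2l sA hx'; have := ler_wpM2l sB hp; have := ler_wpM2l sB hT.
have := ler_wpM2l s3 hgp; have := ler_wpM2l s3 hgT; have := ler_wpM2l s3 hgx.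
lra.
Qed.

(** The n steps of length s fit into the time interval; 6 C^2 and 4 dominate the
    weights of the projection errors and of the Taylor remainders. *)
Lemma assemble_constant {R : realType} (St q C tau s n h1 h2 bu bx bp bT gp gT gx S L : R) :
  0 <= St -> 0 <= q -> 0 <= s -> 0 <= n -> n * s <= tau ->
  [/\ 0 <= h1, 0 <= h2 & 0 <= bu + bx] -> [/\ 0 <= bp + bT, 0 <= gp, 0 <= gT & 0 <= gx] ->
  S <= 15 * q * (s * (3 * (2 * C ^+ 2 * h1) * (bu + bx) + C ^+ 2 * h2 * (bp + bT)
    + s ^+ 2 * (gp + gT + 4 * gx))) ->
  L <= St * (n * S) ->
  L <= St * tau * (15 * q * (6 * C ^+ 2 + 4)) *
    (h1 * (bu + bx) + h2 * (bp + bT) + s ^+ 2 * (gp + gT + gx)).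
Proof.
move=> St0 q0 s0 n0 ntau [h10 h20 u0] [p0 gp0 gT0 gx0] hS hL; apply: (le_trans hL).
set Y := h1 * (bu + bx) + _ + _; set K := 6 * C ^+ 2 + 4.
rewrite -!mulrA; apply: ler_wpM2l => //.
have C2 := sqr_ge0 C.
have Y0 : 0 <= Y.
  have g0 : 0 <= gp + gT + gx by rewrite !addr_ge0.
  apply: addr_ge0; last exact: mulr_ge0 (sqr_ge0 s) g0.
  exact: addr_ge0 (mulr_ge0 h10 u0) (mulr_ge0 h20 p0).
have X0 : 15 * q * (s * (3 * (2 * C ^+ 2 * h1) * (bu + bx) + C ^+ 2 * h2 * (bp + bT)
    + s ^+ 2 * (gp + gT + 4 * gx))) <= 15 * q * (s * (K * Y)).
  apply: ler_wpM2l; first by rewrite mulr_ge0.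
  apply: ler_wpM2l => //; rewrite /K /Y.
  have a1 := mulr_ge0 h10 u0; have a2 := mulr_ge0 h20 p0.
  have s2 := sqr_ge0 s.
  have a3 := mulr_ge0 s2 gp0; have a4 := mulr_ge0 s2 gT0; have a5 := mulr_ge0 s2 gx0.
  have := mulr_ge0 C2 a1; have := mulr_ge0 C2 a2; have := mulr_ge0 C2 a3.
  have := mulr_ge0 C2 a4; have := mulr_ge0 C2 a5; move: a1 a2 a3 a4 a5; lra.
have K0 : 0 <= K by rewrite /K; lra.
have := ler_wpM2l n0 (le_trans hS X0) => /le_trans; apply.
have -> : n * (15 * q * (s * (K * Y))) = n * s * (15 * q * (K * Y)) by ring.
have -> : tau * (15 * (q * (K * Y))) = tau * (15 * q * (K * Y)) by ring.
by apply: ler_wpM2r ntau; apply: mulr_ge0; apply: mulr_ge0.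
Qed.

(** * The error equations and their residuals *)

Lemma comb3B {R : realType} {E : lmodType R} (a b c : R) (x y z x' y' z' : E) :
  a *: x' + b *: y' - c *: z' - (a *: x + b *: y - c *: z) =
  a *: (x' - x) + b *: (y' - y) - c *: (z' - z).
Proof.
rewrite !scalerBr !opprB opprD [c *: z + _]addrC addrACA [- (c *: z') + _]addrC.
by rewrite [a *: x' + _ + _]addrACA.
Qed.

Section Errors.
Context {R : realType} {d : nat}.
Local Notation scal := ('rV[R]_d -> R).
Local Notation vec := ('I_d -> 'rV[R]_d -> R).
Variables (Omega Gammad : set 'rV[R]_d) (P : medium R d) (km kM thm thM tau CPi : R).
Variables (k l : nat) (Th : seq 'M[R]_(d.+1, d)) (u0 : vec) (p0 T0 : scal).
Variables (f : R -> vec) (g Hs : R -> scal) (u : trajectory vec) (xi p T : trajectory scal).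
Hypotheses (dO : domain Omega) (tau0 : 0 < tau) (km0 : 0 < km) (thm0 : 0 < thm).
Hypotheses (spdK : spd_tensor Omega (perm P) km kM) (spdT : spd_tensor Omega (cond P) thm thM).
Hypotheses (adm : admissible P) (CPi0 : 0 <= CPi).
Hypotheses (bndS : stokes_projection_bound Omega Gammad P Th k CPi)
  (bndK : elliptic_projection_bound Omega Th l (perm P) CPi)
  (bndT : elliptic_projection_bound Omega Th l (cond P) CPi).
Hypotheses (cf : time_continuous tau (vL2 Omega) (vL2norm Omega) f)
  (cg : time_continuous tau (L2 Omega) (L2norm Omega) g)
  (cH : time_continuous tau (L2 Omega) (L2norm Omega) Hs).
Hypothesis sol : vp_solution Omega Gammad P tau u0 p0 T0 f g Hs u xi p T.
Hypothesis reg : regular_solution Omega Gammad tau k l u xi p T.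
Variables (M : nat) (uh Piu : nat -> vec) (xih Pixi ph Pip Th_ PiT : nat -> scal).
Local Notation dt := (tau / M%:R).
Local Notation t n := (n%:R * dt).
Hypothesis M1 : (1 <= M)%N.
Hypothesis init : discrete_initial_value Omega Gammad P Th k l
    (u 0) (xi 0) (p 0) (T 0) (uh 0%N) (xih 0%N) (ph 0%N) (Th_ 0%N).
Hypothesis first : coupled_step Omega Gammad P Th k l dt (f (t 1%N)) (g (t 1%N)) (Hs (t 1%N))
    (xih 0%N) (ph 0%N) (Th_ 0%N) (uh 1%N) (xih 1%N) (ph 1%N) (Th_ 1%N).
Hypothesis later : forall n, (1 <= n)%N -> (n.+1 <= M)%N ->
    decoupled_step Omega Gammad P Th k l dt (f (t n.+1)) (g (t n.+1)) (Hs (t n.+1))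
      (xih n.-1) (xih n) (ph n) (Th_ n) (uh n.+1) (xih n.+1) (ph n.+1) (Th_ n.+1).
Hypothesis proj : forall n, (n <= M)%N ->
    [/\ stokes_projection Omega Gammad P Th k (u (t n)) (xi (t n)) (Piu n) (Pixi n),
        elliptic_projection Omega Th l (perm P) (p (t n)) (Pip n) &
        elliptic_projection Omega Th l (cond P) (T (t n)) (PiT n)].

Local Notation V := (vH1_0 Omega Gammad).
Local Notation W := (H1_0 Omega (boundary Omega)).
Local Notation Vh := (fe_V Omega Gammad Th k).
Local Notation Qh := (fe_Q Omega Th k).
Local Notation Wh := (fe_W Omega Th l).
Local Notation la := (lambda P).
Local Notation al := (alpha P).
Local Notation be := (beta P).
Local Notation iL2 := (semi_inner_L2 dO).
Local Notation iS := (semi_inner_strain_form dO).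
Local Notation iK := (semi_inner_diff_form dO km0 spdK).
Local Notation iT := (semi_inner_diff_form dO thm0 spdT).
Local Notation inn := (inner Omega).

Lemma dt_gt0 : 0 < dt. Proof. by rewrite divr_gt0// ltr0n. Qed.

Lemma node0 : t 0%N = 0. Proof. exact: mul0r. Qed.

Lemma node_ge0 n : 0 <= t n. Proof. by rewrite mulr_ge0// ltW// dt_gt0. Qed.

Lemma node_le m n : (m <= n)%N -> t m <= t n.
Proof. by move=> mn; rewrite ler_pM2r ?dt_gt0// ler_nat. Qed.

Lemma node_le_tau n : (n <= M)%N -> t n <= tau.
Proof.
move=> nM; rewrite mulrCA ger_pMr// ler_pdivrMr ?ltr0n// mul1r ler_nat//.
Qed.

Lemma node_in n : (n <= M)%N -> 0 <= t n <= tau.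
Proof. by move=> nM; rewrite node_ge0 node_le_tau. Qed.

Lemma nodeS n : t n.+1 - t n = dt.
Proof. by rewrite -mulrBl -natrB// subSnn mul1r. Qed.

Lemma scheme_level n : (n <= M)%N -> [/\ Vh (uh n), Qh (xih n), Wh (ph n) & Wh (Th_ n)].
Proof.
case: n => [_|[_|n nM]]; last by have [] := later (ltn0Sn n) nM.
  by case: init => -[Vu Qx _ _] [Wp _] [WT _] _.
by case: first.
Qed.

Lemma rate_scale q x y : L2 Omega q -> L2 Omega x -> L2 Omega y ->
  inn (dt^-1 *: (x - y)) q = dt^-1 * inn (x - y) q.
Proof.
move=> Lq Lx Ly; apply: (formZ (subspace_L2 dO) (sip_lin iL2 Lq)).
exact: (subspaceB (subspace_L2 dO)).
Qed.

Lemma clear_rate (a X c1 Y c2 Z D G : R) :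
  c1 * (dt^-1 * Y) + D + c2 * (dt^-1 * Z) = a * (dt^-1 * X) + G ->
  c1 * Y + c2 * Z + dt * D - a * X = dt * G.
Proof.
have cancel y : dt * (dt^-1 * y) = y by rewrite mulVKf// gt_eqF// dt_gt0.
move=> /(congr1 ( *%R dt)); rewrite !mulrDr (mulrCA dt c1) (mulrCA dt c2) (mulrCA dt a).
by rewrite !cancel; lra.
Qed.

(** Both kinds of steps have the same form once the decoupled one is multiplied
    by the step size. *)
Lemma scheme_pressure n q : (n < M)%N -> Wh q ->
  c_alpha P * inn (ph n.+1 - ph n) q + c_alphabeta P * inn (Th_ n.+1 - Th_ n) q
  + dt * diff_form Omega (perm P) (ph n.+1) q - al / la * inn (xih n.-1.+1 - xih n.-1) q
  = dt * inn (g (t n.+1)) q.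
Proof.
case: n => [_|n nM] Wq.
  have [_ H] := first.
  have [_ _ e _] := H 0 0 q 0 (subspace_fe_V _ _ _ dO).1 (subspace_fe_Q _ _ dO).1 Wq
    (subspace_fe_W _ _ dO).1.
  have h (a X c1 Y c2 Z D G : R) : - a * X + c1 * Y + c2 * Z + D = G ->
    c1 * Y + c2 * Z + D - a * X = G by lra.
  exact: h e.
have [_ H] := later (ltn0Sn n) nM.
have [e _ _ _] := H 0 0 q 0 (subspace_fe_V _ _ _ dO).1 (subspace_fe_Q _ _ dO).1 Wq
  (subspace_fe_W _ _ dO).1.
have Lq := fe_W_L2 Wq.
have [_ Qx1 Wp1 WT1] := scheme_level (ltnW nM); have [_ _ Wp2 WT2] := scheme_level nM.
have [_ Qx0 _ _] := scheme_level (leq_trans (leqnSn n) (ltnW nM)).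
rewrite (rate_scale Lq (fe_W_L2 Wp2) (fe_W_L2 Wp1)) in e.
rewrite (rate_scale Lq (fe_W_L2 WT2) (fe_W_L2 WT1)) in e.
rewrite (rate_scale Lq (fe_Q_L2 Qx1) (fe_Q_L2 Qx0)) in e.
exact: clear_rate e.
Qed.

(** The discrete initial value is the projection of the initial data, which
    satisfy the elasticity equation by continuity. *)
Lemma initial_elasticity v : Vh v ->
  2 * mu P * strain_form Omega (uh 0%N) v - inn (div Omega v) (xih 0%N) =
  vinner Omega (f (t 0%N)) v.
Proof.
move=> Vv; have [[_ _ e _] _ _ _] := init; rewrite (e v Vv).
have := nodal_elasticity dO tau0 cf sol reg (node_in (leq0n M)) Vv.1.
by rewrite node0.
Qed.

Lemma scheme_elasticity n v : (n <= M)%N -> Vh v ->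
  2 * mu P * strain_form Omega (uh n) v - inn (div Omega v) (xih n) =
  vinner Omega (f (t n)) v.
Proof.
have Q0 := (subspace_fe_Q Th k dO).1; have W0 := (subspace_fe_W Th l dO).1.
case: n => [_ Vv|[|n] nM Vv]; first exact: initial_elasticity.
  by have [_ H] := first; have [e _ _ _] := H v 0 0 0 Vv Q0 W0 W0; exact: e.
by have [_ H] := later (ltn0Sn n) nM; have [_ _ e _] := H v 0 0 0 Vv Q0 W0 W0; exact: e.
Qed.

Lemma scheme_constraint n phi : (n <= M)%N -> Qh phi ->
  inn (div Omega (uh n)) phi + la^-1 * inn (xih n) phi
  - al / la * inn (ph n) phi - be / la * inn (Th_ n) phi = 0.
Proof.
have V0 := (subspace_fe_V Gammad Th k dO).1; have W0 := (subspace_fe_W Th l dO).1.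
have neg (a b c e' : R) : - a - b + c + e' = 0 -> a + b - c - e' = 0 by lra.
case: n => [_ Qp|[|n] nM Qp].
- by have [_ _ _ H] := init; exact: neg (H phi Qp).
- by have [_ H] := first; have [_ e _ _] := H 0 phi 0 0 V0 Qp W0 W0; exact: neg e.
- have [_ H] := later (ltn0Sn n) nM; have [_ _ _ e] := H 0 phi 0 0 V0 Qp W0 W0.
  have pos (a b c e' : R) : a + b = c + e' -> a + b - c - e' = 0 by lra.
  exact: pos e.
Qed.

Lemma scheme_temperature n q : (n < M)%N -> Wh q ->
  c_beta P * inn (Th_ n.+1 - Th_ n) q + c_alphabeta P * inn (ph n.+1 - ph n) q
  + dt * diff_form Omega (cond P) (Th_ n.+1) q - be / la * inn (xih n.-1.+1 - xih n.-1) q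
  = dt * inn (Hs (t n.+1)) q.
Proof.
case: n => [_|n nM] Wq.
  have [_ H] := first.
  have [_ _ _ e] := H 0 0 0 q (subspace_fe_V _ _ _ dO).1 (subspace_fe_Q _ _ dO).1
    (subspace_fe_W _ _ dO).1 Wq.
  have h (a X c1 Y c2 Z D G : R) : - a * X + c1 * Y + c2 * Z + D = G ->
    c1 * Y + c2 * Z + D - a * X = G by lra.
  exact: h e.
have [_ H] := later (ltn0Sn n) nM.
have [_ e _ _] := H 0 0 0 q (subspace_fe_V _ _ _ dO).1 (subspace_fe_Q _ _ dO).1
  (subspace_fe_W _ _ dO).1 Wq.
have Lq := fe_W_L2 Wq.
have [_ Qx1 Wp1 WT1] := scheme_level (ltnW nM); have [_ _ Wp2 WT2] := scheme_level nM.
have [_ Qx0 _ _] := scheme_level (leq_trans (leqnSn n) (ltnW nM)).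
rewrite (rate_scale Lq (fe_W_L2 Wp2) (fe_W_L2 Wp1)) in e.
rewrite (rate_scale Lq (fe_W_L2 WT2) (fe_W_L2 WT1)) in e.
rewrite (rate_scale Lq (fe_Q_L2 Qx1) (fe_Q_L2 Qx0)) in e.
exact: clear_rate e.
Qed.

Local Notation eu n := (Piu n - uh n).
Local Notation exi n := (Pixi n - xih n).
Local Notation ep n := (Pip n - ph n).
Local Notation eT n := (PiT n - Th_ n).

Lemma error_level n : (n <= M)%N ->
  [/\ Vh (eu n), Qh (exi n), Wh (ep n) & Wh (eT n)].
Proof.
move=> nM; have [Vu Qx Wp WT] := scheme_level nM.
have [[Vu' Qx' _ _] [Wp' _] [WT' _]] := proj nM.
split; [exact: (subspaceB (subspace_fe_V _ _ _ dO))|exact: (subspaceB (subspace_fe_Q _ _ dO))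
  |exact: (subspaceB (subspace_fe_W _ _ dO))..].
Qed.

Lemma error_elasticity n v : (n <= M)%N -> Vh v ->
  2 * mu P * strain_form Omega (eu n) v = inn (div Omega v) (exi n).
Proof.
have h (m a b x y w z F : R) : w - z = F -> m * b - y = F -> m * a - x = w - z ->
  m * (a - b) = x - y by lra.
move=> nM Vv; have [Vu Qx _ _] := scheme_level nM; have [[Vu' Qx' e _] _ _] := proj nM.
have h1 := nodal_elasticity dO tau0 cf sol reg (node_in nM) Vv.1.
have h2 := scheme_elasticity nM Vv; have h3 := e v Vv.
have sv := fe_V_vsobolev Vv; have Ld := L2_div dO sv.
rewrite (formB (sip_lin iS sv) (fe_V_vsobolev Vu') (fe_V_vsobolev Vu)).
rewrite (formB (sip_linr iL2 Ld) (fe_Q_L2 Qx') (fe_Q_L2 Qx)).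
exact: h h1 h2 h3.
Qed.

(** The defect of the constraint: the projections do not commute with the
    relation between the total pressure and the fluid unknowns. *)
Definition constraint_defect n : scal :=
  la^-1 *: (Pixi n - xi (t n)) + (- (al / la)) *: (Pip n - p (t n))
  - (be / la) *: (PiT n - T (t n)).

Lemma projection_L2 n : (n <= M)%N ->
  [/\ L2 Omega (Pixi n), L2 Omega (Pip n) & L2 Omega (PiT n)].
Proof.
move=> nM; have [[_ Qx _ _] [Wp _] [WT _]] := proj nM.
by split; [exact: fe_Q_L2 Qx|exact: fe_W_L2 Wp|exact: fe_W_L2 WT].
Qed.

Lemma solution_L2 n : (n <= M)%N ->
  [/\ L2 Omega (xi (t n)), L2 Omega (p (t n)) & L2 Omega (T (t n))].
Proof.
move=> nM; have nt := node_in nM; split.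
- exact: sobolev_L2 (xi_level reg nt).
- exact: sobolev_L2 (p_level reg nt).2.
- exact: sobolev_L2 (T_level reg nt).2.
Qed.

Lemma constraint_defect_L2 n : (n <= M)%N -> L2 Omega (constraint_defect n).
Proof.
move=> nM; have [Lx Lp LT] := projection_L2 nM; have [lx lp lT] := solution_L2 nM.
have sL := subspace_L2 dO.
apply: (subspaceB sL); first apply: (subspaceD sL); apply: (subspaceZ sL);
  exact: (subspaceB sL).
Qed.

Lemma error_constraint n phi : (n <= M)%N -> Qh phi ->
  inn (div Omega (eu n)) phi + la^-1 * inn (exi n) phi
  - la^-1 * inn (al *: ep n + be *: eT n) phi = inn (constraint_defect n) phi.
Proof.
have h (i a b U V X x Y y Z z X' Y' Z' : R) :
    U + i * X - a * i * Y - b * i * Z = 0 -> V + i * x - a * i * y - b * i * z = 0 ->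
    U - V + i * (X' - x) - i * (a * (Y' - y) + b * (Z' - z)) =
    i * (X' - X) + - (a * i) * (Y' - Y) - b * i * (Z' - Z) by lra.
move=> nM Qphi; have Lphi := fe_Q_L2 Qphi; have sL := subspace_L2 dO.
have [Vu Qx Wp WT] := scheme_level nM; have [[Vu' _ _ De] _ _] := proj nM.
have [Lx Lp LT] := projection_L2 nM; have [lx lp lT] := solution_L2 nM.
have hx := fe_Q_L2 Qx; have hp := fe_W_L2 Wp; have hT := fe_W_L2 WT.
have li := sip_lin iL2 Lphi.
have Zp := subspaceZ sL al (subspaceB sL Lp hp).
have ZT := subspaceZ sL be (subspaceB sL LT hT).
have e1 : inn (al *: ep n + be *: eT n) phi =
    al * (inn (Pip n) phi - inn (ph n) phi) + be * (inn (PiT n) phi - inn (Th_ n) phi).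
  rewrite (formD li Zp ZT) (formZ sL li al (subspaceB sL Lp hp)).
  by rewrite (formZ sL li be (subspaceB sL LT hT)) (formB li Lp hp) (formB li LT hT).
have e2 : inn (constraint_defect n) phi =
    la^-1 * (inn (Pixi n) phi - inn (xi (t n)) phi)
    + - (al / la) * (inn (Pip n) phi - inn (p (t n)) phi)
    - (be / la) * (inn (PiT n) phi - inn (T (t n)) phi).
  have dx := subspaceB sL Lx lx; have dp := subspaceB sL Lp lp.
  have dT := subspaceB sL LT lT.
  have zx := subspaceZ sL la^-1 dx; have zp := subspaceZ sL (- (al / la)) dp.
  have zT := subspaceZ sL (be / la) dT.
  rewrite (formB li (subspaceD sL zx zp) zT) (formD li zx zp).
  rewrite (formZ sL li _ dx) (formZ sL li _ dp) (formZ sL li _ dT).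
  by rewrite (formB li Lx lx) (formB li Lp lp) (formB li LT lT).
have su := fe_V_vsobolev Vu; have su' := fe_V_vsobolev Vu'.
have e3 : inn (div Omega (eu n)) phi = inn (div Omega (u (t n))) phi - inn (div Omega (uh n)) phi.
  rewrite -(De _ Qphi) addrC -scaleN1r.
  have -> := (seen_linear_div dO).2 (-1) (uh n) (Piu n) phi su su' Lphi.
  by rewrite mulN1r addrC.
have h1 := nodal_constraint dO tau0 sol reg (node_in nM) Lphi.
have h2 := scheme_constraint nM Qphi.
by rewrite e1 e2 e3 (formB li Lx hx); exact: h h1 h2.
Qed.

(** What remains of the scheme when the projected solution is inserted in it, the
    rates being those of the exact solution at the new level. The increment of
    the total pressure is taken one step earlier, except in the first, coupled,
    step: this is the meaning of n.-1. *)
Definition pressure_defect n : scal :=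
  c_alpha P *: (Pip n.+1 - Pip n - dt *: traj_t p (t n.+1))
  + c_alphabeta P *: (PiT n.+1 - PiT n - dt *: traj_t T (t n.+1))
  - (al / la) *: (Pixi n.-1.+1 - Pixi n.-1 - dt *: traj_t xi (t n.+1)).

Definition temperature_defect n : scal :=
  c_beta P *: (PiT n.+1 - PiT n - dt *: traj_t T (t n.+1))
  + c_alphabeta P *: (Pip n.+1 - Pip n - dt *: traj_t p (t n.+1))
  - (be / la) *: (Pixi n.-1.+1 - Pixi n.-1 - dt *: traj_t xi (t n.+1)).

Lemma rate_L2 n : (n <= M)%N ->
  [/\ L2 Omega (traj_t xi (t n)), L2 Omega (traj_t p (t n)) & L2 Omega (traj_t T (t n))].
Proof.
move=> nM; have nt := node_in nM; have [_ [_ _ _ _ dx] [_ _ _ _ dp] [_ _ _ _ dT]] := reg.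
by split; [exact: dx.1|exact: dp.1|exact: dT.1].
Qed.

Lemma lag_le n : (n < M)%N -> (n.-1.+1 <= M)%N /\ (n.-1 <= M)%N.
Proof.
by move=> nM; split; [exact: leq_ltn_trans (leq_pred n) nM
  |exact: leq_trans (leq_pred n) (ltnW nM)].
Qed.

Lemma error_pressure n q : (n < M)%N -> Wh q ->
  c_alpha P * inn (ep n.+1 - ep n) q + c_alphabeta P * inn (eT n.+1 - eT n) q
  + dt * diff_form Omega (perm P) (ep n.+1) q
  - al / la * inn (exi n.-1.+1 - exi n.-1) q = inn (pressure_defect n) q.
Proof.
have order (a X c1 Y c2 Z D G : R) : - a * X + c1 * Y + c2 * Z + D = G ->
    c1 * Y + c2 * Z - a * X + D = G by lra.
move=> nM Wq; have Lq := fe_W_L2 Wq; have sq := fe_W_sobolev Wq.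
have [l1 l0] := lag_le nM.
have [_ _ Wp1 WT1] := scheme_level nM; have [_ _ Wp0 WT0] := scheme_level (ltnW nM).
have [_ Qx1 _ _] := scheme_level l1; have [_ Qx0 _ _] := scheme_level l0.
have [_ LP0 LT0] := projection_L2 (ltnW nM); have [_ [WP1 eP] [WTT1 _]] := proj nM.
have [LX1 _ _] := projection_L2 l1; have [LX0 _ _] := projection_L2 l0.
have [rx rp rT] := rate_L2 nM.
apply: (@error_step _ _ (L2 Omega) (fe_W Omega Th l) inn iL2
  (@fe_W_L2 _ _ _ _ _) (fun x => inn x q) (fun x => diff_form Omega (perm P) x q)
  (c_alpha P) (c_alphabeta P) (al / la) dt (inn (g (t n.+1)) q)
  (Pip n) (Pip n.+1) (ph n) (ph n.+1) (traj_t p (t n.+1))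
  (PiT n) (PiT n.+1) (Th_ n) (Th_ n.+1) (traj_t T (t n.+1))
  (Pixi n.-1) (Pixi n.-1.+1) (xih n.-1) (xih n.-1.+1) (traj_t xi (t n.+1)) (p (t n.+1))).
- exact: (sip_lin iL2 Lq).
- by move=> b y z /fe_W_sobolev sy /fe_W_sobolev sz; exact: (sip_lin iK sq).
- by split => //; exact: fe_W_L2 Wp0.
- by split => //; [exact: fe_W_L2 WTT1|exact: fe_W_L2 WT0|exact: fe_W_L2 WT1].
- by split => //; [exact: fe_Q_L2 Qx0|exact: fe_Q_L2 Qx1].
- exact: scheme_pressure.
- have e := nodal_pressure dO tau0 km0 spdK cg sol reg (node_in nM) Wq.1.
  exact: order e.
- exact: eP.
Qed.

Lemma error_temperature n q : (n < M)%N -> Wh q ->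
  c_beta P * inn (eT n.+1 - eT n) q + c_alphabeta P * inn (ep n.+1 - ep n) q
  + dt * diff_form Omega (cond P) (eT n.+1) q
  - be / la * inn (exi n.-1.+1 - exi n.-1) q = inn (temperature_defect n) q.
Proof.
have order (a X c1 Y c2 Z D G : R) : - a * X + c2 * Z + c1 * Y + D = G ->
    c1 * Y + c2 * Z - a * X + D = G by lra.
move=> nM Wq; have Lq := fe_W_L2 Wq; have sq := fe_W_sobolev Wq.
have [l1 l0] := lag_le nM.
have [_ _ Wp1 WT1] := scheme_level nM; have [_ _ Wp0 WT0] := scheme_level (ltnW nM).
have [_ Qx1 _ _] := scheme_level l1; have [_ Qx0 _ _] := scheme_level l0.
have [_ LP0 LT0] := projection_L2 (ltnW nM); have [_ [WP1 _] [WTT1 eT']] := proj nM.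
have [LX1 _ _] := projection_L2 l1; have [LX0 _ _] := projection_L2 l0.
have [rx rp rT] := rate_L2 nM.
apply: (@error_step _ _ (L2 Omega) (fe_W Omega Th l) inn iL2
  (@fe_W_L2 _ _ _ _ _) (fun x => inn x q) (fun x => diff_form Omega (cond P) x q)
  (c_beta P) (c_alphabeta P) (be / la) dt (inn (Hs (t n.+1)) q)
  (PiT n) (PiT n.+1) (Th_ n) (Th_ n.+1) (traj_t T (t n.+1))
  (Pip n) (Pip n.+1) (ph n) (ph n.+1) (traj_t p (t n.+1))
  (Pixi n.-1) (Pixi n.-1.+1) (xih n.-1) (xih n.-1.+1) (traj_t xi (t n.+1)) (T (t n.+1))).
- exact: (sip_lin iL2 Lq).
- by move=> b y z /fe_W_sobolev sy /fe_W_sobolev sz; exact: (sip_lin iT sq).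
- by split => //; exact: fe_W_L2 WT0.
- by split => //; [exact: fe_W_L2 WP1|exact: fe_W_L2 Wp0|exact: fe_W_L2 Wp1].
- by split => //; [exact: fe_Q_L2 Qx0|exact: fe_Q_L2 Qx1].
- exact: scheme_temperature.
- have e := nodal_temperature dO tau0 thm0 spdT cH sol reg (node_in nM) Wq.1.
  exact: order e.
- exact: eT'.
Qed.

(** At the initial level both discrete quantities project the same data. *)
Lemma initial_error :
  [/\ inn (exi 0%N) (exi 0%N) = 0, inn (ep 0%N) (ep 0%N) = 0, inn (eT 0%N) (eT 0%N) = 0,
      diff_form Omega (perm P) (ep 0%N) (ep 0%N) = 0 &
      diff_form Omega (cond P) (eT 0%N) (eT 0%N) = 0] /\
  forall phi, Qh phi -> inn (div Omega (eu 0%N)) phi = 0.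
Proof.
have le0 (c h x : R) : h = 0 -> x ^+ 2 <= c * h ^+ 2 -> x ^+ 2 = 0.
  by move=> -> le; apply/le_anti; rewrite sqr_ge0 andbT (le_trans le)// expr0n mulr0.
have [PS PK PT] := proj (leq0n M); have [IS IK IT _] := init.
move: PS PK PT; rewrite node0 => PS PK PT.
have z0 := node_in (leq0n M); rewrite node0 in z0.
have [Vu su] := u_level reg z0; have sx := xi_level reg z0.
have [Wp sp] := p_level reg z0; have [WT sT] := T_level reg z0.
have nil (x : scal) : L2norm Omega x ^+ 2 = 0 -> inn x x = 0 by rewrite L2norm_sqr.
have null (x y : scal) : x - (y - y) = x by rewrite subrr subr0.
have := stokes_increment dO CPi0 bndS Vu Vu su su sx sx PS IS.
have := elliptic_increment dO CPi0 km0 spdK bndK Wp Wp sp sp PK IK.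
have := elliptic_increment dO CPi0 thm0 spdT bndT WT WT sT sT PT IT.
rewrite !null !subrr (Hnorm0 dO) (Hnorm0 dO) => hT hp hx.
have su1 := vH1_0_vsobolev Vu; have lx := sobolev_L2 sx.
have [_ _ _ Dz] := stokes_projectionB dO su1 su1 lx lx PS IS.
have [Ep eK] := elliptic_projectionB dO km0 spdK (H1_0_sobolev Wp) (H1_0_sobolev Wp) PK IK.
have [ET eT'] := elliptic_projectionB dO thm0 spdT (H1_0_sobolev WT) (H1_0_sobolev WT) PT IT.
have d0 (A : 'rV[R]_d -> 'M[R]_d) am aM q : 0 < am -> spd_tensor Omega A am aM ->
    sobolev Omega 1 q -> diff_form Omega A 0 q = 0.
  move=> am0 spdA sq; have iA := semi_inner_diff_form dO am0 spdA.
  exact: (form0 (subspace_sobolev dO 1) (sip_lin iA sq)).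
have v0 : vHnorm Omega k.+1 0 = 0.
  have [s0 _] := subspace_vsobolev dO k.+1.
  by rewrite (vHnormE dO s0) (semi_norm0 (semi_inner_vHform dO k.+1)).
split; first split.
- apply: nil; apply/le_anti; rewrite sqr_ge0 andbT; move: hx.
  by rewrite v0 expr0n addr0 mulr0.
- apply: nil; exact: (le0 _ 0 _ erefl hp).
- apply: nil; exact: (le0 _ 0 _ erefl hT).
- rewrite (eK _ Ep) subrr; exact: (d0 _ _ _ _ km0 spdK (fe_W_sobolev Ep)).
- rewrite (eT' _ ET) subrr; exact: (d0 _ _ _ _ thm0 spdT (fe_W_sobolev ET)).
- move=> phi Qphi; rewrite (Dz _ Qphi) subrr.
  have [_ lin] := seen_linear_div dO.
  have [s0 _] := subspace_vsobolev dO 1.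
  have := lin (-1) 0 0 phi s0 s0 (fe_Q_L2 Qphi).
  by rewrite scaler0 addr0 => ->; rewrite mulN1r addNr.
Qed.

Local Notation h := (mesh_size Th).
Local Notation nrm := (L2norm Omega).
Local Notation Eu n := (energy (vHnorm Omega k.+1) (traj_t u) (t n)).
Local Notation Ex n := (energy (Hnorm Omega k) (traj_t xi) (t n)).
Local Notation Ew w n := (energy (Hnorm Omega l.+1) (traj_t w) (t n)).
Local Notation Gw w n := (energy nrm (traj_tt w) (t n)).

Lemma total_pressure_projection n : (n < M)%N ->
  nrm (Pixi n.+1 - Pixi n - (xi (t n.+1) - xi (t n))) ^+ 2 <=
  2 * CPi ^+ 2 * h ^+ (2 * k) * (dt * (Eu n.+1 - Eu n) + dt * (Ex n.+1 - Ex n)).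
Proof.
move=> nM; have t0 := node_in (ltnW nM); have t1 := node_in nM.
have [V0 s0] := u_level reg t0; have [V1 s1] := u_level reg t1.
have [P0 _ _] := proj (ltnW nM); have [P1 _ _] := proj nM.
apply: le_trans (stokes_increment dO CPi0 bndS V1 V0 s1 s0 (xi_level reg t1)
  (xi_level reg t0) P1 P0) _.
apply: ler_wpM2l.
  by rewrite !mulr_ge0 ?sqr_ge0// exprn_ge0// mesh_size_ge0.
have [[_ Lu _ du _] [_ Lx _ dx _] _ _] := reg.
have Vk x : (V `&` vsobolev Omega k.+1) x -> vHnorm Omega k.+1 x = semi_norm (vHform Omega k.+1) x.
  by move=> [_ sx]; exact: vHnormE.
have Xk x : sobolev Omega k x -> Hnorm Omega k x = semi_norm (Hform Omega k) x.
  by move=> _; rewrite HnormE.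
have eu := norm_increment (semi_inner_vHform dO k.+1) (subspace_Vk _ _ dO)
  (@subIsetr _ _ _) Vk Lu du (node_ge0 n) (node_le (leqnSn n)) (node_le_tau nM).
have ex := norm_increment (semi_inner_Hform dO k) (subspace_sobolev dO k)
  (@subset_refl _ _) Xk Lx dx (node_ge0 n) (node_le (leqnSn n)) (node_le_tau nM).
by rewrite nodeS in eu ex; exact: lerD eu ex.
Qed.

(** The approximation property for the increment over one step, itself bounded by
    the energy of the rate during the step. *)
Lemma fluid_projection (A : 'rV[R]_d -> 'M[R]_d) (am aM : R) (w : trajectory scal)
    (Pw : nat -> scal) n : 0 < am -> spd_tensor Omega A am aM ->
  elliptic_projection_bound Omega Th l A CPi ->
  regular tau (W `&` sobolev Omega l.+1) (Hnorm Omega l.+1) (L2 Omega) nrm w ->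
  (forall m, (m <= M)%N -> elliptic_projection Omega Th l A (w (t m)) (Pw m)) ->
  (n < M)%N ->
  nrm (Pw n.+1 - Pw n - (w (t n.+1) - w (t n))) ^+ 2 <=
  CPi ^+ 2 * h ^+ (2 * l + 2) * (dt * (Ew w n.+1 - Ew w n)).
Proof.
move=> am0 spdA bnd [_ Lw _ dw _] pr nM.
have [W0 s0] := dw.1 _ (node_in (ltnW nM)); have [W1 s1] := dw.1 _ (node_in nM).
apply: le_trans (elliptic_increment dO CPi0 am0 spdA bnd W1 W0 s1 s0 (pr _ nM)
  (pr _ (ltnW nM))) _.
apply: ler_wpM2l.
  by rewrite !mulr_ge0 ?sqr_ge0// exprn_ge0// mesh_size_ge0.
have Xl x : (W `&` sobolev Omega l.+1) x -> Hnorm Omega l.+1 x = semi_norm (Hform Omega l.+1) x.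
  by move=> _; rewrite HnormE.
have e := norm_increment (semi_inner_Hform dO l.+1) (subspace_Wl _ dO)
  (@subIsetr _ _ _) Xl Lw dw (node_ge0 n) (node_le (leqnSn n)) (node_le_tau nM).
by rewrite nodeS in e; exact: e.
Qed.

Lemma rate_consistency (X : set scal) (nX : scal -> R) (w : trajectory scal) m n :
  subspace X -> X `<=` L2 Omega -> (forall x, X x -> nrm x <= nX x) ->
  regular tau X nX (L2 Omega) nrm w -> (m <= n)%N -> (n < M)%N ->
  nrm (w (t m.+1) - w (t m) - dt *: traj_t w (t n.+1)) ^+ 2 <=
  dt ^+ 2 * ((t n.+1 - t m) * (Gw w n.+1 - Gw w m)).
Proof.
move=> sX XL nXL [_ Lw Lww dw dww] mn nM.
have m1n : (m.+1 <= n.+1)%N by [].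
have e := norm_second_increment iL2 sX XL (fun y _ => erefl) nXL dw Lw dww Lww (node_ge0 m)
  (node_le (leqnSn m)) (node_le m1n) (node_le_tau nM).
by rewrite nodeS in e; exact: e.
Qed.

Lemma fluid_consistency (w : trajectory scal) n :
  regular tau (W `&` sobolev Omega l.+1) (Hnorm Omega l.+1) (L2 Omega) nrm w ->
  (n < M)%N ->
  nrm (w (t n.+1) - w (t n) - dt *: traj_t w (t n.+1)) ^+ 2 <=
  dt ^+ 2 * (dt * (Gw w n.+1 - Gw w n)).
Proof.
move=> rw nM.
have XL : (W `&` sobolev Omega l.+1) `<=` L2 Omega by move=> x [_ /sobolev_L2].
have nX x : (W `&` sobolev Omega l.+1) x -> nrm x <= Hnorm Omega l.+1 x.
  by move=> [_ sx]; exact: L2norm_le_Hnorm.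
have e := rate_consistency (subspace_Wl _ dO) XL nX rw (leqnn n) nM.
by rewrite nodeS in e; exact: e.
Qed.

(** The lagged increment of the total pressure is compared with its rate at the
    new level, at most two steps later. *)
Lemma total_pressure_consistency n : (n < M)%N ->
  nrm (xi (t n.-1.+1) - xi (t n.-1) - dt *: traj_t xi (t n.+1)) ^+ 2 <=
  dt ^+ 2 * (2 * dt * (Gw xi n.+1 - Gw xi n.-1)).
Proof.
move=> nM; have [_ rx _ _] := reg.
have := rate_consistency (subspace_sobolev dO k) (@sobolev_L2 _ _ _ _)
  (fun x sx => L2norm_le_Hnorm dO sx) rx (leq_pred n) nM.
move=> /le_trans; apply; apply: ler_wpM2l; first exact: sqr_ge0.
apply: ler_wpM2r.
  rewrite subr_ge0; have [_ _ Lxx _ _] := rx.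
  apply: (energy_nd Lxx (node_ge0 _) _ (node_le_tau nM)).
  exact: node_le (leq_trans (leq_pred n) (leqnSn n)).
have n2 : (n.+1 <= n.-1 + 2)%N by rewrite addn2; case: n {nM}.
have := node_le n2; rewrite natrD mulrDl; lra.
Qed.

Lemma defect_increment n : (n < M)%N ->
  inn (constraint_defect n.+1 - constraint_defect n)
      (constraint_defect n.+1 - constraint_defect n) <=
  3 * (la^-1 ^+ 2 * nrm (Pixi n.+1 - Pixi n - (xi (t n.+1) - xi (t n))) ^+ 2
    + (al / la) ^+ 2 * nrm (Pip n.+1 - Pip n - (p (t n.+1) - p (t n))) ^+ 2
    + (be / la) ^+ 2 * nrm (PiT n.+1 - PiT n - (T (t n.+1) - T (t n))) ^+ 2).
Proof.
have sign (a b c x y z D : R) : D <= 3 * (a ^+ 2 * x + (- b) ^+ 2 * y + c ^+ 2 * z) ->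
    D <= 3 * (a ^+ 2 * x + b ^+ 2 * y + c ^+ 2 * z) by rewrite sqrrN.
move=> nM; have [Lx Lp LT] := projection_L2 nM; have [lx lp lT] := solution_L2 nM.
have [Lx0 Lp0 LT0] := projection_L2 (ltnW nM); have [lx0 lp0 lT0] := solution_L2 (ltnW nM).
have sL := subspace_L2 dO.
have swap (a b a' b' : scal) : a' - b' - (a - b) = a' - a - (b' - b).
  by rewrite !opprB addrACA [RHS]addrACA [- b' - a]addrC.
rewrite /constraint_defect comb3B (swap (Pixi n)) (swap (Pip n)) (swap (PiT n)).
have B (x' x y' y : scal) : L2 Omega x' -> L2 Omega x -> L2 Omega y' -> L2 Omega y ->
    L2 Omega (x' - x - (y' - y)).
  by move=> h1 h2 h3 h4; apply: (subspaceB sL); exact: (subspaceB sL).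
exact: sign (semi_norm_comb3 iL2 la^-1 (- (al / la)) (be / la)
  (B _ _ _ _ Lx Lx0 lx lx0) (B _ _ _ _ Lp Lp0 lp lp0) (B _ _ _ _ LT LT0 lT lT0)).
Qed.

(** The error of the difference quotient is split into a projection error and a
    Taylor remainder. *)
Lemma defect_split (w : trajectory scal) (Pw : nat -> scal) m n : (m < M)%N -> (n <= M)%N ->
  L2 Omega (Pw m.+1) -> L2 Omega (Pw m) -> L2 Omega (w (t m.+1)) -> L2 Omega (w (t m)) ->
  L2 Omega (traj_t w (t n)) ->
  nrm (Pw m.+1 - Pw m - dt *: traj_t w (t n)) ^+ 2 <=
  2 * (nrm (Pw m.+1 - Pw m - (w (t m.+1) - w (t m))) ^+ 2
     + nrm (w (t m.+1) - w (t m) - dt *: traj_t w (t n)) ^+ 2).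
Proof.
move=> mM nM P1 P0' w1 w0 r; have sL := subspace_L2 dO.
have hP := subspaceB sL P1 P0'; have hw := subspaceB sL w1 w0; have hr := subspaceZ sL dt r.
exact: (semi_norm_split iL2 (subspaceB sL hP hw) (subspaceB sL hw hr)).
Qed.

Local Notation q := (defect_weight al be la (a0 P) (b0 P) (c0 P)).
Local Notation A := (2 * CPi ^+ 2 * h ^+ (2 * k)).
Local Notation B := (CPi ^+ 2 * h ^+ (2 * l + 2)).

Lemma defect_step_le n : (n < M)%N ->
  inn (constraint_defect n.+1 - constraint_defect n)
      (constraint_defect n.+1 - constraint_defect n)
  + (inn (pressure_defect n) (pressure_defect n)
     + inn (temperature_defect n) (temperature_defect n)) <=
  15 * q * (A * (dt * (Eu n.+1 - Eu n) + dt * (Ex n.+1 - Ex n))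
    + A * (dt * (Eu n.-1.+1 - Eu n.-1) + dt * (Ex n.-1.+1 - Ex n.-1))
    + B * (dt * (Ew p n.+1 - Ew p n)) + B * (dt * (Ew T n.+1 - Ew T n))
    + dt ^+ 2 * (dt * (Gw p n.+1 - Gw p n)) + dt ^+ 2 * (dt * (Gw T n.+1 - Gw T n))
    + dt ^+ 2 * (2 * dt * (Gw xi n.+1 - Gw xi n.-1))).
Proof.
move=> nM; have [l1 l0] := lag_le nM; have [_ rx rp rT] := reg.
have [[q0 i1 i2 i3] [c1 c2 c3]] := defect_weight_ge al be la (a0 P) (b0 P) (c0 P).
have [_ LP1 LT1] := projection_L2 nM; have [_ LP0 LT0] := projection_L2 (ltnW nM).
have [LX1 _ _] := projection_L2 l1; have [LX0 _ _] := projection_L2 l0.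
have [_ lp1 lT1] := solution_L2 nM; have [_ lp0 lT0] := solution_L2 (ltnW nM).
have [lx1 _ _] := solution_L2 l1; have [lx0 _ _] := solution_L2 l0.
have [tx tp tT] := rate_L2 nM; have sL := subspace_L2 dO.
have res (z' z w : scal) : L2 Omega z' -> L2 Omega z -> L2 Omega w ->
    L2 Omega (z' - z - dt *: w).
  by move=> h1 h2 h3; apply: (subspaceB sL); [exact: (subspaceB sL)|exact: (subspaceZ sL)].
have hp := res _ _ _ LP1 LP0 tp; have hT := res _ _ _ LT1 LT0 tT.
have hx := res _ _ _ LX1 LX0 tx.
apply: le_trans (defect_le (And3 i1 i2 i3) (And3 c1 c2 c3)
  (And5 q0 (sqr_ge0 _) (sqr_ge0 _) (sqr_ge0 _) (sqr_ge0 _))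
  (And3 (sqr_ge0 _) (sqr_ge0 _) (sqr_ge0 _)) (And3 (sqr_ge0 _) (sqr_ge0 _) (sqr_ge0 _))
  (defect_increment nM)
  (semi_norm_comb3 iL2 (c_alpha P) (c_alphabeta P) (al / la) hp hT hx)
  (semi_norm_comb3 iL2 (c_beta P) (c_alphabeta P) (be / la) hT hp hx)
  (defect_split nM nM LP1 LP0 lp1 lp0 tp) (defect_split nM nM LT1 LT0 lT1 lT0 tT)
  (defect_split l1 nM LX1 LX0 lx1 lx0 tx)) _.
apply: ler_wpM2l; first by rewrite mulr_ge0.
have bp := fluid_projection km0 spdK bndK rp (fun m mM => (let: And3 _ e _ := proj mM in e)) nM.
have bT := fluid_projection thm0 spdT bndT rT (fun m mM => (let: And3 _ _ e := proj mM in e)) nM.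
exact: lerD (lerD (lerD (lerD (lerD (lerD (total_pressure_projection nM)
  (total_pressure_projection l1)) bp) bT) (fluid_consistency rp nM))
  (fluid_consistency rT nM)) (total_pressure_consistency nM).
Qed.

Lemma defect_sum N : (N < M)%N ->
  \sum_(n < N.+1)
    (inn (constraint_defect n.+1 - constraint_defect n)
         (constraint_defect n.+1 - constraint_defect n)
     + (inn (pressure_defect n) (pressure_defect n)
        + inn (temperature_defect n) (temperature_defect n))) <=
  15 * q * (dt * (3 * A *
      (energy (vHnorm Omega k.+1) (traj_t u) tau + energy (Hnorm Omega k) (traj_t xi) tau)
    + B * (energy (Hnorm Omega l.+1) (traj_t p) tau + energy (Hnorm Omega l.+1) (traj_t T) tau)
    + dt ^+ 2 * (energy nrm (traj_tt p) tau + energy nrm (traj_tt T) tau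
                 + 4 * energy nrm (traj_tt xi) tau))).
Proof.
move=> NM; have [[q0 _ _ _] _] := defect_weight_ge al be la (a0 P) (b0 P) (c0 P).
have [[_ Lu _ _ _] [_ Lx Lxx _ _] [_ Lp Lpp _ _] [_ LT LTT _ _]] := reg.
have sums (E : lmodType R) (X : set E) (nr : E -> R) w :
    bochner_L2 `]0, tau[%classic X nr w ->
    let e n := energy nr w (t n) in
    [/\ \sum_(n < N.+1) (e n.+1 - e n) <= energy nr w tau,
        \sum_(n < N.+1) (e n.-1.+1 - e n.-1) <= 2 * energy nr w tau &
        \sum_(n < N.+1) (e n.+1 - e n.-1) <= 2 * energy nr w tau].
  move=> Lw e; apply: increment_sum; first by rewrite /e node0 energy0.
    move=> n nN; apply: (energy_nd Lw (node_ge0 n) (node_le (leqnSn n))).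
    exact: node_le_tau (leq_ltn_trans nN NM).
  by apply: (energy_nd Lw (node_ge0 _) (node_le_tau NM)).
have [u1 u2 _] := sums _ _ _ _ Lu; have [x1 x2 _] := sums _ _ _ _ Lx.
have [p1 _ _] := sums _ _ _ _ Lp; have [T1 _ _] := sums _ _ _ _ LT.
have [gp _ _] := sums _ _ _ _ Lpp; have [gT _ _] := sums _ _ _ _ LTT.
have [_ _ gx] := sums _ _ _ _ Lxx.
have h0 := mesh_size_ge0 Th.
have A0 : 0 <= A by rewrite !mulr_ge0 ?sqr_ge0// exprn_ge0.
have B0 : 0 <= B by rewrite mulr_ge0 ?sqr_ge0// exprn_ge0.
have := @weighted_sum_le _ N.+1 A B dt (fun n => Eu n.+1 - Eu n) (fun n => Ex n.+1 - Ex n)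
  (fun n => Eu n.-1.+1 - Eu n.-1) (fun n => Ex n.-1.+1 - Ex n.-1)
  (fun n => Ew p n.+1 - Ew p n) (fun n => Ew T n.+1 - Ew T n)
  (fun n => Gw p n.+1 - Gw p n) (fun n => Gw T n.+1 - Gw T n)
  (fun n => Gw xi n.+1 - Gw xi n.-1) _ _ _ _ _ _ _
  A0 B0 (ltW dt_gt0) u1 x1 u2 x2 p1 T1 gp gT gx.
have q15 : 0 <= 15 * q by rewrite mulr_ge0.
move=> /(ler_wpM2l q15); apply: le_trans; rewrite mulr_sumr.
apply: ler_sum => n _; apply: defect_step_le.
by apply: leq_trans NM; exact: ltn_ord.
Qed.

(** The stability of the scheme for the error, with the projection errors and
    the Taylor remainders as data. *)
Lemma error_bound N : (N < M)%N ->
  mu P * strain_norm Omega (eu N.+1) ^+ 2 + nrm (exi N.+1) ^+ 2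
  + (c0 P - b0 P) / 2 * nrm (ep N.+1) ^+ 2 + (a0 P - b0 P) / 2 * nrm (eT N.+1) ^+ 2
  + dt * \sum_(1 <= n < N.+1) (diff_form Omega (perm P) (ep n.+1) (ep n.+1)
                              + diff_form Omega (cond P) (eT n.+1) (eT n.+1)) <=
  stability_const al be la (a0 P) (b0 P) (c0 P) * tau * (15 * q * (6 * CPi ^+ 2 + 4)) *
  (h ^+ (2 * k) *
     (energy (vHnorm Omega k.+1) (traj_t u) tau + energy (Hnorm Omega k) (traj_t xi) tau)
   + h ^+ (2 * l + 2) *
     (energy (Hnorm Omega l.+1) (traj_t p) tau + energy (Hnorm Omega l.+1) (traj_t T) tau)
   + dt ^+ 2 * (energy nrm (traj_tt p) tau + energy nrm (traj_tt T) tau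
                + energy nrm (traj_tt xi) tau)).
Proof.
move=> NM; have [[mu0 la0 al0 be0] ba bc b00] := adm.
have le1 n : (n <= N.+1)%N -> (n <= M)%N by move=> nN; exact: leq_trans nN NM.
have le0 n : (n <= N)%N -> (n < M)%N by move=> nN; exact: leq_ltn_trans nN NM.
have VS : Vh `<=` vsobolev Omega 1 by exact: fe_V_vsobolev.
have WS : Wh `<=` sobolev Omega 1 by exact: fe_W_sobolev.
have sV := semi_inner_sub (subspace_fe_V Gammad Th k dO) VS iS.
have sK := semi_inner_sub (subspace_fe_W Th l dO) WS iK.
have sT := semi_inner_sub (subspace_fe_W Th l dO) WS iT.
have dvV : seen_linear Vh (L2 Omega) inn (div Omega).
  have [d1 d2] := seen_linear_div dO; split; first by move=> v /VS; exact: d1.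
  by move=> a x y z /VS sx /VS sy; exact: d2.
have [[x00 p00 T00 K00 TT00] du0] := initial_error.
have H := scheme_stability iL2 sV sK sT (@fe_W_L2 _ _ _ _ _) (@fe_Q_L2 _ _ _ _ _)
  (subspace_fe_Q Th k dO) dvV mu0 la0 al0 be0 ba bc b00 dt_gt0
  (ep := fun n => ep n) (eT := fun n => eT n) (ex := fun n => exi n) (eu := fun n => eu n)
  (rho := constraint_defect) (Rp := pressure_defect) (RT := temperature_defect) (N := N).
have Hp n : (n <= N)%N -> L2 Omega (pressure_defect n) /\ L2 Omega (temperature_defect n).
  move=> /le0 nM; have [l1 l0] := lag_le nM; have sL := subspace_L2 dO.
  have [_ LP1 LT1] := projection_L2 nM; have [_ LP0 LT0] := projection_L2 (ltnW nM).
  have [LX1 _ _] := projection_L2 l1; have [LX0 _ _] := projection_L2 l0.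
  have [tx tp tT] := rate_L2 nM.
  have res c (z' z w : scal) : L2 Omega z' -> L2 Omega z -> L2 Omega w ->
      L2 Omega (c *: (z' - z - dt *: w)).
    move=> h1 h2 h3; apply: (subspaceZ sL); apply: (subspaceB sL); last exact: (subspaceZ sL).
    exact: (subspaceB sL).
  have cp c := res c _ _ _ LP1 LP0 tp; have cT c := res c _ _ _ LT1 LT0 tT.
  have cx c := res c _ _ _ LX1 LX0 tx.
  split; apply: (subspaceB sL) (cx _); apply: (subspaceD sL);
    [exact: cp|exact: cT|exact: cT|exact: cp].
have {}H := H (fun n nN => let: And4 _ _ e _ := error_level (le1 n nN) in e)
  (fun n nN => let: And4 _ _ _ e := error_level (le1 n nN) in e)
  (fun n nN => let: And4 _ e _ _ := error_level (le1 n nN) in e)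
  (fun n nN => let: And4 e _ _ _ := error_level (le1 n nN) in e)
  (fun n nN => constraint_defect_L2 (le1 n nN))
  (fun n nN => (Hp n nN).1) (fun n nN => (Hp n nN).2) p00 T00 x00 K00 TT00 du0
  (fun n q' nN => error_pressure (le0 n nN)) (fun n q' nN => error_temperature (le0 n nN))
  (fun n v nN => error_elasticity (le1 n nN)) (fun n phi nN => error_constraint (le1 n nN)).
have St0 := stability_const_ge0 al0 be0 la0 ba bc.
have [[q0 _ _ _] _] := defect_weight_ge al be la (a0 P) (b0 P) (c0 P).
have [[_ Lu _ _ _] [_ Lx Lxx _ _] [_ Lp Lpp _ _] [_ LT LTT _ _]] := reg.
have en (E : lmodType R) (X : set E) (nr : E -> R) w :
    bochner_L2 `]0, tau[%classic X nr w -> 0 <= energy nr w tau.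
  move=> Lw; rewrite -(energy0 nr w); exact: (energy_nd Lw (lexx 0) (ltW tau0) (lexx tau)).
have Ntau := node_le_tau NM; have n0 : 0 <= N.+1%:R :> R by exact: ler0n.
have h0 := mesh_size_ge0 Th.
rewrite -!L2norm_sqr in H.
have sE : strain_norm Omega (eu N.+1) ^+ 2 = strain_form Omega (eu N.+1) (eu N.+1).
  have [V1 _ _ _] := error_level NM.
  exact: (semi_norm_sqr sV V1).
rewrite sE; apply: (assemble_constant St0 q0 (ltW dt_gt0) n0 Ntau _ _ (defect_sum NM) H).
- by split; [exact: exprn_ge0..|apply: addr_ge0; [exact: (en _ _ _ _ Lu)|exact: (en _ _ _ _ Lx)]].
- by split; [apply: addr_ge0; [exact: (en _ _ _ _ Lp)|exact: (en _ _ _ _ LT)]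
    |exact: (en _ _ _ _ Lpp)|exact: (en _ _ _ _ LTT)|exact: (en _ _ _ _ Lxx)].
Qed.
End Errors.

(* tau is the final time and CPi the constant hidden in the approximation
   properties of the projections. *)
Theorem theorem4p3 (R : realType) (tau CPi : R) (tau_gt0 : 0 < tau)
    (CPi_gt0 : 0 < CPi) :
  exists Ct : R -> R -> R -> R -> R -> R -> R,
  forall (d : nat) (Omega Gammad Gamman : set 'rV[R]_d) (P : medium R d)
    (km kM thm thM : R)
    (k l : nat) (I : Type) (Th : I -> seq 'M[R]_(d.+1, d)) (gamma : R)
    (u0 : 'I_d -> 'rV[R]_d -> R) (p0 T0 : 'rV[R]_d -> R)
    (f : R -> 'I_d -> 'rV[R]_d -> R) (g Hs : R -> 'rV[R]_d -> R)
    (u : trajectory ('I_d -> 'rV[R]_d -> R))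
    (xi p T : trajectory ('rV[R]_d -> R)),
  (d = 2 \/ d = 3)%N ->
  domain Omega ->
  Gammad `|` Gamman = boundary Omega -> Gammad <> boundary Omega ->
  0 < km -> 0 < kM -> 0 < thm -> 0 < thM ->
  spd_tensor Omega (perm P) km kM -> spd_tensor Omega (cond P) thm thM ->
  admissible P ->
  (2 <= k)%N -> (1 <= l)%N ->
  (forall i, triangulation Omega (Th i)) ->
  shape_regular Th -> quasi_uniform Th ->
  0 < gamma -> (forall i, inf_sup Omega Gammad (Th i) k gamma) ->
  (forall i, stokes_projection_bound Omega Gammad P (Th i) k CPi) ->
  (forall i, elliptic_projection_bound Omega (Th i) l (perm P) CPi) ->
  (forall i, elliptic_projection_bound Omega (Th i) l (cond P) CPi) ->
  vsobolev Omega 1 u0 -> L2 Omega p0 -> L2 Omega T0 ->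
  time_continuous tau (vL2 Omega) (vL2norm Omega) f ->
  time_continuous tau (L2 Omega) (L2norm Omega) g ->
  time_continuous tau (L2 Omega) (L2norm Omega) Hs ->
  vp_solution Omega Gammad P tau u0 p0 T0 f g Hs u xi p T ->
  regular_solution Omega Gammad tau k l u xi p T ->
  forall (i : I) (M : nat)
    (uh Piu : nat -> 'I_d -> 'rV[R]_d -> R)
    (xih Pixi ph Pip Th_ PiT : nat -> 'rV[R]_d -> R),
  let h := mesh_size (Th i) in
  let dt := tau / M%:R in
  let t (n : nat) := n%:R * dt in
  discrete_initial_value Omega Gammad P (Th i) k l
    (u 0) (xi 0) (p 0) (T 0) (uh 0%N) (xih 0%N) (ph 0%N) (Th_ 0%N) ->
  coupled_step Omega Gammad P (Th i) k l dt (f (t 1%N)) (g (t 1%N)) (Hs (t 1%N))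
    (xih 0%N) (ph 0%N) (Th_ 0%N) (uh 1%N) (xih 1%N) (ph 1%N) (Th_ 1%N) ->
  (forall n, (1 <= n)%N -> (n.+1 <= M)%N ->
    decoupled_step Omega Gammad P (Th i) k l dt
      (f (t n.+1)) (g (t n.+1)) (Hs (t n.+1))
      (xih n.-1) (xih n) (ph n) (Th_ n)
      (uh n.+1) (xih n.+1) (ph n.+1) (Th_ n.+1)) ->
  (forall n, (n <= M)%N ->
    [/\ stokes_projection Omega Gammad P (Th i) k
          (u (t n)) (xi (t n)) (Piu n) (Pixi n),
        elliptic_projection Omega (Th i) l (perm P) (p (t n)) (Pip n) &
        elliptic_projection Omega (Th i) l (cond P) (T (t n)) (PiT n)]) ->
  let eu n := Piu n - uh n in
  let exi n := Pixi n - xih n in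
  let ep n := Pip n - ph n in
  let eT n := PiT n - Th_ n in
  let C := Ct (alpha P) (beta P) (lambda P) (a0 P) (b0 P) (c0 P) in
  let J := `]0, tau[%classic in
  let leb := @lebesgue_measure R in
  let C1 := C *
    (\int[leb]_(s in J) (vHnorm Omega 1 (traj_tt u s)) ^+ 2
     + \int[leb]_(s in J) (L2norm Omega (traj_tt xi s)) ^+ 2
     + \int[leb]_(s in J) (L2norm Omega (traj_tt p s)) ^+ 2
     + \int[leb]_(s in J) (L2norm Omega (traj_tt T s)) ^+ 2) in
  let C2 := C *
    (\int[leb]_(s in J) (Hnorm Omega k (traj_t xi s)) ^+ 2
     + \int[leb]_(s in J) (vHnorm Omega k.+1 (traj_t u s)) ^+ 2) in
  let C3 := C *
    (\int[leb]_(s in J) (Hnorm Omega l.+1 (traj_t p s)) ^+ 2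
     + \int[leb]_(s in J) (Hnorm Omega l.+1 (traj_t T s)) ^+ 2) in
  forall N, (1 <= N)%N -> (N.+1 <= M)%N ->
  mu P * (strain_norm Omega (eu N.+1)) ^+ 2
  + (L2norm Omega (exi N.+1)) ^+ 2
  + (c0 P - b0 P) / 2 * (L2norm Omega (ep N.+1)) ^+ 2
  + (a0 P - b0 P) / 2 * (L2norm Omega (eT N.+1)) ^+ 2
  + dt * \sum_(1 <= n < N.+1)
      (diff_form Omega (perm P) (ep n.+1) (ep n.+1)
       + diff_form Omega (cond P) (eT n.+1) (eT n.+1))
  <= C1 * dt ^+ 2 + C2 * h ^+ (2 * k) + C3 * h ^+ (2 * l + 2).
Proof.
have regroup (c a b s x y z w u' v p' q' L : R) : 0 <= c -> 0 <= x ->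
    L <= c * (a * (u' + v) + b * (p' + q') + s ^+ 2 * (z + w + y)) ->
    L <= c * (x + y + z + w) * s ^+ 2 + c * (v + u') * a + c * (p' + q') * b.
  move=> c0 x0 /le_trans; apply; have := mulr_ge0 (mulr_ge0 c0 x0) (sqr_ge0 s); lra.
pose Ct al be la a0 b0 c0 := stability_const al be la a0 b0 c0 * tau *
  (15 * defect_weight al be la a0 b0 c0 * (6 * CPi ^+ 2 + 4)).
exists Ct => d Omega Gammad Gamman P km kM thm thM k l I Th gamma u0 p0 T0 f g Hs u xi p T.
move=> _ dO _ _ km0 _ thm0 _ spdK spdT adm _ _ _ _ _ _ _ bndS bndK bndT _ _ _ cf cg cH sol reg.
move=> i M uh Piu xih Pixi ph Pip Th_ PiT h dt t init first later proj.
move=> eu exi ep eT C J leb C1 C2 C3 N _ NM.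
have M1 : (1 <= M)%N by exact: leq_trans NM.
have bound := error_bound dO tau_gt0 km0 thm0 spdK spdT adm (ltW CPi_gt0) (bndS i) (bndK i)
  (bndT i) cf cg cH sol reg M1 init first later proj NM.
have C0 : 0 <= C.
  have [[_ la0 al0 be0] ba bc _] := adm.
  have [[q0 _ _ _] _] :=
    defect_weight_ge (alpha P) (beta P) (lambda P) (a0 P) (b0 P) (c0 P).
  have St0 := stability_const_ge0 al0 be0 la0 ba bc.
  have K0 : 0 <= 6 * CPi ^+ 2 + 4 by rewrite addr_ge0// mulr_ge0// sqr_ge0.
  apply: mulr_ge0; first exact: mulr_ge0 St0 (ltW tau_gt0).
  by apply: mulr_ge0 K0; rewrite mulr_ge0.
have utt0 : 0 <= energy (vHnorm Omega 1) (traj_tt u) tau.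
  have [[_ _ Luu _ _] _ _ _] := reg; rewrite -(energy0 (vHnorm Omega 1) (traj_tt u)).
  exact: (energy_nd Luu (lexx 0) (ltW tau_gt0) (lexx tau)).
exact: regroup C0 utt0 bound.
Qed.
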